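(* Let $\Bbbk$ be a field and $\mathscr{C}$ an abelian monoidal category. (1) Suppose $\mathscr{C}$ has enough projectives and its tensor product is right exact in both variables. Let $\mathscr{M}$ be an abelian left $\mathscr{C}$-module category with enough projectives whose action is right exact in both variables, and let $\ell\in\mathscr{M}$ be an object such that (a) $-\triangleright\ell\colon\mathscr{C}\to\mathscr{M}$ has a right adjoint $\lfloor\ell,-\rfloor$; (b) for every projective $x\in\mathscr{C}$ the object $x\triangleright\ell$ is projective; (c) every projective object of $\mathscr{M}$ is a direct summand of an object $x\triangleright\ell$ with $x\in\mathscr{C}$ projective. Let $T$ be the monad $\lfloor\ell,-\triangleright\ell\rfloor$ on $\mathscr{C}$. Then there is an equivalence $\mathscr{M}\simeq\mathscr{C}^T$ of $\mathscr{C}$-module categories, where the $\mathscr{C}$-module structure of the category $\mathscr{C}^T$ of $T$-modules is extended from the Kleisli category. Furthermore, the assignments $(\mathscr{M},\ell)\mapsto\lfloor\ell,-\triangleright\ell\rfloor$ and $T\mapsto(\mathscr{C}^T,T1)$ give mutually inverse bijections between pairs $(\mathscr{M},\ell)$, consisting of an abelian left $\mathscr{C}$-module category $\mathscr{M}$ with enough projectives whose action is right exact in both variables and an object $\ell\in\mathscr{M}$ satisfying (a), (b) and (c), modulo equivalence $\mathscr{M}\simeq\mathscr{N}$ of $\mathscr{C}$-module categories, and right exact lax $\mathscr{C}$-module monads on $\mathscr{C}$ modulo equivalence $\mathscr{C}^T\simeq\mathscr{C}^S$ of $\mathscr{C}$-module categories. (2) Dually, suppose $\mathscr{C}$ has enough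 injectives and its tensor product is left exact in both variables. Let $\mathscr{M}$ be an abelian left $\mathscr{C}$-module category with enough injectives whose action is left exact in both variables, and let $\ell\in\mathscr{M}$ be such that (a) $-\triangleright\ell$ has a left adjoint $\lceil\ell,-\rceil$; (b) for every injective $x\in\mathscr{C}$ the object $x\triangleright\ell$ is injective; (c) every injective object of $\mathscr{M}$ is a direct summand of some $x\triangleright\ell$ with $x\in\mathscr{C}$ injective. Let $S$ be the comonad $\lceil\ell,-\triangleright\ell\rceil$ on $\mathscr{C}$. Then $\mathscr{M}\simeq\mathscr{C}^S$ as $\mathscr{C}$-module categories, where the $\mathscr{C}$-module structure of the category $\mathscr{C}^S$ of $S$-comodules is extended from the Kleisli category of $S$; and $(\mathscr{M},\ell)\mapsto\lceil\ell,-\triangleright\ell\rceil$, $S\mapsto(\mathscr{C}^S,S1)$ give mutually inverse bijections between pairs $(\mathscr{M},\ell)$, consisting of an abelian left $\mathscr{C}$-module category $\mathscr{M}$ with enough injectives whose action is left exact in both variables and an object $\ell\in\mathscr{M}$ satisfying the conditions (a), (b) and (c) of this part (2), modulo $\mathscr{M}\simeq\mathscr{N}$ and left exact oplax $\mathscr{C}$-module comonads on $\mathscr{C}$ modulo $\mathscr{C}^S\simeq\mathscr{C}^G$.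
   Context: All categories and functors are $\Bbbk$-linear. A lax $\mathscr{C}$-module monad on a $\mathscr{C}$-module category $\mathscr{M}$ (here $\mathscr{M}=\mathscr{C}$ with the regular action) is a monad $(T,\mu,\eta)$ with a lax $\mathscr{C}$-module structure $T_{\mathsf a;x,m}\colon x\triangleright Tm\to T(x\triangleright m)$ for which $\mu,\eta$ are $\mathscr{C}$-module transformations; an oplax $\mathscr{C}$-module comonad is defined dually with $S_{\mathsf a;x,m}\colon S(x\triangleright m)\to x\triangleright Sm$. Since $-\triangleright\ell$ is a strong $\mathscr{C}$-module functor, its right adjoint is canonically lax and its left adjoint canonically oplax, so that $\lfloor\ell,-\triangleright\ell\rfloor$ is a lax $\mathscr{C}$-module monad and $\lceil\ell,-\triangleright\ell\rceil$ an oplax $\mathscr{C}$-module comonad. The Kleisli category $\mathscr{C}_T$ (objects those of $\mathscr{C}$, $\mathscr{C}_T(m,n)=\mathscr{C}(m,Tn)$) is a $\mathscr{C}$-module category with $x\triangleright m=x\otimes m$ on objects and $x\triangleright f=T_{\mathsf a;x,n}\circ(x\otimes f)$ for $f\colon m\to Tn$. For right exact $T$, $\mathscr{C}^T$ carries an (essentially unique) $\mathscr{C}$-module structure, right exact in each variable, for which the inclusion $\mathscr{C}_T\to\mathscr{C}^T$, $m\mapsto(Tm,\mu_m)$, is a strong $\mathscr{C}$-module functor; explicitly $x\blacktriangleright(m,\nabla_m)$ is the coequaliser in $\mathscr{C}^T$ of $T(x\otimes\nabla_m)$ and $\mu_{x\otimes m}\circ T(T_{\mathsf a;x,m})\colon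 T(x\otimes Tm)\rightrightarrows T(x\otimes m)$. This is the structure ''extended from the Kleisli category''. The extended structure on $\mathscr{C}^S$ for a left exact oplax $\mathscr{C}$-module comonad $S$ is defined dually, by equalisers. *)

(* Defs.v *)
From HB Require Import structures.
Set Warnings "-notation-overridden,-ambiguous-paths,-redundant-canonical-projection,-projection-no-head-constant".
From mathcomp Require Import all_boot all_algebra.
Import GRing.Theory.
Local Open Scope ring_scope.

Set Implicit Arguments.
Unset Strict Implicit.
Unset Printing Implicit Defensive.

Declare Scope cat_scope.
Delimit Scope cat_scope with cat.
Local Open Scope cat_scope.

Record category (k : fieldType) := Category {
  ob :> Type;
  hom : ob -> ob -> lmodType k;
  idm : forall a, hom a a;
  comp : forall a b c, hom b c -> hom a b -> hom a c;
  compA : forall a b c d (h : hom c d) (g : hom b c) (f : hom a b),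
    comp h (comp g f) = comp (comp h g) f;
  comp1m : forall a b (f : hom a b), comp (idm b) f = f;
  compm1 : forall a b (f : hom a b), comp f (idm a) = f;
  comp_linl : forall a b c (f : hom a b), linear (fun g : hom b c => comp g f);
  comp_linr : forall a b c (g : hom b c), linear (fun f : hom a b => comp g f)
}.

Arguments hom {k} {_} a b.
Arguments idm {k} {_} a.
Arguments comp {k} {_ _ _ _} g f.
Arguments compA {k} {_ _ _ _ _} h g f.
Arguments comp1m {k} {_ _ _} f.
Arguments compm1 {k} {_ _ _} f.

Notation "g ∘ f" := (comp g f) (at level 40, left associativity) : cat_scope.
Notation "1_ a" := (idm a) (at level 8, a at level 2, format "1_ a") : cat_scope.

(* Compositions are normalised to the left; these lemmas rewrite with an
   equation between composites in the middle of such a composition. *)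
Lemma reA k (C : category k) (a b c d : C) (g : hom b c) (f : hom a b) e :
  g ∘ f = e -> forall h : hom c d, h ∘ g ∘ f = h ∘ e.
Proof. by move=> <- h; rewrite compA. Qed.

Lemma reA3 k (C : category k) (a b c d e : C) (h : hom c d) (g : hom b c)
    (f : hom a b) r :
  h ∘ g ∘ f = r -> forall i : hom d e, i ∘ h ∘ g ∘ f = i ∘ r.
Proof. by move=> <- i; rewrite !compA. Qed.

Record iso k (C : category k) (a b : C) := Iso {
  fwd : hom a b;
  bwd : hom b a;
  bwdK : bwd ∘ fwd = 1_a;
  fwdK : fwd ∘ bwd = 1_b
}.

Definition iso_sym k (C : category k) (a b : C) (i : iso a b) : iso b a :=
  Iso (fwdK i) (bwdK i).

Lemma fwd_inj k (C : category k) (a b c : C) (i : iso b c) (f g : hom a b) :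
  fwd i ∘ f = fwd i ∘ g -> f = g.
Proof.
by move=> e; rewrite -[f]comp1m -[g]comp1m -(bwdK i) -!compA e.
Qed.

Lemma fwd_surj k (C : category k) (a b c : C) (i : iso a b) (f g : hom b c) :
  f ∘ fwd i = g ∘ fwd i -> f = g.
Proof.
by move=> e; rewrite -[f]compm1 -[g]compm1 -(fwdK i) !compA e.
Qed.

Record functor k (C D : category k) := Functor {
  fob :> C -> D;
  fmap : forall a b, hom a b -> hom (fob a) (fob b);
  fmap_lin : forall a b, linear (@fmap a b);
  fmap1 : forall a, fmap (1_a) = 1_(fob a);
  fmapM : forall a b c (g : hom b c) (f : hom a b),
    fmap (g ∘ f) = fmap g ∘ fmap f
}.

Arguments fmap {k C D} f {a b} _ : rename.
Arguments fmap1 {k C D} f a : rename.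
Arguments fmapM {k C D} f {a b c} _ _ : rename.

Definition fid k (C : category k) : functor C C.
Proof. by exists id (fun a b f => f). Defined.

Definition fcomp k (A B C : category k) (G : functor B C) (F : functor A B) :
  functor A C.
Proof.
exists (fun a => G (F a)) (fun a b f => fmap G (fmap F f)).
- by move=> a b l f g; rewrite !fmap_lin.
- by move=> a; rewrite !fmap1.
- by move=> a b c g f; rewrite !fmapM.
Defined.

Definition natural k (C D : category k) (F G : functor C D)
    (t : forall a, hom (F a) (G a)) : Prop :=
  forall a b (f : hom a b), t b ∘ fmap F f = fmap G f ∘ t a.

Record nat_iso k (C D : category k) (F G : functor C D) := NatIso {
  niso : forall a, iso (F a) (G a);
  niso_nat : natural (fun a => fwd (niso a))
}.

Definition is_equivalence k (C D : category k) (F : functor C D) : Prop :=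
  exists G : functor D C,
    inhabited (nat_iso (fcomp G F) (fid C)) /\
    inhabited (nat_iso (fcomp F G) (fid D)).

Record adjunction k (C D : category k) (F : functor C D) (G : functor D C) :=
  Adjunction {
  adj_unit : forall a, hom a (G (F a));
  adj_counit : forall b, hom (F (G b)) b;
  unit_nat : natural (F := fid C) (G := fcomp G F) adj_unit;
  counit_nat : natural (F := fcomp F G) (G := fid D) adj_counit;
  counit_unit : forall a, adj_counit (F a) ∘ fmap F (adj_unit a) = 1_(F a);
  unit_counit : forall b, fmap G (adj_counit b) ∘ adj_unit (G b) = 1_(G b)
}.

Section Abelian.
Context (k : fieldType) (C : category k).

(* Homs are never empty, so being initial and terminal means that all maps
   out of and into the object vanish. *)
Definition is_zero (z : C) : Prop :=
  (forall a (f : hom z a), f = 0) /\ (forall a (f : hom a z), f = 0).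

Record is_biproduct (a b s : C) (i : hom a s) (j : hom b s) (p : hom s a)
    (q : hom s b) : Prop := IsBiproduct {
  bip_pi : p ∘ i = 1_a;
  bip_qj : q ∘ j = 1_b;
  bip_pj : p ∘ j = 0;
  bip_qi : q ∘ i = 0;
  bip_sum : i ∘ p + j ∘ q = 1_s
}.

Definition is_kernel (a b c : C) (f : hom a b) (g : hom b c) : Prop :=
  g ∘ f = 0 /\
  forall d (h : hom d b), g ∘ h = 0 -> exists! h' : hom d a, f ∘ h' = h.

Definition is_cokernel (a b c : C) (f : hom a b) (g : hom b c) : Prop :=
  g ∘ f = 0 /\
  forall d (h : hom b d), h ∘ f = 0 -> exists! h' : hom c d, h' ∘ g = h.

Definition is_mono (a b : C) (f : hom a b) : Prop :=
  forall c (g h : hom c a), f ∘ g = f ∘ h -> g = h.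

Definition is_epi (a b : C) (f : hom a b) : Prop :=
  forall c (g h : hom b c), g ∘ f = h ∘ f -> g = h.

Record abelian : Prop := Abelian {
  ab_zero : exists z : C, is_zero z;
  ab_biproduct : forall a b : C, exists (s : C) (i : hom a s) (j : hom b s)
    (p : hom s a) (q : hom s b), is_biproduct i j p q;
  ab_kernel : forall (b c : C) (g : hom b c),
    exists (a : C) (f : hom a b), is_kernel f g;
  ab_cokernel : forall (a b : C) (f : hom a b),
    exists (c : C) (g : hom b c), is_cokernel f g;
  ab_mono : forall (a b : C) (f : hom a b), is_mono f ->
    exists (c : C) (g : hom b c), is_kernel f g;
  ab_epi : forall (b c : C) (g : hom b c), is_epi g ->
    exists (a : C) (f : hom a b), is_cokernel f g
}.

Definition projective (p : C) : Prop :=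
  forall (a b : C) (e : hom a b) (f : hom p b), is_epi e ->
    exists f' : hom p a, e ∘ f' = f.

Definition injective_ob (q : C) : Prop :=
  forall (a b : C) (i : hom a b) (f : hom a q), is_mono i ->
    exists f' : hom b q, f' ∘ i = f.

Definition enough_projectives : Prop :=
  forall a : C, exists (p : C) (e : hom p a), projective p /\ is_epi e.

Definition enough_injectives : Prop :=
  forall a : C, exists (q : C) (i : hom a q), injective_ob q /\ is_mono i.

Definition direct_summand (a s : C) : Prop :=
  exists (b : C) (i : hom a s) (j : hom b s) (p : hom s a) (q : hom s b),
    is_biproduct i j p q.

End Abelian.

(* All functors are k-linear, hence preserve biproducts; such a functor
   preserves finite colimits (limits) iff it preserves cokernels (kernels). *)
Definition right_exact k (C D : category k) (F : functor C D) : Prop :=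
  forall (a b c : C) (f : hom a b) (g : hom b c),
    is_cokernel f g -> is_cokernel (fmap F f) (fmap F g).

Definition left_exact k (C D : category k) (F : functor C D) : Prop :=
  forall (a b c : C) (f : hom a b) (g : hom b c),
    is_kernel f g -> is_kernel (fmap F f) (fmap F g).

Record bifunctor k (A B C : category k) := Bifunctor {
  bob :> A -> B -> C;
  bmap : forall a a' b b', hom a a' -> hom b b' -> hom (bob a b) (bob a' b');
  bmap_linl : forall a a' b b' (g : hom b b'),
    linear (fun f : hom a a' => bmap f g);
  bmap_linr : forall a a' b b' (f : hom a a'),
    linear (fun g : hom b b' => bmap f g);
  bmap1 : forall a b, bmap (1_a) (1_b) = 1_(bob a b);
  bmapM : forall a a' a'' b b' b'' (f' : hom a' a'') (f : hom a a')
    (g' : hom b' b'') (g : hom b b'),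
    bmap (f' ∘ f) (g' ∘ g) = bmap f' g' ∘ bmap f g
}.

Arguments bmap {k} {_ _ _} _ {_ _ _ _} _ _.
Arguments bmap1 {k} {_ _ _} _ _ _.
Arguments bmapM {k} {_ _ _} _ {_ _ _ _ _ _} _ _ _ _.

Definition bif_left k (A B C : category k) (H : bifunctor A B C) (a : A) :
  functor B C.
Proof.
exists (H a) (fun b b' g => bmap H (1_a) g).
- by move=> b b' l f g; rewrite bmap_linr.
- by move=> b; rewrite bmap1.
- by move=> b b' b'' g f; rewrite -bmapM comp1m.
Defined.

Definition bif_right k (A B C : category k) (H : bifunctor A B C) (b : B) :
  functor A C.
Proof.
exists (fun a => H a b) (fun a a' f => bmap H f (1_b)).
- by move=> a a' l f g; rewrite bmap_linl.
- by move=> a; rewrite bmap1.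
- by move=> a a' a'' g f; rewrite -bmapM comp1m.
Defined.

Definition right_exact2 k (A B C : category k) (H : bifunctor A B C) : Prop :=
  (forall a, right_exact (bif_left H a)) /\
  (forall b, right_exact (bif_right H b)).

Definition left_exact2 k (A B C : category k) (H : bifunctor A B C) : Prop :=
  (forall a, left_exact (bif_left H a)) /\
  (forall b, left_exact (bif_right H b)).

Record monoidal_category (k : fieldType) := MonoidalCategory {
  mcat :> category k;
  tens : bifunctor mcat mcat mcat;
  tunit : mcat;
  tassoc : forall x y z, iso (tens (tens x y) z) (tens x (tens y z));
  lunit : forall x, iso (tens tunit x) x;
  runit : forall x, iso (tens x tunit) x;
  tassoc_nat : forall x x' y y' z z' (f : hom x x') (g : hom y y')
    (h : hom z z'),
    fwd (tassoc x' y' z') ∘ bmap tens (bmap tens f g) h =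
    bmap tens f (bmap tens g h) ∘ fwd (tassoc x y z);
  lunit_nat : forall x x' (f : hom x x'),
    fwd (lunit x') ∘ bmap tens (1_tunit) f = f ∘ fwd (lunit x);
  runit_nat : forall x x' (f : hom x x'),
    fwd (runit x') ∘ bmap tens f (1_tunit) = f ∘ fwd (runit x);
  pentagon : forall x y z t,
    fwd (tassoc x y (tens z t)) ∘ fwd (tassoc (tens x y) z t) =
    bmap tens (1_x) (fwd (tassoc y z t)) ∘ fwd (tassoc x (tens y z) t)
      ∘ bmap tens (fwd (tassoc x y z)) (1_t);
  triangle : forall x y,
    bmap tens (1_x) (fwd (lunit y)) ∘ fwd (tassoc x tunit y) =
    bmap tens (fwd (runit x)) (1_y)
}.

Arguments tens {k m} : rename.
Arguments tunit {k m} : rename.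
Arguments tassoc {k m} x y z : rename.
Arguments lunit {k m} x : rename.
Arguments runit {k m} x : rename.

Notation "x ⊗ y" := (bob tens x y) (at level 35, right associativity)
  : cat_scope.
Notation "f ⊗h g" := (bmap tens f g) (at level 35, right associativity)
  : cat_scope.

Record module_structure k (C : monoidal_category k) (M : category k) :=
  ModuleStructure {
  act : bifunctor C M M;
  aassoc : forall x y m, iso (act (x ⊗ y) m) (act x (act y m));
  aunit : forall m, iso (act tunit m) m;
  aassoc_nat : forall x x' y y' m m' (f : hom x x') (g : hom y y')
    (h : hom m m'),
    fwd (aassoc x' y' m') ∘ bmap act (f ⊗h g) h =
    bmap act f (bmap act g h) ∘ fwd (aassoc x y m);
  aunit_nat : forall m m' (f : hom m m'),
    fwd (aunit m') ∘ bmap act (1_tunit) f = f ∘ fwd (aunit m);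
  apentagon : forall x y z m,
    fwd (aassoc x y (act z m)) ∘ fwd (aassoc (x ⊗ y) z m) =
    bmap act (1_x) (fwd (aassoc y z m)) ∘ fwd (aassoc x (y ⊗ z) m)
      ∘ bmap act (fwd (tassoc x y z)) (1_m);
  atriangle : forall x m,
    bmap act (1_x) (fwd (aunit m)) ∘ fwd (aassoc x tunit m) =
    bmap act (fwd (runit x)) (1_m)
}.

Record module_category k (C : monoidal_category k) := ModuleCategory {
  modcat :> category k;
  modstr : module_structure C modcat
}.

Notation "x ▷ m" := (bob (act (modstr _)) x m)
  (at level 35, right associativity) : cat_scope.
Notation "f ▷h g" := (bmap (act (modstr _)) f g)
  (at level 35, right associativity) : cat_scope.
Notation aso x y m := (aassoc (modstr _) x y m).
Notation uno m := (aunit (modstr _) m).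

Definition regular k (C : monoidal_category k) : module_category C.
Proof.
exists C; exists (@tens k C) tassoc lunit.
- exact: tassoc_nat.
- exact: lunit_nat.
- exact: pentagon.
- exact: triangle.
Defined.

Section ModuleFunctors.
Context (k : fieldType) (C : monoidal_category k) (M N : module_category C).

Record is_lax (F : functor M N) (s : forall x m, hom (x ▷ F m) (F (x ▷ m))) :
  Prop := IsLax {
  lax_nat : forall x x' m m' (f : hom x x') (g : hom m m'),
    s x' m' ∘ (f ▷h fmap F g) = fmap F (f ▷h g) ∘ s x m;
  lax_assoc : forall x y m,
    fmap F (fwd (aso x y m)) ∘ s (x ⊗ y) m =
    s x (y ▷ m) ∘ (1_x ▷h s y m) ∘ fwd (aso x y (F m));
  lax_unit : forall m, fmap F (fwd (uno m)) ∘ s tunit m = fwd (uno (F m))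
}.

Record is_oplax (F : functor M N) (s : forall x m, hom (F (x ▷ m)) (x ▷ F m)) :
  Prop := IsOplax {
  oplax_nat : forall x x' m m' (f : hom x x') (g : hom m m'),
    s x' m' ∘ fmap F (f ▷h g) = (f ▷h fmap F g) ∘ s x m;
  oplax_assoc : forall x y m,
    fwd (aso x y (F m)) ∘ s (x ⊗ y) m =
    (1_x ▷h s y m) ∘ s x (y ▷ m) ∘ fmap F (fwd (aso x y m));
  oplax_unit : forall m, fwd (uno (F m)) ∘ s tunit m = fmap F (fwd (uno m))
}.

Record strong_structure (F : functor M N) := StrongStructure {
  strong : forall x m, iso (x ▷ F m) (F (x ▷ m));
  strongP : is_lax (fun x m => fwd (strong x m))
}.

Definition module_equivalent : Prop :=
  exists F : functor M N, inhabited (strong_structure F) /\ is_equivalence F.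

End ModuleFunctors.

Section ActOn.
Context (k : fieldType) (C : monoidal_category k).

Section Kelly.
Context (M : module_category C).

Lemma act_faithful1 (a b : M) (f g : hom a b) :
  (1_(@tunit k C) ▷h f) = (1_tunit ▷h g) -> f = g.
Proof.
move=> e; have := aunit_nat (modstr M) f; rewrite e aunit_nat => e'.
by rewrite -[f]compm1 -[g]compm1 -(fwdK (uno a)) !compA e'.
Qed.

Lemma aunit_tens (x : C) (m : M) :
  fwd (uno (x ▷ m)) ∘ fwd (aso tunit x m) = (fwd (lunit x) ▷h 1_m).
Proof.
apply: act_faithful1.
pose A := fwd (aso tunit (tunit ⊗ x) m); pose B := fwd (tassoc tunit tunit x) ▷h 1_m.
have AB : (1_tunit ▷h (fwd (uno (x ▷ m)) ∘ fwd (aso tunit x m))) ∘ A ∘ B =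
          (1_tunit ▷h (fwd (lunit x) ▷h 1_m)) ∘ A ∘ B.
  rewrite -[in LHS](comp1m (1_tunit)) bmapM -[RHS]compA.
  rewrite (reA3 (esym (apentagon _ _ _ _ _))) compA atriangle.
  rewrite -[1_(x ▷ m)]bmap1 -aassoc_nat.
  rewrite compA -aassoc_nat.
  rewrite -[RHS]compA /B -bmapM triangle compm1.
  by [].
apply: (fwd_surj (i := aso tunit (tunit ⊗ x) m)).
have cB : B ∘ (bwd (tassoc tunit tunit x) ▷h 1_m) = 1_ _.
  by rewrite /B -bmapM fwdK compm1 bmap1.
by rewrite -[LHS]compm1 -[RHS]compm1 -cB !compA AB.
Qed.

End Kelly.

Context (M : module_category C) (l : M).

Definition act_on : functor (regular C) M := bif_right (act (modstr M)) l.

Definition act_on_strong : strong_structure act_on.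
Proof.
exists (fun x y : C => iso_sym (aso x y l)); split=> /=.
- move=> x x' y y' f g.
  have e := aassoc_nat (modstr M) f g (1_l).
  rewrite -[LHS]compm1 -(fwdK (aso x y l)) !compA.
  by rewrite (reA (esym e)) !compA bwdK comp1m.
- move=> x y z; apply: (fwd_surj (i := aso (x ⊗ y) z l)).
  rewrite -!compA bwdK compm1; apply: (fwd_inj (i := aso x (y ⊗ z) l)).
  rewrite !compA fwdK comp1m (reA (apentagon _ _ _ _ _)) !compA -bmapM bwdK.
  by rewrite compm1 bmap1 comp1m.
- move=> y.
  by rewrite -aunit_tens (reA (fwdK _)) compm1.
Defined.

End ActOn.

(* The solutions of a linear equation, as a k-module: maps of (co)modules are
   the maps of underlying objects satisfying such an equation. *)
Record lin_eq (k : fieldType) (V W : lmodType k) (f g : V -> W)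
    (lf : linear f) (lg : linear g) := LinEq {
  lin_val :> V;
  lin_valP : f lin_val == g lin_val
}.

Section LinEq.
Context (k : fieldType) (V W : lmodType k) (f g : V -> W)
  (lf : linear f) (lg : linear g).

Definition lin_eq_pred : {pred V} := fun v => f v == g v.

Lemma lin_eq_closed : submod_closed lin_eq_pred.
Proof.
split=> [|c u v]; rewrite !unfold_in.
  have lin0 (h : V -> W) : linear h -> h 0 = 0.
    by move=> lh; rewrite -[0 in LHS](addNr 0) -scaleN1r lh scaleN1r addNr.
  by rewrite !lin0.
by move=> /eqP eu /eqP ev; rewrite lf lg eu ev.
Qed.

HB.instance Definition _ :=
  [isSub of lin_eq lf lg for @lin_val k V W f g lf lg].
HB.instance Definition _ := [Choice of lin_eq lf lg by <:].
HB.instance Definition _ :=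
  GRing.SubChoice_isSubLmodule.Build k V lin_eq_pred (lin_eq lf lg)
    lin_eq_closed.
End LinEq.

Record lax_module_monad k (C : monoidal_category k) (M : module_category C) :=
  LaxModuleMonad {
  mon :> functor M M;
  mu : forall m, hom (mon (mon m)) (mon m);
  eta : forall m, hom m (mon m);
  mu_nat : natural (F := fcomp mon mon) (G := mon) mu;
  eta_nat : natural (F := fid M) (G := mon) eta;
  mu_assoc : forall m, mu m ∘ fmap mon (mu m) = mu m ∘ mu (mon m);
  mu_etal : forall m, mu m ∘ eta (mon m) = 1_(mon m);
  mu_etar : forall m, mu m ∘ fmap mon (eta m) = 1_(mon m);
  lax : forall x m, hom (x ▷ mon m) (mon (x ▷ m));
  laxP : is_lax lax;
  lax_eta : forall x m, lax x m ∘ (1_x ▷h eta m) = eta (x ▷ m);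
  lax_mu : forall x m,
    lax x m ∘ (1_x ▷h mu m) =
    mu (x ▷ m) ∘ fmap mon (lax x m) ∘ lax x (mon m)
}.

Arguments mu {k C M} T m : rename.
Arguments eta {k C M} T m : rename.
Arguments lax {k C M} T x m : rename.

Section Monad.
Context (k : fieldType) (C : monoidal_category k) (M : module_category C)
  (T : lax_module_monad M).

Lemma mu_natE a b (f : hom a b) :
  mu T b ∘ fmap T (fmap T f) = fmap T f ∘ mu T a.
Proof. exact: mu_nat. Qed.

Lemma eta_natE a b (f : hom a b) : eta T b ∘ f = fmap T f ∘ eta T a.
Proof. exact: eta_nat. Qed.

Record tmod := TMod {
  tm_ob :> M;
  tm_act : hom (T tm_ob) tm_ob;
  tm_unit : tm_act ∘ eta T tm_ob = 1_tm_ob;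
  tm_assoc : tm_act ∘ mu T tm_ob = tm_act ∘ fmap T tm_act
}.

Lemma tm_linl (A B : tmod) : linear (fun f : hom A B => f ∘ tm_act A).
Proof. exact: comp_linl. Qed.

Lemma tm_linr (A B : tmod) : linear (fun f : hom A B => tm_act B ∘ fmap T f).
Proof. by move=> l f g; rewrite fmap_lin comp_linr. Qed.

Definition tm_hom (A B : tmod) : lmodType k := lin_eq (@tm_linl A B) (@tm_linr A B).

Lemma tm_homP (A B : tmod) (f : tm_hom A B) :
  lin_val f ∘ tm_act A = tm_act B ∘ fmap T (lin_val f).
Proof. exact/eqP/(lin_valP f). Qed.

Definition tm_mk (A B : tmod) (f : hom (tm_ob A) (tm_ob B))
  (e : f ∘ tm_act A = tm_act B ∘ fmap T f) : tm_hom A B :=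
  @LinEq _ _ _ _ _ (@tm_linl A B) (@tm_linr A B) f (introT eqP e).

Lemma tm_id_subproof (A : tmod) :
  1_(tm_ob A) ∘ tm_act A = tm_act A ∘ fmap T (1_(tm_ob A)).
Proof. by rewrite fmap1 comp1m compm1. Qed.

Lemma tm_comp_subproof (A B D : tmod) (g : tm_hom B D) (f : tm_hom A B) :
  lin_val g ∘ lin_val f ∘ tm_act A = tm_act D ∘ fmap T (lin_val g ∘ lin_val f).
Proof. by rewrite fmapM (reA (tm_homP f)) !compA tm_homP. Qed.

Definition modules : category k.
Proof.
exists tmod tm_hom (fun A => tm_mk (tm_id_subproof A))
  (fun A B D g f => tm_mk (tm_comp_subproof g f)).
- by move=> *; apply/val_inj; rewrite /= compA.
- by move=> *; apply/val_inj; rewrite /= comp1m.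
- by move=> *; apply/val_inj; rewrite /= compm1.
- by move=> a b c f l g h; apply/val_inj; rewrite /= comp_linl.
- by move=> a b c f l g h; apply/val_inj; rewrite /= comp_linr.
Defined.

Definition free_module (m : M) : modules :=
  @TMod (T m) (mu T m) (mu_etal T m) (esym (mu_assoc T m)).

Definition kleisli_cat : category k.
Proof.
exists (ob M) (fun m n => hom m (T n)) (fun m => eta T m)
  (fun a b c g f => mu T c ∘ fmap T g ∘ f).
- move=> a b c d h g f; rewrite !fmapM !compA.
  by rewrite mu_assoc (reA (mu_natE h)) !compA.
- by move=> a b f; rewrite mu_etar comp1m.
- by move=> a b f; rewrite (reA (esym (eta_natE f))) compA mu_etal comp1m.
- by move=> a b c f l g h /=; rewrite fmap_lin comp_linr comp_linl.
- by move=> a b c g l f h /=; rewrite comp_linr.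
Defined.

Lemma kleisli_compE (a b c : kleisli_cat) (g : hom b c) (f : hom a b) :
  g ∘ f = comp (mu T c) (fmap T (g : hom (b : M) (T c)))
            ∘ (f : hom (a : M) (T b)) :> hom (a : M) (T c).
Proof. by []. Qed.

Definition kleisli_act : bifunctor C kleisli_cat kleisli_cat.
Proof.
refine (@Bifunctor k C kleisli_cat kleisli_cat
  (fun x (m : M) => x ▷ m)
  (fun x x' m m' f (g : hom (m : M) (T m')) => lax T x' m' ∘ (f ▷h g))
  _ _ _ _).
- by move=> x x' m m' g l f h /=; rewrite bmap_linl comp_linr.
- by move=> x x' m m' f l g h /=; rewrite bmap_linr comp_linr.
- by move=> x m /=; rewrite lax_eta.
- move=> x x' x'' a b c f' f g' g; rewrite kleisli_compE /=.
  have -> : (f' ∘ f) ▷h (comp (mu T c) (fmap T g') ∘ g) =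
      comp (1_x'' ▷h mu T c) (f' ▷h fmap T g') ∘ (f ▷h g).
    by rewrite -!bmapM !comp1m.
  rewrite fmapM !compA lax_mu.
  by rewrite (reA (lax_nat (laxP T) f' g')) !compA.
Defined.

Definition kl (a b : M) (u : hom a b) : @hom k kleisli_cat a b := eta T b ∘ u.

Lemma kl_compl (a b c : M) (u : hom b c) (f : hom a (T b)) :
  (kl u ∘ (f : @hom k kleisli_cat a b) : @hom k kleisli_cat a c) = fmap T u ∘ f.
Proof. by rewrite kleisli_compE /kl fmapM compA mu_etar comp1m. Qed.

Lemma kl_compr (a b c : M) (g : hom b (T c)) (u : hom a b) :
  ((g : @hom k kleisli_cat b c) ∘ kl u : @hom k kleisli_cat a c) = g ∘ u.
Proof.
by rewrite kleisli_compE /kl compA (reA (esym (eta_natE _))) compA mu_etal comp1m.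
Qed.

Lemma klM (a b c : M) (v : hom b c) (u : hom a b) :
  kl (v ∘ u) = kl v ∘ kl u :> @hom k kleisli_cat a c.
Proof. by rewrite kl_compr /kl compA. Qed.

Lemma kl1 (a : M) : kl (1_a) = @idm k kleisli_cat a.
Proof. exact: (compm1 (eta T a)). Qed.

Lemma kl_act (x x' : C) (a b : M) (f : hom x x') (u : hom a b) :
  bmap kleisli_act f (kl u) = kl (f ▷h u).
Proof.
rewrite /= /kl -(comp1m f) bmapM compA lax_eta.
by rewrite comp1m.
Qed.

Definition kleisli_iso (a b : M) (i : iso a b) : @iso k kleisli_cat a b.
Proof.
exists (kl (fwd i)) (kl (bwd i)).
- by rewrite -klM bwdK kl1.
- by rewrite -klM fwdK kl1.
Defined.

Lemma fwd_kl (a b : M) (i : iso a b) : fwd (kleisli_iso i) = kl (fwd i).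
Proof. by []. Qed.

Definition kleisli_str : module_structure C kleisli_cat.
Proof.
exists kleisli_act (fun x y m => kleisli_iso (aso x y m))
  (fun m => kleisli_iso (uno m)).
- move=> x x' y y' m m' f g h; rewrite kl_compl kl_compr /=.
  rewrite compA (lax_assoc (laxP T)) -[RHS]compA.
  rewrite -[f in RHS](comp1m f) bmapM -!compA; congr (_ ∘ (_ ∘ _)).
  exact: aassoc_nat.
- move=> m m' f; rewrite kl_compl kl_compr /=.
  by rewrite compA (lax_unit (laxP T)) aunit_nat.
- move=> x y z m; rewrite -[@idm k kleisli_cat m]kl1 !fwd_kl !kl_act -!klM.
  by rewrite apentagon.
- move=> x m; rewrite -[@idm k kleisli_cat m]kl1 !fwd_kl !kl_act -!klM.
  by rewrite atriangle.
Defined.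

Definition kleisli : module_category C := ModuleCategory kleisli_str.

Lemma kleisli_incl_subproof (a b : M) (f : hom a (T b)) :
  mu T b ∘ fmap T f ∘ mu T a = mu T b ∘ fmap T (mu T b ∘ fmap T f).
Proof. by rewrite fmapM compA mu_assoc -!compA mu_natE. Qed.

Definition kleisli_incl : functor kleisli modules.
Proof.
refine (@Functor k kleisli_cat modules free_module
  (fun a b (f : hom (a : M) (T b)) =>
    @tm_mk (free_module a) (free_module b) _ (kleisli_incl_subproof f)) _ _ _).
- by move=> a b l f g; apply/val_inj; rewrite /= fmap_lin comp_linr.
- by move=> a; apply/val_inj; rewrite /= mu_etar.
- move=> a b c g f; apply/val_inj; rewrite /= !fmapM !compA.
  by rewrite mu_assoc (reA (mu_natE g)) !compA.
Defined.

(* The module structure on the category of T-modules extended from the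
   Kleisli category; it is determined up to equivalence by these properties. *)
Record extended_from_kleisli (E : module_structure C modules) : Prop :=
  ExtendedFromKleisli {
  ext_exact : right_exact2 (act E);
  ext_incl : inhabited
    (@strong_structure k C kleisli (ModuleCategory E) kleisli_incl)
}.

End Monad.

Section StrongLemmas.
Context (k : fieldType) (C : monoidal_category k) (M N : module_category C)
  (F : functor M N) (s : strong_structure F).
Local Notation φ x m := (fwd (strong s x m)).
Local Notation ψ x m := (bwd (strong s x m)).

Lemma strong_nat x x' m m' (f : hom x x') (g : hom m m') :
  φ x' m' ∘ (f ▷h fmap F g) = fmap F (f ▷h g) ∘ φ x m.
Proof. exact: (lax_nat (strongP s) f g). Qed.

Lemma strong_assoc x y m : fmap F (fwd (aso x y m)) ∘ φ (x ⊗ y) m =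
  φ x (y ▷ m) ∘ (1_x ▷h φ y m) ∘ fwd (aso x y (F m)).
Proof. exact: (lax_assoc (strongP s)). Qed.

Lemma strong_unit m : fmap F (fwd (uno m)) ∘ φ tunit m = fwd (uno (F m)).
Proof. exact: (lax_unit (strongP s)). Qed.

Lemma strong_bwd_nat x x' m m' (f : hom x x') (g : hom m m') :
  ψ x' m' ∘ fmap F (f ▷h g) = (f ▷h fmap F g) ∘ ψ x m.
Proof.
rewrite -[LHS]compm1 -(fwdK (strong s x m)) compA (reA (esym (strong_nat f g))).
by rewrite compA bwdK comp1m.
Qed.

Lemma strong_bwd_assoc x y m : fwd (aso x y (F m)) ∘ ψ (x ⊗ y) m =
  (1_x ▷h ψ y m) ∘ ψ x (y ▷ m) ∘ fmap F (fwd (aso x y m)).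
Proof.
apply: (fwd_surj (i := strong s (x ⊗ y) m)).
rewrite (reA (strong_assoc _ _ _)) !compA (reA (bwdK _)) compm1.
rewrite (reA (bwdK _)) compm1.
by rewrite -bmapM bwdK comp1m bmap1 comp1m.
Qed.

End StrongLemmas.

Section AdjunctionLemmas.
Context (k : fieldType) (C D : category k) (F : functor C D) (G : functor D C)
  (adj : adjunction F G).
Local Notation η := (adj_unit adj).
Local Notation ε := (adj_counit adj).

Lemma unit_natE a b (f : hom a b) : η b ∘ f = fmap G (fmap F f) ∘ η a.
Proof. exact: (unit_nat adj). Qed.

Lemma counit_natE a b (f : hom a b) : ε b ∘ fmap F (fmap G f) = f ∘ ε a.
Proof. exact: (counit_nat adj). Qed.

Lemma adj_injr a b (f g : hom a (G b)) :
  ε b ∘ fmap F f = ε b ∘ fmap F g -> f = g.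
Proof.
move=> e; rewrite -[f]comp1m -[g]comp1m -!(unit_counit adj).
by rewrite -!compA !unit_natE !compA -!fmapM e.
Qed.

Lemma adj_injl a b (f g : hom (F a) b) :
  fmap G f ∘ η a = fmap G g ∘ η a -> f = g.
Proof.
move=> e; rewrite -[f]compm1 -[g]compm1 -!(counit_unit adj).
by rewrite !compA -!counit_natE -!compA -!fmapM e.
Qed.

Lemma adj_transr a b (h : hom (F a) b) : ε b ∘ fmap F (fmap G h ∘ η a) = h.
Proof. by rewrite fmapM compA counit_natE -compA counit_unit compm1. Qed.

Lemma adj_transl a b (h : hom a (G b)) : fmap G (ε b ∘ fmap F h) ∘ η a = h.
Proof. by rewrite fmapM -compA -unit_natE compA unit_counit comp1m. Qed.

End AdjunctionLemmas.

Section AdjunctionMonad.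
Context (k : fieldType) (C : monoidal_category k) (M N : module_category C)
  (F : functor M N) (G : functor N M) (s : strong_structure F)
  (adj : adjunction F G).
Local Notation φ x m := (fwd (strong s x m)).
Local Notation ψ x m := (bwd (strong s x m)).
Local Notation η := (adj_unit adj).
Local Notation ε := (adj_counit adj).

(* The canonical lax structure x ▷ G n -> G (x ▷ n) of the right adjoint of a
   strong module functor is the mate of the strong structure. *)
Definition radj_lax (x : C) (n : N) : hom (x ▷ G n) (G (x ▷ n)) :=
  fmap G ((1_x ▷h ε n) ∘ ψ x (G n)) ∘ η (x ▷ G n).

(* The composite x ▷ G F m -> G (x ▷ F m) -> G F (x ▷ m) *)
Definition adj_lax (x : C) (m : M) : hom (x ▷ G (F m)) (G (F (x ▷ m))) :=
  fmap G (φ x m) ∘ radj_lax x (F m).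

Lemma adj_lax_trans x m : ε (F (x ▷ m)) ∘ fmap F (adj_lax x m) =
  φ x m ∘ (1_x ▷h ε (F m)) ∘ ψ x (G (F m)).
Proof. by rewrite /adj_lax /radj_lax compA -fmapM adj_transr compA. Qed.

Lemma adj_laxP : is_lax (M := M) (N := M) (F := fcomp G F) adj_lax.
Proof.
have tl := adj_lax_trans; move: adj_lax tl => λ tl; split=> /=.
- move=> x x' m m' f g; apply: (adj_injr (adj := adj)); rewrite !fmapM !compA tl counit_natE.
  rewrite -[RHS]compA tl (reA (strong_bwd_nat s _ _)) !compA -strong_nat.
  congr (_ ∘ _); rewrite -!compA -!bmapM counit_natE.
  by rewrite comp1m compm1.
- move=> x y m; apply: (adj_injr (adj := adj)); rewrite !fmapM !compA counit_natE tl -!compA tl.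
  rewrite !compA strong_assoc (reA (strong_bwd_nat s _ _)) !compA -!compA; congr (_ ∘ _).
  rewrite !compA -[RHS]compA.
  have -> : (1_x ▷h ε (F (y ▷ m))) ∘ (1_x ▷h fmap F (λ y m)) =
     (1_x ▷h φ y m) ∘ ((1_x ▷h (1_y ▷h ε (F m))) ∘ (1_x ▷h ψ y (G (F m)))).
    by rewrite -!bmapM !comp1m tl compA.
  rewrite -!compA; congr (_ ∘ _).
  rewrite (compA (1_x ▷h ψ _ _)) -strong_bwd_assoc !compA -aassoc_nat.
  by rewrite bmap1.
- move=> m; apply: (adj_injr (adj := adj)); rewrite !fmapM !compA counit_natE -!compA tl.
  rewrite !compA strong_unit aunit_nat -compA.
  rewrite -(strong_unit s) -!compA fwdK.
  by rewrite compm1.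
Qed.

Definition adj_monad : lax_module_monad M.
Proof.
refine (@LaxModuleMonad k C M (fcomp G F) (fun m => fmap G (ε (F m))) η
  _ _ _ _ _ adj_lax adj_laxP _ _).
- move=> a b f /=.
  by rewrite -!fmapM counit_natE.
- exact: unit_natE.
- by move=> m /=; rewrite -!fmapM counit_natE.
- by move=> m /=; rewrite unit_counit.
- by move=> m /=; rewrite -fmapM counit_unit fmap1.
- have tl := adj_lax_trans; move: adj_lax tl => λ tl x m /=.
  apply: (adj_injr (adj := adj)); rewrite counit_unit fmapM compA tl -compA strong_bwd_nat.
  by rewrite compA -[X in X ∘ _]compA -bmapM comp1m counit_unit bmap1 compm1 fwdK.
- have tl := adj_lax_trans; move: adj_lax tl => λ tl x m /=.
  apply: (adj_injr (adj := adj)); rewrite !fmapM !compA tl counit_natE.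
  rewrite -[LHS]compA strong_bwd_nat (reA (counit_natE adj (fmap F (λ x m)))) !compA tl.
  rewrite -[RHS]compA tl !compA (reA (bwdK _)) compm1; congr (_ ∘ _).
  by rewrite -!compA -!bmapM counit_natE.
Defined.

End AdjunctionMonad.

Record oplax_module_comonad k (C : monoidal_category k)
    (M : module_category C) := OplaxModuleComonad {
  com :> functor M M;
  delta : forall m, hom (com m) (com (com m));
  cou : forall m, hom (com m) m;
  delta_nat : natural (F := com) (G := fcomp com com) delta;
  cou_nat : natural (F := com) (G := fid M) cou;
  delta_assoc : forall m,
    fmap com (delta m) ∘ delta m = delta (com m) ∘ delta m;
  delta_coul : forall m, cou (com m) ∘ delta m = 1_(com m);
  delta_cour : forall m, fmap com (cou m) ∘ delta m = 1_(com m);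
  oplax : forall x m, hom (com (x ▷ m)) (x ▷ com m);
  oplaxP : is_oplax oplax;
  oplax_cou : forall x m, (1_x ▷h cou m) ∘ oplax x m = cou (x ▷ m);
  oplax_delta : forall x m,
    (1_x ▷h delta m) ∘ oplax x m =
    oplax x (com m) ∘ fmap com (oplax x m) ∘ delta (x ▷ m)
}.

Arguments delta {k C M} S m : rename.
Arguments cou {k C M} S m : rename.
Arguments oplax {k C M} S x m : rename.

Section Comonad.
Context (k : fieldType) (C : monoidal_category k) (M : module_category C)
  (S : oplax_module_comonad M).

Lemma delta_natE a b (f : hom a b) :
  delta S b ∘ fmap S f = fmap S (fmap S f) ∘ delta S a.
Proof. exact: delta_nat. Qed.

Lemma cou_natE a b (f : hom a b) : cou S b ∘ fmap S f = f ∘ cou S a.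
Proof. exact: cou_nat. Qed.

Record scomod := SComod {
  sc_ob :> M;
  sc_coact : hom sc_ob (S sc_ob);
  sc_counit : cou S sc_ob ∘ sc_coact = 1_sc_ob;
  sc_coassoc : delta S sc_ob ∘ sc_coact = fmap S sc_coact ∘ sc_coact
}.

Lemma sc_linl (A B : scomod) : linear (fun f : hom A B => fmap S f ∘ sc_coact A).
Proof. by move=> l f g; rewrite fmap_lin comp_linl. Qed.

Lemma sc_linr (A B : scomod) : linear (fun f : hom A B => sc_coact B ∘ f).
Proof. exact: comp_linr. Qed.

Definition sc_hom (A B : scomod) : lmodType k :=
  lin_eq (@sc_linl A B) (@sc_linr A B).

Lemma sc_homP (A B : scomod) (f : sc_hom A B) :
  fmap S (lin_val f) ∘ sc_coact A = sc_coact B ∘ lin_val f.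
Proof. exact/eqP/(lin_valP f). Qed.

Definition sc_mk (A B : scomod) (f : hom (sc_ob A) (sc_ob B))
  (e : fmap S f ∘ sc_coact A = sc_coact B ∘ f) : sc_hom A B :=
  @LinEq _ _ _ _ _ (@sc_linl A B) (@sc_linr A B) f (introT eqP e).

Lemma sc_id_subproof (A : scomod) :
  fmap S (1_(sc_ob A)) ∘ sc_coact A = sc_coact A ∘ 1_(sc_ob A).
Proof. by rewrite fmap1 comp1m compm1. Qed.

Lemma sc_comp_subproof (A B D : scomod) (g : sc_hom B D) (f : sc_hom A B) :
  fmap S (lin_val g ∘ lin_val f) ∘ sc_coact A =
  sc_coact D ∘ (lin_val g ∘ lin_val f).
Proof. by rewrite fmapM -compA sc_homP !compA sc_homP. Qed.

Definition comodules : category k.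
Proof.
exists scomod sc_hom (fun A => sc_mk (sc_id_subproof A))
  (fun A B D g f => sc_mk (sc_comp_subproof g f)).
- by move=> *; apply/val_inj; rewrite /= compA.
- by move=> *; apply/val_inj; rewrite /= comp1m.
- by move=> *; apply/val_inj; rewrite /= compm1.
- by move=> a b c f l g h; apply/val_inj; rewrite /= comp_linl.
- by move=> a b c f l g h; apply/val_inj; rewrite /= comp_linr.
Defined.

Definition cofree_comodule (m : M) : comodules :=
  @SComod (S m) (delta S m) (delta_coul S m) (esym (delta_assoc S m)).

Definition cokleisli_cat : category k.
Proof.
exists (ob M) (fun m n => hom (S m) n) (fun m => cou S m)
  (fun a b c g f => g ∘ fmap S f ∘ delta S a).
- move=> a b c d h g f; rewrite !fmapM -!compA.
  by rewrite delta_assoc (compA (delta S b)) delta_natE !compA.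
- by move=> a b f; rewrite cou_natE -compA delta_coul compm1.
- by move=> a b f; rewrite -compA delta_cour compm1.
- by move=> a b c f l g h /=; rewrite !comp_linl.
- by move=> a b c g l f h /=; rewrite fmap_lin comp_linr comp_linl.
Defined.

Lemma cokleisli_compE (a b c : cokleisli_cat) (g : hom b c) (f : hom a b) :
  g ∘ f = comp (g : hom (S b) (c : M)) (fmap S (f : hom (S a) (b : M)))
            ∘ delta S a :> hom (S a) (c : M).
Proof. by []. Qed.

Definition cokleisli_act : bifunctor C cokleisli_cat cokleisli_cat.
Proof.
refine (@Bifunctor k C cokleisli_cat cokleisli_cat
  (fun x (m : M) => x ▷ m)
  (fun x x' m m' f (g : hom (S m) (m' : M)) => (f ▷h g) ∘ oplax S x m)
  _ _ _ _).
- by move=> x x' m m' g l f h /=; rewrite bmap_linl comp_linl.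
- by move=> x x' m m' f l g h /=; rewrite bmap_linr comp_linl.
- by move=> x m /=; rewrite oplax_cou.
- move=> x x' x'' a b c f' f g' g; rewrite cokleisli_compE /=.
  have -> : (f' ∘ f) ▷h (comp (g' : hom (S b) (c : M)) (fmap S g) ∘ delta S a)
      = comp (f' ▷h (g' : hom (S b) (c : M))) (f ▷h fmap S g)
          ∘ (1_x ▷h delta S a).
    by rewrite -!bmapM !compm1.
  rewrite fmapM -compA oplax_delta !compA.
  by rewrite (reA (oplax_nat (oplaxP S) f g)) !compA.
Defined.

Definition cokl (a b : M) (u : hom a b) : @hom k cokleisli_cat a b :=
  u ∘ cou S a.

Lemma cokl_compl (a b c : M) (u : hom b c) (f : hom (S a) b) :
  (cokl u ∘ (f : @hom k cokleisli_cat a b) : @hom k cokleisli_cat a c) = u ∘ f.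
Proof.
by rewrite cokleisli_compE /cokl (reA (cou_natE _)) compA -compA delta_coul compm1.
Qed.

Lemma cokl_compr (a b c : M) (g : hom (S b) c) (u : hom a b) :
  ((g : @hom k cokleisli_cat b c) ∘ cokl u : @hom k cokleisli_cat a c) =
  g ∘ fmap S u.
Proof.
by rewrite cokleisli_compE /cokl fmapM compA -compA delta_cour compm1.
Qed.

Lemma coklM (a b c : M) (v : hom b c) (u : hom a b) :
  cokl (v ∘ u) = cokl v ∘ cokl u :> @hom k cokleisli_cat a c.
Proof. by rewrite cokl_compl /cokl compA. Qed.

Lemma cokl1 (a : M) : cokl (1_a) = @idm k cokleisli_cat a.
Proof. exact: (comp1m (cou S a)). Qed.

Lemma cokl_act (x x' : C) (a b : M) (f : hom x x') (u : hom a b) :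
  bmap cokleisli_act f (cokl u) = cokl (f ▷h u).
Proof.
rewrite /= /cokl -(compm1 f) bmapM -compA oplax_cou.
by rewrite compm1.
Qed.

Definition cokleisli_iso (a b : M) (i : iso a b) : @iso k cokleisli_cat a b.
Proof.
exists (cokl (fwd i)) (cokl (bwd i)).
- by rewrite -coklM bwdK cokl1.
- by rewrite -coklM fwdK cokl1.
Defined.

Lemma fwd_cokl (a b : M) (i : iso a b) : fwd (cokleisli_iso i) = cokl (fwd i).
Proof. by []. Qed.

Definition cokleisli_str : module_structure C cokleisli_cat.
Proof.
exists cokleisli_act (fun x y m => cokleisli_iso (aso x y m))
  (fun m => cokleisli_iso (uno m)).
- move=> x x' y y' m m' f g h; rewrite cokl_compl cokl_compr /=.
  rewrite compA aassoc_nat -compA (oplax_assoc (oplaxP S)).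
  by rewrite -[f in RHS](compm1 f) bmapM !compA.
- move=> m m' f; rewrite cokl_compl cokl_compr /=.
  by rewrite compA aunit_nat -!compA (oplax_unit (oplaxP S)).
- move=> x y z m; rewrite -[@idm k cokleisli_cat m]cokl1 !fwd_cokl !cokl_act.
  by rewrite -!coklM apentagon.
- move=> x m; rewrite -[@idm k cokleisli_cat m]cokl1 !fwd_cokl !cokl_act.
  by rewrite -!coklM atriangle.
Defined.

Definition cokleisli : module_category C := ModuleCategory cokleisli_str.

Lemma cokleisli_incl_subproof (a b : M) (f : hom (S a) b) :
  fmap S (fmap S f ∘ delta S a) ∘ delta S a = delta S b ∘ (fmap S f ∘ delta S a).
Proof. by rewrite fmapM -compA delta_assoc !compA delta_natE. Qed.

Definition cokleisli_incl : functor cokleisli comodules.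
Proof.
refine (@Functor k cokleisli_cat comodules cofree_comodule
  (fun a b (f : hom (S a) (b : M)) =>
    @sc_mk (cofree_comodule a) (cofree_comodule b) _ (cokleisli_incl_subproof f))
  _ _ _).
- by move=> a b l f g; apply/val_inj; rewrite /= fmap_lin comp_linl.
- by move=> a; apply/val_inj; rewrite /= delta_cour.
- move=> a b c g f; apply/val_inj; rewrite /= !fmapM -!compA.
  by rewrite delta_assoc (compA (delta S b)) delta_natE !compA.
Defined.

(* Dual to extended_from_kleisli. *)
Record extended_from_cokleisli (E : module_structure C comodules) : Prop :=
  ExtendedFromCokleisli {
  coext_exact : left_exact2 (act E);
  coext_incl : inhabited
    (@strong_structure k C cokleisli (ModuleCategory E) cokleisli_incl)
}.

End Comonad.

Section AdjunctionComonad.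
Context (k : fieldType) (C : monoidal_category k) (M N : module_category C)
  (F : functor M N) (G : functor N M) (s : strong_structure G)
  (adj : adjunction F G).
Local Notation φ x n := (fwd (strong s x n)).
Local Notation ψ x n := (bwd (strong s x n)).
Local Notation η := (adj_unit adj).
Local Notation ε := (adj_counit adj).

(* The canonical oplax structure of the left adjoint, again a mate. *)
Definition ladj_oplax (x : C) (m : M) : hom (F (x ▷ m)) (x ▷ F m) :=
  ε (x ▷ F m) ∘ fmap F (φ x (F m) ∘ (1_x ▷h η m)).

(* The composite F G (x ▷ n) -> F (x ▷ G n) -> x ▷ F G n *)
Definition adj_oplax (x : C) (n : N) : hom (F (G (x ▷ n))) (x ▷ F (G n)) :=
  ladj_oplax x (G n) ∘ fmap F (ψ x n).

Lemma adj_oplax_trans x n : fmap G (adj_oplax x n) ∘ η (G (x ▷ n)) =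
  φ x (F (G n)) ∘ (1_x ▷h η (G n)) ∘ ψ x n.
Proof. by rewrite /adj_oplax /ladj_oplax -compA -fmapM adj_transl. Qed.

Lemma adj_oplaxP : is_oplax (M := N) (N := N) (F := fcomp F G) adj_oplax.
Proof.
have tl := adj_oplax_trans; move: adj_oplax tl => σ tl; split=> /=.
- move=> x x' m m' f g; apply: (adj_injl (adj := adj)).
  rewrite !fmapM -!compA tl -unit_natE !compA tl.
  rewrite -!compA strong_bwd_nat !compA -strong_nat; congr (_ ∘ _).
  by rewrite -!compA -!bmapM unit_natE comp1m compm1.
- move=> x y m; apply: (adj_injl (adj := adj)).
  rewrite !fmapM -!compA tl -unit_natE (compA (fmap G (σ x _))) tl.
  rewrite !compA strong_assoc -strong_nat.
  have -> : φ x (y ▷ F (G m)) ∘ (1_x ▷h fmap G (σ y m)) ∘ (1_x ▷h η (G (y ▷ m)))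
     = φ x (y ▷ F (G m)) ∘ (1_x ▷h φ y (F (G m))) ∘ (1_x ▷h (1_y ▷h η (G m)))
        ∘ (1_x ▷h ψ y m).
    by rewrite -!compA -!bmapM !comp1m tl compA.
  rewrite -!compA; do 2!congr (_ ∘ _).
  rewrite (compA (1_x ▷h ψ _ _)) -strong_bwd_assoc !compA -aassoc_nat.
  by rewrite bmap1.
- move=> m; apply: (adj_injl (adj := adj)).
  rewrite !fmapM -!compA tl -unit_natE !compA strong_unit aunit_nat.
  by rewrite -(strong_unit s) -!compA fwdK compm1.
Qed.

Definition adj_comonad : oplax_module_comonad N.
Proof.
refine (@OplaxModuleComonad k C N (fcomp F G) (fun n => fmap F (η (G n))) ε
  _ _ _ _ _ adj_oplax adj_oplaxP _ _).
- move=> a b f /=.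
  by rewrite -!fmapM unit_natE.
- exact: counit_natE.
- by move=> m /=; rewrite -!fmapM unit_natE.
- by move=> m /=; rewrite counit_unit.
- by move=> m /=; rewrite -fmapM unit_counit fmap1.
- have tl := adj_oplax_trans; move: adj_oplax tl => σ tl x m /=.
  apply: (adj_injl (adj := adj)); rewrite unit_counit fmapM -compA tl !compA.
  rewrite -strong_nat -[X in X ∘ _]compA -bmapM comp1m unit_counit bmap1.
  by rewrite compm1 fwdK.
- have tl := adj_oplax_trans; move: adj_oplax tl => σ tl x m /=.
  apply: (adj_injl (adj := adj)).
  rewrite !fmapM -!compA tl -unit_natE.
  rewrite (compA _ (η (G (F (G (x ▷ m)))))) -unit_natE -!compA tl.
  rewrite !compA -strong_nat tl.
  rewrite (reA (bwdK _)) compm1.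
  congr (_ ∘ _); rewrite -!compA -!bmapM -unit_natE.
  by [].
Defined.

End AdjunctionComonad.

(* f and g are multivalued assignments, defined up to a choice (of an adjoint,
   or of an extended module structure); they are well defined and mutually
   inverse bijections between X modulo RX and Y modulo RY. *)
Record mutually_inverse_mod (X Y : Type) (RX : X -> X -> Prop)
    (RY : Y -> Y -> Prop) (f : X -> Y -> Prop) (g : Y -> X -> Prop) : Prop :=
  MutuallyInverseMod {
  f_total : forall x, exists y, f x y;
  g_total : forall y, exists x, g y x;
  f_compat : forall x x' y y', RX x x' -> f x y -> f x' y' -> RY y y';
  g_compat : forall y y' x x', RY y y' -> g y x -> g y' x' -> RX x x';
  fgK : forall x y x', f x y -> g y x' -> RX x x';
  gfK : forall y x y', g y x -> f x y' -> RY y y'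
}.

Section Projective.
Context (k : fieldType) (C : monoidal_category k).

Record proj_conditions (M : module_category C) (l : M) : Prop :=
  ProjConditions {
  pc_abelian : abelian M;
  pc_enough : enough_projectives M;
  pc_exact : right_exact2 (act (modstr M));
  pc_adjoint : exists G : functor M C, inhabited (adjunction (act_on l) G);
  pc_preserve : forall x : C, projective x -> projective (x ▷ l);
  pc_generate : forall p : M, projective p ->
    exists x : C, projective x /\ direct_summand p (x ▷ l)
}.

Record proj_pair := ProjPair {
  pp_cat : module_category C;
  pp_ob : pp_cat;
  pp_conditions : proj_conditions pp_ob
}.

(* The equivalence is not required to match the distinguished objects. *)
Definition pp_equiv (p q : proj_pair) : Prop :=
  module_equivalent (pp_cat p) (pp_cat q).

Record right_exact_monad := RightExactMonad {
  rem_monad :> lax_module_monad (regular C);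
  rem_exact : right_exact rem_monad
}.

Definition rem_equiv (T U : right_exact_monad) : Prop :=
  exists E E', extended_from_kleisli (T := T) E /\
    extended_from_kleisli (T := U) E' /\
    module_equivalent (ModuleCategory E) (ModuleCategory E').

(* (M, l) |-> the monad [l, - ▷ l] *)
Definition pair_to_monad (p : proj_pair) (T : right_exact_monad) : Prop :=
  exists (G : functor (pp_cat p) (regular C))
    (adj : adjunction (act_on (pp_ob p)) G),
    rem_monad T = adj_monad (act_on_strong (pp_ob p)) adj.

(* T |-> (C^T, T1) *)
Definition monad_to_pair (T : right_exact_monad) (p : proj_pair) : Prop :=
  exists (E : module_structure C (modules T)) (_ : extended_from_kleisli E)
    (c : proj_conditions (M := ModuleCategory E) (free_module T (tunit : C))),
    p = ProjPair c.

End Projective.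

Section Injective.
Context (k : fieldType) (C : monoidal_category k).

Record inj_conditions (M : module_category C) (l : M) : Prop :=
  InjConditions {
  ic_abelian : abelian M;
  ic_enough : enough_injectives M;
  ic_exact : left_exact2 (act (modstr M));
  ic_adjoint : exists L : functor M C, inhabited (adjunction L (act_on l));
  ic_preserve : forall x : C, injective_ob x -> injective_ob (x ▷ l);
  ic_generate : forall q : M, injective_ob q ->
    exists x : C, injective_ob x /\ direct_summand q (x ▷ l)
}.

Record inj_pair := InjPair {
  ip_cat : module_category C;
  ip_ob : ip_cat;
  ip_conditions : inj_conditions ip_ob
}.

Definition ip_equiv (p q : inj_pair) : Prop :=
  module_equivalent (ip_cat p) (ip_cat q).

Record left_exact_comonad := LeftExactComonad {
  lec_comonad :> oplax_module_comonad (regular C);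
  lec_exact : left_exact lec_comonad
}.

Definition lec_equiv (S U : left_exact_comonad) : Prop :=
  exists E E', extended_from_cokleisli (S := S) E /\
    extended_from_cokleisli (S := U) E' /\
    module_equivalent (ModuleCategory E) (ModuleCategory E').

Definition pair_to_comonad (p : inj_pair) (S : left_exact_comonad) : Prop :=
  exists (L : functor (ip_cat p) (regular C))
    (adj : adjunction L (act_on (ip_ob p))),
    lec_comonad S = adj_comonad (act_on_strong (ip_ob p)) adj.

Definition comonad_to_pair (S : left_exact_comonad) (p : inj_pair) : Prop :=
  exists (E : module_structure C (comodules S)) (_ : extended_from_cokleisli E)
    (c : inj_conditions (M := ModuleCategory E) (cofree_comodule S (tunit : C))),
    p = InjPair c.

End Injective.

(* Main.v *)
From Stdlib Require Import IndefiniteDescription ProofIrrelevance.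
From mathcomp Require Import all_boot all_algebra.
Require Import Defs.
Import GRing.Theory.
Local Open Scope ring_scope.
Local Open Scope cat_scope.
Set Implicit Arguments.
Unset Strict Implicit.
Unset Printing Implicit Defensive.

(* Right exact functors out of the category of modules of a right exact monad T
   are determined by their restriction to free modules, because every module a
   is the cokernel of the bar map T T a -> T a, functorially in a.  This gives
   the extended action as a cokernel of maps of free modules; its associator,
   unitor and coherence, its uniqueness, and the strong structure of right exact
   functors out of the modules all follow by comparison on free modules.

   Under (a)-(c) the functor [l, -] preserves epimorphisms, since - |> l
   preserves projectives; being a right adjoint it is then exact.  The counit is
   an epimorphism, since every object is a quotient of some x |> l.  Hence the
   comparison functor M -> C^T is an equivalence, and its inverse is strong,
   since its restriction to the Kleisli category is k |-> k |> l.

   The dual half is the first half in the opposite categories, for monads on an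
   arbitrary module category: the opposite of the regular module category of C
   and the regular module category of the opposite of C have different coherence
   proofs, hence are different terms. *)

(** * Abelian categories, equivalences and adjunctions *)

(** Both equivalence relations in the bijection see only module categories, never the object l or
    the monad itself. Hence no isomorphism of monads is ever built: well-definedness and both round
    trips reduce to the reconstruction M ≃ C^T and to the uniqueness of the extended structure. That
    (C^T, T1) satisfies (a)-(c) comes from moving the evident conditions on (C, 1) along the strong
    left adjoint C -> C^T.

    The obstacle is that an extended structure is known only through its exactness and a strong
    structure on the Kleisli inclusion, with no formula for its action. All comparisons therefore
    pass through right exact functors out of C^T. This is why the quasi-inverse C^T -> M, and not
    the comparison functor itself, receives its strong structure first.

    Linearity turns every coequaliser into the cokernel of a difference. Modules are presented
    inside the Kleisli category, where the action already exists; the presentation of a free module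
    is split there, which gives the value of the extended action on free modules. *)

Section Linear.
Context (k : fieldType) (V W : lmodType k) (h : V -> W).
Hypothesis lh : linear h.

Lemma linear_map0 : h 0 = 0.
Proof. by rewrite -[0 in LHS](addNr 0) -scaleN1r lh scaleN1r addNr. Qed.

Lemma linear_mapB u v : h (u - v) = h u - h v.
Proof. by rewrite addrC -scaleN1r lh scaleN1r addrC. Qed.

Lemma linear_mapD u v : h (u + v) = h u + h v.
Proof. by have := lh 1 u v; rewrite !scale1r. Qed.

End Linear.

Section CategoryBasics.
Context (k : fieldType).
Implicit Types C D : category k.

Lemma comp0m C (a b c : C) (f : hom a b) : (0 : hom b c) ∘ f = 0.
Proof. exact: (linear_map0 (@comp_linl k C a b c f)). Qed.

Lemma compm0 C (a b c : C) (g : hom b c) : g ∘ (0 : hom a b) = 0.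
Proof. exact: (linear_map0 (@comp_linr k C a b c g)). Qed.

Lemma compBm C (a b c : C) (g h : hom b c) (f : hom a b) :
  (g - h) ∘ f = g ∘ f - h ∘ f.
Proof. exact: (linear_mapB (@comp_linl k C a b c f)). Qed.

Lemma compmB C (a b c : C) (g : hom b c) (f h : hom a b) :
  g ∘ (f - h) = g ∘ f - g ∘ h.
Proof. exact: (linear_mapB (@comp_linr k C a b c g)). Qed.

Lemma compDm C (a b c : C) (g h : hom b c) (f : hom a b) :
  (g + h) ∘ f = g ∘ f + h ∘ f.
Proof. exact: (linear_mapD (@comp_linl k C a b c f)). Qed.

Lemma compmD C (a b c : C) (g : hom b c) (f h : hom a b) :
  g ∘ (f + h) = g ∘ f + g ∘ h.
Proof. exact: (linear_mapD (@comp_linr k C a b c g)). Qed.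

Lemma fmap0 C D (F : functor C D) a b : fmap F (0 : hom a b) = 0.
Proof. exact: (linear_map0 (@fmap_lin k C D F a b)). Qed.

Lemma fmapB C D (F : functor C D) a b (f g : hom a b) :
  fmap F (f - g) = fmap F f - fmap F g.
Proof. exact: (linear_mapB (@fmap_lin k C D F a b)). Qed.

Lemma fmapD C D (F : functor C D) a b (f g : hom a b) :
  fmap F (f + g) = fmap F f + fmap F g.
Proof. exact: (linear_mapD (@fmap_lin k C D F a b)). Qed.

Definition iso_refl C (a : C) : iso a a := Iso (comp1m (1_a)) (comp1m (1_a)).

Definition iso_comp C (a b c : C) (j : iso b c) (i : iso a b) : iso a c.
Proof.
exists (fwd j ∘ fwd i) (bwd i ∘ bwd j).
- by rewrite compA (reA (bwdK j)) compm1 bwdK.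
- by rewrite compA (reA (fwdK i)) compm1 fwdK.
Defined.

Definition fmap_iso C D (F : functor C D) (a b : C) (i : iso a b) :
  iso (F a) (F b).
Proof.
exists (fmap F (fwd i)) (fmap F (bwd i)).
- by rewrite -fmapM bwdK fmap1.
- by rewrite -fmapM fwdK fmap1.
Defined.

Lemma iso_eql C (a b c : C) (i : iso b c) (f : hom a b) (g : hom a c) :
  fwd i ∘ f = g <-> f = bwd i ∘ g.
Proof.
by split=> [<-|->]; rewrite compA ?bwdK ?fwdK comp1m.
Qed.

Lemma iso_eqr C (a b c : C) (i : iso a b) (f : hom b c) (g : hom a c) :
  f ∘ fwd i = g <-> f = g ∘ bwd i.
Proof.
by split=> [<-|->]; rewrite -compA ?bwdK ?fwdK compm1.
Qed.

Lemma niso_natE C D (F G : functor C D) (n : nat_iso F G) a b (f : hom a b) :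
  fwd (niso n b) ∘ fmap F f = fmap G f ∘ fwd (niso n a).
Proof. exact: niso_nat. Qed.

Lemma nat_iso_bwd C D (F G : functor C D) (n : nat_iso F G) a b (f : hom a b) :
  bwd (niso n b) ∘ fmap G f = fmap F f ∘ bwd (niso n a).
Proof.
apply/esym/iso_eql; rewrite compA; apply/esym/iso_eqr.
by rewrite -(niso_nat n f).
Qed.

Definition nat_iso_sym C D (F G : functor C D) (n : nat_iso F G) : nat_iso G F :=
  @NatIso _ _ _ G F (fun a => iso_sym (niso n a)) (nat_iso_bwd n).

(** Identifies a quasi-inverse on part of its source: for [Ψ] the comparison functor and [J] the
    Kleisli inclusion, it computes the otherwise unspecified [Φ] on free modules. *)
Definition nat_iso_unwhisker A C D (H : functor A C) (Ψ : functor C D)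
  (Φ : functor D C) (J : functor A D) (j : nat_iso (fcomp Ψ H) J)
  (n : nat_iso (fcomp Φ Ψ) (fid C)) : nat_iso H (fcomp Φ J).
Proof.
apply: (@NatIso _ A C H (fcomp Φ J)
  (fun a => iso_comp (fmap_iso Φ (niso j a)) (iso_sym (niso n (H a))))).
move=> a b f; rewrite [fwd _]/= -compA.
have /= -> := nat_iso_bwd n (fmap H f).
rewrite !compA -!fmapM; congr (fmap Φ _ ∘ _).
exact: (niso_nat j f).
Defined.

End CategoryBasics.

Section Exactness.
Context (k : fieldType) (C : category k).
Implicit Types a b c d : C.

Lemma is_cokernel0 a b c (f : hom a b) (g : hom b c) :
  is_cokernel f g -> g ∘ f = 0.
Proof. by case. Qed.

Lemma is_cokernel_epi a b c (f : hom a b) (g : hom b c) :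
  is_cokernel f g -> is_epi g.
Proof.
move=> [gf0 univ] d u v uv.
have [w [_ wu]] := univ d (u ∘ g) (etrans (reA gf0 u) (compm0 _ _)).
by rewrite -(wu u) // -(wu v).
Qed.

Lemma is_cokernel_factor a b c d (f : hom a b) (g : hom b c) (h : hom b d) :
  is_cokernel f g -> h ∘ f = 0 -> exists h' : hom c d, h' ∘ g = h.
Proof. by move=> [_ univ] /univ [h' [hh _]]; exists h'. Qed.

Lemma is_cokernelI a b c (f : hom a b) (g : hom b c) : g ∘ f = 0 -> is_epi g ->
  (forall d (h : hom b d), h ∘ f = 0 -> exists h' : hom c d, h' ∘ g = h) ->
  is_cokernel f g.
Proof.
move=> gf0 epi ex; split=> // d h /ex [h' hh]; exists h'; split=> // h'' hh'.
by apply: epi; rewrite hh.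
Qed.

Lemma is_kernel0 a b c (f : hom a b) (g : hom b c) :
  is_kernel f g -> g ∘ f = 0.
Proof. by case. Qed.

Lemma is_kernel_mono a b c (f : hom a b) (g : hom b c) :
  is_kernel f g -> is_mono f.
Proof.
move=> [gf0 univ] d u v uv.
have [|w [_ wu]] := univ d (f ∘ u); first by rewrite compA gf0 comp0m.
by rewrite -(wu u) // -(wu v).
Qed.

Lemma is_kernel_factor a b c d (f : hom a b) (g : hom b c) (h : hom d b) :
  is_kernel f g -> g ∘ h = 0 -> exists h' : hom d a, f ∘ h' = h.
Proof. by move=> [_ univ] /univ [h' [hh _]]; exists h'. Qed.

Lemma is_kernelI a b c (f : hom a b) (g : hom b c) : g ∘ f = 0 -> is_mono f ->
  (forall d (h : hom d b), g ∘ h = 0 -> exists h' : hom d a, f ∘ h' = h) ->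
  is_kernel f g.
Proof.
move=> gf0 mono ex; split=> // d h /ex [h' hh]; exists h'; split=> // h'' hh'.
by apply: mono; rewrite hh.
Qed.

Lemma epi_comp a b c (g : hom b c) (f : hom a b) :
  is_epi g -> is_epi f -> is_epi (g ∘ f).
Proof. by move=> eg ef d u v; rewrite !compA => /ef /eg. Qed.

Lemma epi_comp_left a b c (g : hom b c) (f : hom a b) :
  is_epi (g ∘ f) -> is_epi g.
Proof. by move=> e d u v uv; apply: e; rewrite !compA uv. Qed.

Lemma iso_epi a b (i : iso a b) : is_epi (fwd i).
Proof. move=> d u v; exact: fwd_surj. Qed.

Lemma split_epi a b (e : hom a b) (s : hom b a) : e ∘ s = 1_b -> is_epi e.
Proof.
by move=> es d u v uv; rewrite -[u]compm1 -[v]compm1 -es !compA uv.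
Qed.

Lemma epiP a b (e : hom a b) :
  is_epi e <-> forall d (u : hom b d), u ∘ e = 0 -> u = 0.
Proof.
split=> [ee d u ue|ee d u v uv]; first by apply: ee; rewrite ue comp0m.
by apply/eqP; rewrite -subr_eq0; apply/eqP/ee; rewrite compBm uv subrr.
Qed.

Lemma monoP a b (i : hom a b) :
  is_mono i <-> forall d (u : hom d a), i ∘ u = 0 -> u = 0.
Proof.
split=> [ee d u ue|ee d u v uv]; first by apply: ee; rewrite ue compm0.
by apply/eqP; rewrite -subr_eq0; apply/eqP/ee; rewrite compmB uv subrr.
Qed.

(** Cokernels commute with cokernels. A map [h] on [b] that kills [f] pulls back to [b0], kills [f0]
    and so descends to [h0] on [c0]. That [h0] kills the relations [dc] can be tested after the
    epimorphism [g1], where it becomes [h ∘ qb ∘ db = 0]. *)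
Lemma cokernel_of_cokernels (a0 a b1 b0 b c1 c0 c : C)
    (qa : hom a0 a) (db : hom b1 b0) (qb : hom b0 b)
    (dc : hom c1 c0) (qc : hom c0 c) (f0 : hom a0 b0) (f : hom a b)
    (g1 : hom b1 c1) (g0 : hom b0 c0) (g : hom b c) :
  is_epi qa -> is_cokernel db qb -> is_cokernel dc qc ->
  is_cokernel f0 g0 -> is_epi g1 ->
  f ∘ qa = qb ∘ f0 -> g ∘ qb = qc ∘ g0 -> g0 ∘ db = dc ∘ g1 ->
  is_cokernel f g.
Proof.
move=> ea kb kc k0 e1 ef eg ed; apply: is_cokernelI.
- by apply: ea; rewrite -compA ef compA eg -compA (is_cokernel0 k0) compm0 comp0m.
- apply: (@epi_comp_left _ _ _ g qb); rewrite eg.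
  by apply: epi_comp; apply: is_cokernel_epi; eassumption.
move=> d h hf.
have [|h0 hh0] := is_cokernel_factor (h := h ∘ qb) k0.
  by rewrite -compA -ef compA hf comp0m.
have [|h' hh'] := is_cokernel_factor (h := h0) kc.
  by apply: e1; rewrite -compA -ed compA hh0 -compA (is_cokernel0 kb) compm0 comp0m.
exists h'; apply: (is_cokernel_epi kb).
by rewrite -compA eg compA hh'.
Qed.

Lemma cokernel_iso (a b c a' b' c' : C) (f : hom a b) (g : hom b c)
    (f' : hom a' b') (g' : hom b' c') (i : iso a a') (j : iso b b') (l : iso c c') :
  fwd j ∘ f = f' ∘ fwd i -> fwd l ∘ g = g' ∘ fwd j ->
  is_cokernel f g -> is_cokernel f' g'.
Proof.
move=> ef eg kfg; apply: is_cokernelI.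
- apply: (fwd_surj (i := i)).
  by rewrite -compA -ef compA -eg -compA (is_cokernel0 kfg) compm0 comp0m.
- apply: (@epi_comp_left _ _ _ g' (fwd j)); rewrite -eg.
  by apply: epi_comp; [exact: iso_epi|exact: is_cokernel_epi kfg].
move=> d h hf.
have [|h' hh] := is_cokernel_factor (h := h ∘ fwd j) kfg.
  by rewrite -compA ef compA hf comp0m.
exists (h' ∘ bwd l); apply: (fwd_surj (i := j)).
by rewrite -compA -eg compA -(compA h') bwdK compm1.
Qed.

Lemma cokernel_unique a b c c' (f : hom a b) (g : hom b c) (g' : hom b c') :
  is_cokernel f g -> is_cokernel f g' -> exists l : iso c c', fwd l ∘ g = g'.
Proof.
move=> kg kg'.
have [u ug] := is_cokernel_factor kg (is_cokernel0 kg').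
have [v vg] := is_cokernel_factor kg' (is_cokernel0 kg).
have vu : v ∘ u = 1_c.
  by apply: (is_cokernel_epi kg); rewrite -compA ug vg comp1m.
have uv : u ∘ v = 1_c'.
  by apply: (is_cokernel_epi kg'); rewrite -compA vg ug comp1m.
by exists (Iso vu uv).
Qed.

Hypothesis Cab : abelian C.

Lemma epi_is_cokernel a b c (e : hom b c) (i : hom a b) :
  is_epi e -> is_kernel i e -> is_cokernel i e.
Proof.
move=> ee ki; have [d [u ku]] := ab_epi Cab ee.
apply: is_cokernelI => // [|d' h hi]; first exact: is_kernel0 ki.
have [v uv] := is_kernel_factor ki (is_cokernel0 ku).
by apply: (is_cokernel_factor ku); rewrite -uv compA hi comp0m.
Qed.

Lemma mono_is_kernel a b c (i : hom a b) (e : hom b c) :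
  is_mono i -> is_cokernel i e -> is_kernel i e.
Proof.
move=> mi ke; have [d [u ku]] := ab_mono Cab mi.
apply: is_kernelI => // [|d' h eh]; first exact: is_cokernel0 ke.
have [v uv] := is_cokernel_factor ke (is_kernel0 ku).
by apply: (is_kernel_factor ku); rewrite -uv -compA eh compm0.
Qed.

(* f' is the corestriction of f to its image, the kernel of its cokernel. *)
Lemma image_epi a b c d (f : hom a b) (g : hom b c) (i : hom d b) (f' : hom a d) :
  is_cokernel f g -> is_kernel i g -> i ∘ f' = f -> is_epi f'.
Proof.
move=> kg ki ff; apply/epiP => e u uf.
have [l [j kj]] := ab_kernel Cab u.
(* With [j] the kernel of [u], the map [f] factors through the subobject [i ∘ j], which is the
   kernel of some [w]. So [w] kills [f], factors through [g] and kills [i]. Then [i] factors through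
   [i ∘ j], which gives [j] a section and forces [u = 0]. *)
have mij : is_mono (i ∘ j).
  by move=> x p q; rewrite -!compA => /(is_kernel_mono ki) /(is_kernel_mono kj).
have [w' [w kw]] := ab_mono Cab mij.
have [t tf] := is_kernel_factor kj uf.
have [|v vw] := is_cokernel_factor (h := w) kg.
  by rewrite -ff -tf !compA -(compA w) (is_kernel0 kw) comp0m.
have [|r ir] := is_kernel_factor (h := i) kw.
  by rewrite -vw -compA (is_kernel0 ki) compm0.
have jr : j ∘ r = 1_d by apply: (is_kernel_mono ki); rewrite compA ir compm1.
by rewrite -[u]compm1 -jr compA (is_kernel0 kj) comp0m.
Qed.

(** The complement is the kernel of [e], with projection induced by the idempotent [1 - s ∘ e]. *)
Lemma split_epi_summand a b (e : hom a b) (s : hom b a) :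
  e ∘ s = 1_b -> direct_summand b a.
Proof.
move=> es; have [d [i ki]] := ab_kernel Cab e.
have [|q iq] := is_kernel_factor (h := 1_a - s ∘ e) ki.
  by rewrite compmB compm1 compA es comp1m subrr.
exists d, s, i, e, q; split=> //.
- apply: (is_kernel_mono ki).
  by rewrite compA iq compBm comp1m compm1 -compA (is_kernel0 ki) compm0 subr0.
- exact: is_kernel0 ki.
- apply: (is_kernel_mono ki).
  by rewrite compA iq compBm comp1m compm0 -compA es compm1 subrr.
- by rewrite iq addrC subrK.
Qed.

End Exactness.

Section Choice.
Context (k : fieldType) (C : category k).

(** [abelian] asserts cokernels only as propositions, while the extended action needs them as data
    of a bifunctor; hence the choice. *)
Lemma cokernel_choice (a b : C) (f : hom a b) :
  abelian C -> {c : C & {q : hom b c | is_cokernel f q}}.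
Proof.
move=> Cab; have [c cP] := constructive_indefinite_description _ (ab_cokernel Cab f).
by exists c; apply: constructive_indefinite_description.
Qed.

Lemma cokernel_desc (a b c d : C) (f : hom a b) (g : hom b c) (h : hom b d) :
  is_cokernel f g -> h ∘ f = 0 -> {h' : hom c d | h' ∘ g = h}.
Proof.
by move=> kg hf; apply/constructive_indefinite_description/(is_cokernel_factor kg hf).
Qed.

End Choice.

Section BifunctorLinear.
Context (k : fieldType) (A B C : category k) (H : bifunctor A B C).

Lemma bmapm0 a a' b b' (f : hom a a') : bmap H f (0 : hom b b') = 0.
Proof. exact: (linear_map0 (@bmap_linr _ _ _ _ H a a' b b' f)). Qed.

Lemma bmapmD a a' b b' (f : hom a a') (g h : hom b b') :
  bmap H f (g + h) = bmap H f g + bmap H f h.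
Proof. exact: (linear_mapD (@bmap_linr _ _ _ _ H a a' b b' f)). Qed.

Lemma bmap_idl a a' b b' (f : hom a a') (g : hom b b') :
  bmap H (1_a') g ∘ bmap H f (1_b) = bmap H f g.
Proof. by rewrite -bmapM comp1m compm1. Qed.

Lemma bmap_idr a a' b b' (f : hom a a') (g : hom b b') :
  bmap H f (1_b') ∘ bmap H (1_a) g = bmap H f g.
Proof. by rewrite -bmapM comp1m compm1. Qed.

Lemma bmap_comp_idl a b b' b'' (g : hom b' b'') (f : hom b b') :
  bmap H (1_a) (g ∘ f) = bmap H (1_a) g ∘ bmap H (1_a) f.
Proof. by rewrite -bmapM comp1m. Qed.

End BifunctorLinear.

Lemma right_exact_epi k (C D : category k) (F : functor C D) (a b : C)
    (e : hom a b) :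
  abelian C -> right_exact F -> is_epi e -> is_epi (fmap F e).
Proof.
move=> Cab ex ee; have [c [f kf]] := ab_epi Cab ee.
exact: is_cokernel_epi (ex _ _ _ _ _ kf).
Qed.

Lemma right_exact_comp k (A B C : category k) (G : functor B C) (F : functor A B) :
  right_exact G -> right_exact F -> right_exact (fcomp G F).
Proof. by move=> eG eF a b c f g /eF /eG. Qed.

Section Equivalences.
Context (k : fieldType).
Implicit Types C D : category k.

Definition faithful C D (F : functor C D) : Prop :=
  forall a b (f g : hom a b), fmap F f = fmap F g -> f = g.

Definition full C D (F : functor C D) : Prop :=
  forall a b (g : hom (F a) (F b)), exists f : hom a b, fmap F f = g.

Definition ess_surj C D (F : functor C D) : Prop :=
  forall d, exists a, inhabited (iso (F a) d).

Section FullyFaithful.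
Context (C D : category k) (F : functor C D).
Hypotheses (Ffaith : faithful F) (Ffull : full F).

Definition preim a b (g : hom (F a) (F b)) : hom a b :=
  proj1_sig (constructive_indefinite_description _ (Ffull g)).

Lemma preimK a b (g : hom (F a) (F b)) : fmap F (preim g) = g.
Proof. exact: proj2_sig (constructive_indefinite_description _ (Ffull g)). Qed.

Definition preim_iso (a b : C) (i : iso (F a) (F b)) : iso a b.
Proof.
exists (preim (fwd i)) (preim (bwd i)).
- by apply: Ffaith; rewrite fmapM !preimK bwdK fmap1.
- by apply: Ffaith; rewrite fmapM !preimK fwdK fmap1.
Defined.

Lemma reflect_cokernel a b c (f : hom a b) (g : hom b c) :
  is_cokernel (fmap F f) (fmap F g) -> is_cokernel f g.
Proof.
move=> kfg; apply: is_cokernelI.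
- by apply: Ffaith; rewrite fmapM (is_cokernel0 kfg) fmap0.
- move=> d u v uv; apply/Ffaith/(is_cokernel_epi kfg).
  by rewrite -!fmapM uv.
move=> d h hf; have [|h' hh] := is_cokernel_factor (h := fmap F h) kfg.
  by rewrite -fmapM hf fmap0.
by exists (preim h'); apply: Ffaith; rewrite fmapM preimK.
Qed.

Hypothesis Fes : ess_surj F.

Lemma ess_surj_choice d : {a : C & iso (F a) d}.
Proof.
have [a ia] := constructive_indefinite_description _ (Fes d).
have [i _] : {i : iso (F a) d | True}.
  by apply: constructive_indefinite_description; case: ia => i; exists i.
by exists a.
Qed.

Local Notation obj d := (projT1 (ess_surj_choice d)).
Local Notation ι d := (projT2 (ess_surj_choice d)).

Definition quasi_inverse : functor D C.
Proof.
exists (fun d => obj d) (fun a b f => preim (bwd (ι b) ∘ f ∘ fwd (ι a))).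
- move=> a b l f g; apply: Ffaith.
  by rewrite fmap_lin !preimK comp_linr comp_linl.
- by move=> a; apply: Ffaith; rewrite preimK fmap1 compm1 bwdK.
- move=> a b c g f; apply: Ffaith.
  by rewrite fmapM !preimK !compA (reA (fwdK _)) compm1.
Defined.

Definition quasi_inverse_adj : adjunction F quasi_inverse.
Proof.
exists (fun a => preim (bwd (ι (F a)))) (fun b => fwd (ι b)).
- move=> a b f; apply: Ffaith => /=.
  rewrite !fmapM !preimK -!compA; apply/esym/iso_eql.
  by rewrite !compA fwdK comp1m -compA fwdK compm1.
- by move=> a b f /=; rewrite preimK !compA fwdK comp1m.
- by move=> a; rewrite preimK fwdK.
- move=> b; apply: Ffaith.
  by rewrite fmapM !preimK -!compA fwdK compm1 bwdK fmap1.
Defined.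

Definition quasi_inverse_counit : nat_iso (fcomp F quasi_inverse) (fid D).
Proof. by exists (fun d => ι d) => a b f /=; rewrite preimK !compA fwdK comp1m. Defined.

Definition quasi_inverse_unit : nat_iso (fcomp quasi_inverse F) (fid C).
Proof.
exists (fun a => preim_iso (ι (F a))) => a b f; apply: Ffaith => /=.
by rewrite !fmapM !preimK !compA fwdK comp1m.
Defined.

Lemma ff_es_equivalence : is_equivalence F.
Proof.
exists quasi_inverse; split; apply: inhabits.
- exact: quasi_inverse_unit.
- exact: quasi_inverse_counit.
Qed.

Lemma ff_es_right_exact : right_exact F.
Proof.
move=> a b c f g kfg; apply: is_cokernelI.
- by rewrite -fmapM (is_cokernel0 kfg) fmap0.
- move=> d u v uv.
  have /(@fwd_inj _ _ _ _ _ (iso_sym (ι d))) // : bwd (ι d) ∘ u = bwd (ι d) ∘ v.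
  rewrite -[LHS]preimK -[RHS]preimK; congr (fmap F _).
  apply/(is_cokernel_epi kfg)/Ffaith.
  by rewrite !fmapM !preimK -!compA uv.
move=> d h hf; have [|h' hh] := is_cokernel_factor (h := preim (bwd (ι d) ∘ h)) kfg.
  by apply: Ffaith; rewrite fmapM preimK -compA hf compm0 fmap0.
by exists (fwd (ι d) ∘ fmap F h'); rewrite -compA -fmapM hh preimK compA fwdK comp1m.
Qed.

End FullyFaithful.

Lemma nat_iso_faithful C D (F : functor C D) (G : functor D C) :
  inhabited (nat_iso (fcomp G F) (fid C)) -> faithful F.
Proof.
move=> [n] a b f g fg; apply: (fwd_surj (i := niso n a)).
by rewrite -![_ ∘ fwd (niso n a)](niso_natE n) /= fg.
Qed.

Lemma equivalence_faithful C D (F : functor C D) : is_equivalence F -> faithful F.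
Proof. by move=> [G [n _]]; apply: nat_iso_faithful n. Qed.

Lemma equivalence_full C D (F : functor C D) : is_equivalence F -> full F.
Proof.
move=> [G [[n] m]] a b g; exists (fwd (niso n b) ∘ fmap G g ∘ bwd (niso n a)).
(* [m] makes [G] faithful, so the equation may be checked after [G]. *)
apply: (nat_iso_faithful m); apply: (fwd_inj (i := niso n b)).
have /= -> := niso_natE n.
by rewrite /= -[LHS]compA bwdK compm1.
Qed.

Lemma equivalence_ess_surj C D (F : functor C D) : is_equivalence F -> ess_surj F.
Proof. by move=> [G [_ [m]]] d; exists (G d); apply/inhabits/(niso m d). Qed.

Lemma equivalence_right_exact C D (F : functor C D) :
  is_equivalence F -> right_exact F.
Proof.
by move=> e; apply: (ff_es_right_exact (equivalence_faithful e)
  (equivalence_full e) (equivalence_ess_surj e)).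
Qed.

Lemma is_equivalence_comp A B C (G : functor B C) (F : functor A B) :
  is_equivalence G -> is_equivalence F -> is_equivalence (fcomp G F).
Proof.
move=> eG eF; apply: ff_es_equivalence => [a b f g|a b g|c].
- by move=> /(equivalence_faithful eG) /(equivalence_faithful eF).
- have [f <-] := equivalence_full eG g; have [h <-] := equivalence_full eF f.
  by exists h.
- have [b [i]] := equivalence_ess_surj eG c.
  have [a [j]] := equivalence_ess_surj eF b.
  by exists a; apply: inhabits; apply: iso_comp i (fmap_iso G j).
Qed.

End Equivalences.

Section Adjunctions.
Context (k : fieldType) (C D : category k) (F : functor C D) (G : functor D C)
  (adj : adjunction F G).
Local Notation η := (adj_unit adj).
Local Notation ε := (adj_counit adj).

Lemma ladj_right_exact : right_exact F.
Proof.
move=> a b c f g kfg; apply: is_cokernelI.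
- by rewrite -fmapM (is_cokernel0 kfg) fmap0.
- move=> d u v uv; apply: (adj_injl (adj := adj)).
  by apply: (is_cokernel_epi kfg); rewrite -!compA !(unit_natE adj g) !compA -!fmapM uv.
move=> d h hf.
have [|h' hh] := is_cokernel_factor (h := fmap G h ∘ η b) kfg.
  by rewrite -compA (unit_natE adj f) compA -fmapM hf fmap0 comp0m.
exists (ε d ∘ fmap F h'); rewrite -compA -fmapM hh.
exact: adj_transr.
Qed.

Lemma radj_kernel a b c (f : hom a b) (g : hom b c) :
  is_kernel f g -> is_kernel (fmap G f) (fmap G g).
Proof.
move=> kfg; apply: is_kernelI.
- by rewrite -fmapM (is_kernel0 kfg) fmap0.
- move=> d u v uv; apply: (adj_injr (adj := adj)).
  apply: (is_kernel_mono kfg).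
  by rewrite !compA -!(counit_natE adj f) -!compA -!fmapM uv.
move=> d h hf.
have [|h' hh] := is_kernel_factor (h := ε b ∘ fmap F h) kfg.
  by rewrite compA -(counit_natE adj g) -compA -fmapM hf fmap0 compm0.
exists (fmap G h' ∘ η d); rewrite compA -fmapM hh.
exact: adj_transl.
Qed.

Hypotheses (Cab : abelian C) (Dab : abelian D) (Cp : enough_projectives C)
  (Fp : forall p : C, projective p -> projective (F p)).

(** The transpose [F p -> b] of a projective cover [u] of [G b] lifts through [e], because [F p] is
    projective. Transposing back factors [u] through [G e]. *)
Lemma radj_epi a b (e : hom a b) : is_epi e -> is_epi (fmap G e).
Proof.
move=> ee; have [p [u [pp eu]]] := Cp (G b).
have [v ev] := Fp pp (ε b ∘ fmap F u) ee.
have e1 : fmap G e ∘ (fmap G v ∘ η p) = u.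
  by rewrite compA -fmapM ev; apply: adj_transl.
by rewrite -e1 in eu; apply: epi_comp_left eu.
Qed.

(** [G] preserves the kernel [i] of [g] and the epimorphism [g], so [G g] is the cokernel of [G i].
    The corestriction [f'] of [f] to the image [i] remains an epimorphism under [G], hence [G f] and
    [G i] are killed by the same maps. *)
Lemma radj_right_exact : right_exact G.
Proof.
move=> a b c f g kfg.
have [d [i ki]] := ab_kernel Dab g.
have [f' ff] := is_kernel_factor ki (is_cokernel0 kfg).
have ef := image_epi Dab kfg ki ff.
have eg := radj_epi (is_cokernel_epi kfg).
have kG := epi_is_cokernel Cab eg (radj_kernel ki).
apply: is_cokernelI => // [|x h hf]; first by rewrite -fmapM (is_cokernel0 kfg) fmap0.
apply: (is_cokernel_factor kG); apply: (radj_epi ef).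
by rewrite -compA -fmapM ff hf comp0m.
Qed.

End Adjunctions.

(** Converse of [radj_epi]: the transpose of [f] is lifted through [G e]. *)
Lemma projective_ladj k (C D : category k) (F : functor C D) (G : functor D C)
    (adj : adjunction F G) (p : C) :
  (forall a b (e : hom a b), is_epi e -> is_epi (fmap G e)) ->
  projective p -> projective (F p).
Proof.
move=> Gepi pp a b e f ee.
have [h eh] := pp _ _ _ (fmap G f ∘ adj_unit adj p) (Gepi _ _ _ ee).
exists (adj_counit adj a ∘ fmap F h); apply: (adj_injl (adj := adj)).
by rewrite fmapM -compA (adj_transl adj) eh.
Qed.

Lemma projective_iso k (C : category k) (p q : C) (i : iso p q) :
  projective p -> projective q.
Proof.
move=> pp a b e f ee; have [h eh] := pp _ _ _ (f ∘ fwd i) ee.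
by exists (h ∘ bwd i); rewrite compA eh -compA fwdK compm1.
Qed.

Definition adjunction_comp k (A B C : category k) (F : functor A B)
    (G : functor B A) (F' : functor B C) (G' : functor C B)
    (adj : adjunction F G) (adj' : adjunction F' G') :
  adjunction (fcomp F' F) (fcomp G G').
Proof.
exists (fun a => fmap G (adj_unit adj' (F a)) ∘ adj_unit adj a)
  (fun c => adj_counit adj' c ∘ fmap F' (adj_counit adj (G' c))).
- move=> a b f /=.
  by rewrite -compA (unit_natE adj f) !compA -!fmapM (unit_natE adj' (fmap F f)).
- move=> a b f /=.
  by rewrite -compA -fmapM (counit_natE adj (fmap G' f)) fmapM !compA
    (counit_natE adj' f).
- move=> a /=.
  rewrite -compA -fmapM [fmap F (_ ∘ _)]fmapM compA (counit_natE adj (adj_unit adj' (F a))).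
  by rewrite -compA counit_unit compm1 counit_unit.
- move=> c /=.
  rewrite compA -fmapM [fmap G' (_ ∘ _)]fmapM -compA -(unit_natE adj' (adj_counit adj (G' c))).
  by rewrite compA unit_counit comp1m unit_counit.
Defined.

Definition adjunction_iso k (A B : category k) (F F' : functor A B)
    (G : functor B A) (n : nat_iso F F') (adj : adjunction F G) :
  adjunction F' G.
Proof.
exists (fun a => fmap G (fwd (niso n a)) ∘ adj_unit adj a)
  (fun b => adj_counit adj b ∘ bwd (niso n (G b))).
- move=> a b f /=.
  by rewrite -compA (unit_natE adj f) !compA -!fmapM niso_natE.
- move=> a b f /=.
  by rewrite -compA (nat_iso_bwd n (fmap G f)) !compA (counit_natE adj f).
- move=> a; rewrite -compA (nat_iso_bwd n) fmapM !compA.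
  rewrite (counit_natE adj (fwd (niso n a))) -(compA (fwd _)) counit_unit compm1.
  exact: fwdK.
- by move=> b; rewrite compA -fmapM -compA bwdK compm1 unit_counit.
Defined.

(** * Modules of a right exact monad *)

Section ModulesOfMonad.
Context (k : fieldType) (C : monoidal_category k) (B : module_category C)
  (T : lax_module_monad B).
Local Notation A := (modules T).

Lemma tm_hom_inj (a b : A) (f g : hom a b) :
  lin_val (f : tm_hom a b) = lin_val (g : tm_hom a b) -> f = g.
Proof. exact: val_inj. Qed.

Definition forget : functor A B.
Proof. by exists (@tm_ob _ _ _ T) (fun a b (f : tm_hom a b) => lin_val f). Defined.

Definition free : functor B A.
Proof.
exists (@free_module _ _ _ T)
  (fun a b f => @tm_mk _ _ _ T (free_module T a) (free_module T b) (fmap T f)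
     (esym (mu_natE T f))).
- by move=> a b l f g; apply: tm_hom_inj; rewrite /= fmap_lin.
- by move=> a; apply: tm_hom_inj; rewrite /= fmap1.
- by move=> a b c g f; apply: tm_hom_inj; rewrite /= fmapM.
Defined.

Definition tm_aug (a : A) : hom (free (forget a)) a :=
  @tm_mk _ _ _ T (free_module T a) a (tm_act a) (tm_assoc a).

Definition free_adj : adjunction free forget.
Proof.
exists (eta T) tm_aug.
- by move=> a b f /=; rewrite eta_natE.
- by move=> a b f; apply: tm_hom_inj => /=; rewrite -tm_homP.
- by move=> a; apply: tm_hom_inj => /=; apply: mu_etar.
- by move=> a; apply: tm_unit.
Defined.

(** The difference of the two maps [mu] and [T(tm_act)] of the canonical presentation of a module,
    so that its cokernel is their coequaliser. *)
Definition tm_bar (a : A) : hom (free (T (forget a))) (free (forget a)) :=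
  tm_aug (free (forget a)) - fmap free (tm_act a).

Lemma tm_aug_nat (a b : A) (f : hom a b) :
  tm_aug b ∘ fmap free (fmap forget f) = f ∘ tm_aug a.
Proof. by apply: tm_hom_inj => /=; rewrite -tm_homP. Qed.

Lemma tm_aug_bar (a : A) : tm_aug a ∘ tm_bar a = 0.
Proof.
by apply: tm_hom_inj; rewrite /= compmB tm_assoc subrr.
Qed.

Lemma forget_faithful : faithful forget.
Proof. by move=> a b f g; apply: tm_hom_inj. Qed.

Lemma forget_reflects_epi (a b : A) (e : hom a b) :
  is_epi (fmap forget e) -> is_epi e.
Proof.
by move=> ee c u v uv; apply/forget_faithful/ee; rewrite -!fmapM uv.
Qed.

(** The pair is split by units on underlying objects: precomposing [h ∘ tm_bar a = 0] with [eta] at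
    [T a] gives [h = h ∘ eta ∘ tm_act a]. The same identity shows that the factor [h ∘ eta] is a
    module map. *)
Lemma tm_aug_cokernel (a : A) : is_cokernel (tm_bar a) (tm_aug a).
Proof.
apply: is_cokernelI; first exact: tm_aug_bar.
  apply: forget_reflects_epi; apply: split_epi (tm_unit a).
move=> d h hbar.
have e : fmap forget h = fmap forget h ∘ eta T (forget a) ∘ tm_act a.
  apply/eqP; rewrite -subr_eq0 -[X in X - _]compm1 -(mu_etal T) -[X in _ - X]compA eta_natE.
  rewrite -compmB -compBm compA.
  have /= -> := congr1 (fun f : hom (free (T (forget a))) d => fmap forget f) hbar.
  by rewrite comp0m.
have hm : (fmap forget h ∘ eta T (forget a)) ∘ tm_act a =
    tm_act d ∘ fmap T (fmap forget h ∘ eta T (forget a)).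
  by rewrite -e fmapM compA -(tm_homP h) -compA mu_etar compm1.
by exists (tm_mk hm); apply: tm_hom_inj; rewrite /= -e.
Qed.

(** The action on the kernel is the one induced by the universal property of [i], and its laws are
    cancelled against the monomorphism [i]. *)
Lemma kernel_lift (a b : A) (g : hom a b) (c : B) (i : hom c (forget a)) :
  is_kernel i (fmap forget g) ->
  exists (d : A) (j : hom d a), is_kernel (fmap forget j) (fmap forget g).
Proof.
move=> ki; have [|t it] := is_kernel_factor (h := tm_act a ∘ fmap T i) ki.
  rewrite compA /= (tm_homP g) -compA -fmapM.
  by rewrite (is_kernel0 ki) fmap0 compm0.
have tu : t ∘ eta T c = 1_c.
  apply: (is_kernel_mono ki).
  by rewrite compA it -compA -eta_natE compA (tm_unit a) comp1m compm1.
have ta : t ∘ mu T c = t ∘ fmap T t.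
  apply: (is_kernel_mono ki); rewrite !compA it -compA -mu_natE compA (tm_assoc a).
  by rewrite -!compA -!fmapM it.
by exists (TMod tu ta), (@tm_mk _ _ _ T (TMod tu ta) a i it).
Qed.

Lemma forget_reflects_kernel (a b c : A) (f : hom a b) (g : hom b c) :
  is_kernel (fmap forget f) (fmap forget g) -> is_kernel f g.
Proof.
move=> kfg; apply: is_kernelI.
- by apply: forget_faithful; rewrite fmapM (is_kernel0 kfg).
- by move=> d u v uv; apply/forget_faithful/(is_kernel_mono kfg); rewrite -!fmapM uv.
move=> d h gh; have [|h' hh] := is_kernel_factor (h := fmap forget h) kfg.
  by rewrite -fmapM gh.
have hm : h' ∘ tm_act d = tm_act a ∘ fmap T h'.
  apply: (is_kernel_mono kfg); rewrite !compA hh /= (tm_homP h) (tm_homP f).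
  by rewrite -compA -fmapM hh.
by exists (tm_mk hm); apply: forget_faithful; rewrite fmapM.
Qed.

Hypotheses (Bab : abelian B) (Tex : right_exact T).

(** Right exactness of [T] enters twice: [T q] is a cokernel, which defines the action on [c], and
    [T T q] is an epimorphism, which proves its associativity. *)
Lemma cokernel_lift (a b : A) (f : hom a b) (c : B) (q : hom (forget b) c) :
  is_cokernel (fmap forget f) q ->
  exists (d : A) (r : hom b d), is_cokernel (fmap forget f) (fmap forget r).
Proof.
move=> kq; have kTq := Tex kq.
have eTTq := is_cokernel_epi (Tex kTq).
have [|t tq] := is_cokernel_factor (h := q ∘ tm_act b) kTq.
  by rewrite -compA -(tm_homP f) compA (is_cokernel0 kq) comp0m.
have tu : t ∘ eta T c = 1_c.
  apply: (is_cokernel_epi kq).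
  by rewrite -compA eta_natE compA tq -compA (tm_unit b) compm1 comp1m.
have ta : t ∘ mu T c = t ∘ fmap T t.
  apply: eTTq; rewrite -compA mu_natE compA tq (reA (tm_assoc b)).
  by rewrite -(compA t) -fmapM tq fmapM !compA tq.
by exists (TMod tu ta), (@tm_mk _ _ _ T b (TMod tu ta) q (esym tq)).
Qed.

Lemma forget_reflects_cokernel (a b c : A) (f : hom a b) (g : hom b c) :
  is_cokernel (fmap forget f) (fmap forget g) -> is_cokernel f g.
Proof.
move=> kfg; apply: is_cokernelI.
- by apply: forget_faithful; rewrite fmapM (is_cokernel0 kfg).
- exact/forget_reflects_epi/(is_cokernel_epi kfg).
move=> d h hf; have [|h' hh] := is_cokernel_factor (h := fmap forget h) kfg.
  by rewrite -fmapM hf.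
have hm : h' ∘ tm_act c = tm_act d ∘ fmap T h'.
  apply: (is_cokernel_epi (Tex kfg)).
  rewrite -compA -(tm_homP g) compA hh (tm_homP h).
  by rewrite -compA -fmapM hh.
by exists (tm_mk hm); apply: forget_faithful; rewrite fmapM.
Qed.

(** Any cokernel of [f] is isomorphic to the lifted one, whose underlying map is a cokernel by
    construction. *)
Lemma forget_right_exact : right_exact forget.
Proof.
move=> a b c f g kfg.
have [d [q kq]] := ab_cokernel Bab (fmap forget f).
have [e [r kr]] := cokernel_lift kq.
have [l lr] := cokernel_unique (forget_reflects_cokernel kr) kfg.
apply: (@cokernel_iso _ _ _ _ _ _ _ _ _ _ _ _ (iso_refl _) (iso_refl _)
  (fmap_iso forget l)) kr => /=.
- by rewrite comp1m compm1.
- by rewrite compm1 -lr.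
Qed.

Lemma forget_epi (a b : A) (e : hom a b) : is_epi e -> is_epi (fmap forget e).
Proof.
move=> ee; apply/epiP => d u ue.
have [c [q kq]] := ab_cokernel Bab (fmap forget e).
have [c' [r kr]] := cokernel_lift kq.
have r0 : r = 0 by apply: ee; rewrite comp0m; apply: forget_faithful; rewrite fmapM (is_cokernel0 kr).
have [u' <-] := is_cokernel_factor kr ue.
by rewrite r0 fmap0 compm0.
Qed.

Lemma forget_mono (a b : A) (i : hom a b) : is_mono i -> is_mono (fmap forget i).
Proof.
move=> mi; apply/monoP => d u iu.
have [c [j kj]] := ab_kernel Bab (fmap forget i).
have [c' [l kl]] := kernel_lift kj.
have l0 : l = 0 by apply: mi; rewrite compm0; apply: forget_faithful; rewrite fmapM (is_kernel0 kl).
have [u' <-] := is_kernel_factor kl iu.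
by rewrite l0 fmap0 comp0m.
Qed.

Lemma modules_biproduct (a b : A) : exists (s : A) (i : hom a s) (j : hom b s)
  (p : hom s a) (q : hom s b), is_biproduct i j p q.
Proof.
have [s [i [j [p [q [pi qj pj qi sum]]]]]] := ab_biproduct Bab (forget a) (forget b).
pose t := i ∘ tm_act a ∘ fmap T p + j ∘ tm_act b ∘ fmap T q.
have tu : t ∘ eta T s = 1_s.
  rewrite compDm -!compA -!eta_natE (compA (tm_act a)) (tm_unit a) comp1m.
  by rewrite (compA (tm_act b)) (tm_unit b) comp1m.
have pt : p ∘ t = tm_act a ∘ fmap T p.
  by rewrite compmD !compA pi pj !comp0m addr0 comp1m.
have qt : q ∘ t = tm_act b ∘ fmap T q.
  by rewrite compmD !compA qi qj !comp0m add0r comp1m.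
have ta : t ∘ mu T s = t ∘ fmap T t.
  rewrite !compDm -!compA -!mu_natE -!fmapM pt qt.
  by rewrite !(compA (tm_act _)) (tm_assoc a) (tm_assoc b) !fmapM -!compA.
have ti : i ∘ tm_act a = t ∘ fmap T i.
  by rewrite compDm -!compA -!fmapM pi qi fmap0 !compm0 addr0 fmap1 compm1.
have tj : j ∘ tm_act b = t ∘ fmap T j.
  by rewrite compDm -!compA -!fmapM pj qj fmap0 !compm0 add0r fmap1 compm1.
exists (TMod tu ta), (@tm_mk _ _ _ T a (TMod tu ta) i ti).
exists (@tm_mk _ _ _ T b (TMod tu ta) j tj).
exists (@tm_mk _ _ _ T (TMod tu ta) a p pt), (@tm_mk _ _ _ T (TMod tu ta) b q qt).
by split; apply: tm_hom_inj.
Qed.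

Lemma modules_abelian : abelian A.
Proof.
split.
- have [z [z1 z2]] := ab_zero Bab.
  have tu : (0 : hom (T z) z) ∘ eta T z = 1_z by rewrite [LHS]z1 [RHS]z1.
  have ta : (0 : hom (T z) z) ∘ mu T z = 0 ∘ fmap T (0 : hom (T z) z).
    by rewrite !comp0m.
  by exists (TMod tu ta); split=> a f; apply: tm_hom_inj; rewrite ?[LHS]z1 ?[LHS]z2.
- exact: modules_biproduct.
- move=> b c g; have [a [f kf]] := ab_kernel Bab (fmap forget g).
  have [d [j kj]] := kernel_lift kf.
  by exists d, j; apply: forget_reflects_kernel.
- move=> a b f; have [c [g kg]] := ab_cokernel Bab (fmap forget f).
  have [d [r kr]] := cokernel_lift kg.
  by exists d, r; apply: forget_reflects_cokernel.
- move=> a b i mi; have [c [g kg]] := ab_cokernel Bab (fmap forget i).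
  have [d [r kr]] := cokernel_lift kg.
  exists d, r; apply: forget_reflects_kernel.
  exact: mono_is_kernel (forget_mono mi) kr.
- move=> b c e ee; have [a [f kf]] := ab_kernel Bab (fmap forget e).
  have [d [j kj]] := kernel_lift kf.
  exists d, j; apply: forget_reflects_cokernel.
  exact: epi_is_cokernel (forget_epi ee) kj.
Qed.

End ModulesOfMonad.

Section ExtensionFromFree.
Context (k : fieldType) (C : monoidal_category k) (B : module_category C)
  (T : lax_module_monad B) (D : category k).
Local Notation A := (modules T).

Lemma natural_eq_on_free (R R' : functor A D) (t t' : forall a, hom (R a) (R' a)) :
  right_exact R -> natural t -> natural t' ->
  (forall b, t (free T b) = t' (free T b)) -> forall a, t a = t' a.
Proof.
move=> Rex nt nt' e a; apply: (is_cokernel_epi (Rex _ _ _ _ _ (tm_aug_cokernel a))).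
by rewrite nt nt' e.
Qed.

Lemma natural_extend (R R' : functor A D)
    (t : forall b, hom (R (free T b)) (R' (free T b))) :
  right_exact R ->
  (forall b b' (f : hom (free T b) (free T b')), t b' ∘ fmap R f = fmap R' f ∘ t b) ->
  exists2 t' : forall a, hom (R a) (R' a), natural t' & forall b, t' (free T b) = t b.
Proof.
move=> Rex nt; have kR a := Rex _ _ _ _ _ (tm_aug_cokernel a).
have ex (a : A) : exists u : hom (R a) (R' a),
    u ∘ fmap R (tm_aug a) = fmap R' (tm_aug a) ∘ t (forget T a).
  apply: (is_cokernel_factor (kR a)).
  by rewrite -compA nt compA -fmapM tm_aug_bar fmap0 comp0m.
pose t' a := proj1_sig (constructive_indefinite_description _ (ex a)).
have t'E a : t' a ∘ fmap R (tm_aug a) = fmap R' (tm_aug a) ∘ t (forget T a).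
  exact: (proj2_sig (constructive_indefinite_description _ (ex a))).
exists t'.
- move=> a b f; apply: (is_cokernel_epi (kR a)).
  rewrite -!compA t'E -fmapM -tm_aug_nat fmapM compA t'E -compA nt.
  by rewrite !compA -!fmapM tm_aug_nat.
(* The augmentation of a free module is itself a map between free modules, so [t] is already natural
   along it. *)
- move=> b; apply: (is_cokernel_epi (kR _)).
  by rewrite t'E -(nt _ _ (tm_aug (free T b))).
Qed.

Lemma nat_iso_extend (R R' : functor A D)
    (t : forall b, iso (R (free T b)) (R' (free T b))) :
  right_exact R -> right_exact R' ->
  (forall b b' (f : hom (free T b) (free T b')),
     fwd (t b') ∘ fmap R f = fmap R' f ∘ fwd (t b)) ->
  exists n : nat_iso R R', forall b, fwd (niso n (free T b)) = fwd (t b).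
Proof.
move=> Rex Rex' nt.
have nt' b b' (f : hom (free T b) (free T b')) :
    bwd (t b') ∘ fmap R' f = fmap R f ∘ bwd (t b).
  apply/esym/iso_eql; rewrite compA; apply/esym/iso_eqr.
  by rewrite -nt.
have [u nu uE] := natural_extend Rex nt.
have [v nv vE] := natural_extend Rex' nt'.
have vu a : v a ∘ u a = 1_(R a).
  apply: (natural_eq_on_free (R := R) (R' := R) (t := fun a => v a ∘ u a)
    (t' := fun a => 1_(R a))) => //.
  - by move=> x y f; rewrite -compA nu compA nv compA.
  - by move=> x y f; rewrite comp1m compm1.
  - by move=> b; rewrite uE vE bwdK.
have uv a : u a ∘ v a = 1_(R' a).
  apply: (natural_eq_on_free (R := R') (R' := R') (t := fun a => u a ∘ v a)
    (t' := fun a => 1_(R' a))) => //.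
  - by move=> x y f; rewrite -compA nv compA nu compA.
  - by move=> x y f; rewrite comp1m compm1.
  - by move=> b; rewrite uE vE fwdK.
by exists (@NatIso _ _ _ R R' (fun a => Iso (vu a) (uv a)) nu).
Qed.

End ExtensionFromFree.

(** * The action extended from the Kleisli category *)

Section KleisliPresentation.
Context (k : fieldType) (C : monoidal_category k) (B : module_category C)
  (T : lax_module_monad B).
Local Notation A := (modules T).
Local Notation K := (kleisli_cat T).
Local Notation J := (kleisli_incl T).

Lemma kleisli_incl_kl (a b : B) (u : hom a b) : fmap J (kl T u) = fmap (free T) u.
Proof. by apply: tm_hom_inj; rewrite /= /kl fmapM compA mu_etar comp1m. Qed.

Lemma kleisli_incl_full : full J.
Proof.
move=> a b g.
exists (fmap (forget T) g ∘ eta T a : @hom k K a b); apply: tm_hom_inj => /=.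
have e := tm_homP g.
by rewrite fmapM compA -e -compA mu_etar compm1.
Qed.

(** The Kleisli morphism that [J] sends to [mu], the augmentation of the free module. Likewise
    [kleisli_bar] lifts [tm_bar]: in the Kleisli category the action of [x] can be applied to it
    before any action on modules exists. *)
Definition kleisli_aug (a : B) : @hom k K (T a) a := 1_(T a).

Definition kleisli_bar (a : A) : @hom k K (T (forget T a)) (forget T a) :=
  kleisli_aug (forget T a) - kl T (tm_act a).

Lemma kleisli_bar_nat (a b : A) (f : hom a b) :
  kl T (fmap (forget T) f) ∘ kleisli_bar a =
  kleisli_bar b ∘ kl T (fmap T (fmap (forget T) f)) :> @hom k K _ _.
Proof.
rewrite /kleisli_bar compmB compBm -!klM; congr (_ - kl T _).
- by rewrite kl_compl kl_compr compm1 comp1m.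
- exact: (tm_homP f).
Qed.

Lemma kleisli_aug_nat (a b : B) (f : @hom k K a b) :
  kleisli_aug b ∘ kl T (fmap (forget T) (fmap J f)) = f ∘ kleisli_aug a
    :> @hom k K _ _.
Proof. by rewrite kl_compr kleisli_compE comp1m compm1. Qed.

Lemma kleisli_aug_bar (a : B) :
  kleisli_aug a ∘ kleisli_bar (J a) = 0 :> @hom k K _ _.
Proof.
rewrite compmB kl_compr kleisli_compE /kleisli_aug /=.
by rewrite fmap1 !compm1 comp1m subrr.
Qed.

Lemma kleisli_aug_eta (a : B) :
  kleisli_aug a ∘ kl T (eta T a) = @idm k K a.
Proof. by rewrite kl_compr comp1m. Qed.

(** Together with [kleisli_aug_eta] this is a contraction: the presentation of a free module is a
    split cokernel in the Kleisli category, hence preserved by every linear functor, in particular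
    by the action of [x]. *)
Lemma kleisli_bar_split (a : B) :
  kleisli_bar (J a) ∘ kl T (fmap T (eta T a)) =
  kl T (eta T a) ∘ kleisli_aug a - 1_(T a : K) :> @hom k K _ _.
Proof.
rewrite compBm kl_compr kl_compl -klM /= mu_etar kl1.
by rewrite comp1m compm1.
Qed.

End KleisliPresentation.

(** * Module structures determined on free modules *)

(** Density relative to right exact functors: all that the coherence of the extended action and the
    extension of strong structures use of the Kleisli inclusion. *)
Record dense k (K A : category k) (J : functor K A) : Prop := Dense {
  dense_eq : forall (D : category k) (R R' : functor A D)
    (t t' : forall a, hom (R a) (R' a)), right_exact R ->
    natural t -> natural t' -> (forall b, t (J b) = t' (J b)) ->
    forall a, t a = t' a;
  dense_ext : forall (D : category k) (R R' : functor A D)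
    (t : forall b, iso (R (J b)) (R' (J b))), right_exact R -> right_exact R' ->
    (forall b b' (g : hom b b'),
       fwd (t b') ∘ fmap R (fmap J g) = fmap R' (fmap J g) ∘ fwd (t b)) ->
    exists n : nat_iso R R', forall b, fwd (niso n (J b)) = fwd (t b)
}.

(** The inclusion is full, so naturality along Kleisli morphisms is naturality along all maps of
    free modules. *)
Lemma kleisli_incl_dense k (C : monoidal_category k) (B : module_category C)
  (T : lax_module_monad B) : dense (kleisli_incl T).
Proof.
split=> [D R R' t t'|D R R' t Rex Rex' nt]; first exact: natural_eq_on_free.
apply: nat_iso_extend => // b b' f.
by have [g <-] := kleisli_incl_full f; apply: nt.
Qed.

Section Coherence.
Context (k : fieldType) (C : monoidal_category k) (K : module_category C)
  (A : category k) (J : functor K A) (H : bifunctor C A A)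
  (σ : forall x b, iso (H x (J b)) (J (x ▷ b))).
Hypotheses (Jd : dense J) (HX : forall x, right_exact (bif_left H x))
  (σ_nat : forall x x' a b (f : hom x x') (g : hom a b),
     fwd (σ x' b) ∘ bmap H f (fmap J g) = fmap J (f ▷h g) ∘ fwd (σ x a)).
Local Notation "f ▶ g" := (bmap H f g) (at level 35).

Definition coh_sigma2 (x y : C) (b : K) : iso (H x (H y (J b))) (J (x ▷ y ▷ b)) :=
  iso_comp (σ x (y ▷ b)) (fmap_iso (bif_left H x) (σ y b)).

Local Notation σ2 := coh_sigma2.

Lemma coh_sigma2_nat x x' y y' a b (f : hom x x') (g : hom y y') (h : hom a b) :
  fwd (σ2 x' y' b) ∘ (f ▶ (g ▶ fmap J h)) = fmap J (f ▷h (g ▷h h)) ∘ fwd (σ2 x y a).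
Proof.
rewrite /= -compA -bmapM comp1m σ_nat -[f in LHS]compm1 bmapM compA.
by rewrite σ_nat compA.
Qed.

Lemma coh_assoc_ex (x y : C) :
  exists n : nat_iso (bif_left H (x ⊗ y)) (fcomp (bif_left H x) (bif_left H y)),
    forall b, fwd (σ2 x y b) ∘ fwd (niso n (J b)) =
      fmap J (fwd (aso x y b)) ∘ fwd (σ (x ⊗ y) b).
Proof.
pose t b : iso (H (x ⊗ y) (J b)) (H x (H y (J b))) :=
  iso_comp (iso_sym (σ2 x y b)) (iso_comp (fmap_iso J (aso x y b)) (σ (x ⊗ y) b)).
have tE b : fwd (σ2 x y b) ∘ fwd (t b) = fmap J (fwd (aso x y b)) ∘ fwd (σ (x ⊗ y) b).
  by rewrite /t [fwd (iso_comp (iso_sym _) _)]/= compA fwdK comp1m.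
have [||b b' g|n nE] := dense_ext Jd (R := bif_left H (x ⊗ y))
  (R' := fcomp (bif_left H x) (bif_left H y)) (t := t); last 1 first.
- by exists n => b; rewrite nE tE.
- exact: HX.
- exact: right_exact_comp (HX x) (HX y).
apply: (fwd_inj (i := σ2 x y b')).
rewrite compA tE -compA [fmap (bif_left _ _) _]/= σ_nat [in RHS]compA.
rewrite [fmap (fcomp _ _) _]/= coh_sigma2_nat -[RHS]compA tE !compA -!fmapM.
by rewrite -(bmap1 tens) aassoc_nat.
Qed.

Definition coh_assoc (x y : C) :=
  proj1_sig (constructive_indefinite_description _ (coh_assoc_ex x y)).

Lemma coh_assoc_incl (x y : C) b :
  fwd (σ2 x y b) ∘ fwd (niso (coh_assoc x y) (J b)) =
    fmap J (fwd (aso x y b)) ∘ fwd (σ (x ⊗ y) b).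
Proof.
exact: (proj2_sig (constructive_indefinite_description _ (coh_assoc_ex x y))).
Qed.

Lemma coh_assoc_inclE (x y : C) b :
  fwd (σ x (y ▷ b)) ∘ (1_x ▶ fwd (σ y b)) ∘ fwd (niso (coh_assoc x y) (J b)) =
    fmap J (fwd (aso x y b)) ∘ fwd (σ (x ⊗ y) b).
Proof. exact: coh_assoc_incl. Qed.

Lemma coh_unit_ex :
  exists n : nat_iso (bif_left H tunit) (fid A),
    forall b, fwd (niso n (J b)) = fmap J (fwd (uno b)) ∘ fwd (σ tunit b).
Proof.
pose t b : iso (H tunit (J b)) (J b) := iso_comp (fmap_iso J (uno b)) (σ tunit b).
have [||b b' g|n nE] := dense_ext Jd (R := bif_left H tunit) (R' := fid A) (t := t);
  last 1 first.
- by exists n => b; rewrite nE.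
- exact: HX.
- by [].
by rewrite /= -compA σ_nat !compA -!fmapM aunit_nat.
Qed.

Definition coh_unit := proj1_sig (constructive_indefinite_description _ coh_unit_ex).

Lemma coh_unit_incl b : fwd (niso coh_unit (J b)) =
  fmap J (fwd (uno b)) ∘ fwd (σ tunit b).
Proof. exact: (proj2_sig (constructive_indefinite_description _ coh_unit_ex)). Qed.

Local Notation α x y a := (fwd (niso (coh_assoc x y) a)).
Local Notation υ a := (fwd (niso coh_unit a)).

Lemma coh_assoc_natm (x y : C) (a b : A) (f : hom a b) :
  α x y b ∘ (1_(x ⊗ y) ▶ f) = (1_x ▶ (1_y ▶ f)) ∘ α x y a.
Proof. exact: (niso_natE (coh_assoc x y)). Qed.

(** The associator is extended for each pair [x], [y] separately, so naturality in these is not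
    built in. Both sides are natural in the module, hence may be compared on the objects [J d],
    where the associator is that of [K]. *)
Lemma coh_assoc_nat x x' y y' (a b : A) (f : hom x x') (g : hom y y') (h : hom a b) :
  α x' y' b ∘ ((f ⊗h g) ▶ h) = (f ▶ (g ▶ h)) ∘ α x y a.
Proof.
have natx c : α x' y' c ∘ ((f ⊗h g) ▶ 1_c) = (f ▶ (g ▶ 1_c)) ∘ α x y c.
  apply: (dense_eq Jd (R := bif_left H (x ⊗ y))
    (R' := fcomp (bif_left H x') (bif_left H y'))
    (t := fun c => α x' y' c ∘ ((f ⊗h g) ▶ 1_c))
    (t' := fun c => (f ▶ (g ▶ 1_c)) ∘ α x y c)) => // [d e u|d e u|d].
  - rewrite /= -[LHS]compA bmap_idr -(bmap_idl _ _ u) !compA.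
    by rewrite coh_assoc_natm.
  - rewrite /= -[LHS]compA coh_assoc_natm !compA -!bmapM.
    by rewrite !comp1m !compm1.
  - apply: (fwd_inj (i := σ2 x' y' d)).
    rewrite !compA coh_assoc_incl -!(fmap1 J) coh_sigma2_nat.
    rewrite (reA (coh_assoc_incl x y d)) (reA (σ_nat _ _)) !compA -!fmapM.
    by rewrite aassoc_nat.
rewrite -(bmap_idr H (f ⊗h g)) compA natx.
have -> : (f ▶ (g ▶ h)) = (f ▶ (g ▶ 1_b)) ∘ (1_x ▶ (1_y ▶ h)).
  by rewrite -!bmapM !comp1m !compm1.
by rewrite -!compA coh_assoc_natm.
Qed.

Definition coh_str : module_structure C A.
Proof.
exists H (fun x y a => niso (coh_assoc x y) a) (fun a => niso coh_unit a).
- exact: coh_assoc_nat.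
- by move=> m m' f; apply: (niso_natE coh_unit).
- move=> x y z.
  apply: (dense_eq Jd (R := bif_left H ((x ⊗ y) ⊗ z))
    (R' := fcomp (bif_left H x) (fcomp (bif_left H y) (bif_left H z)))
    (t := fun m => α x y (H z m) ∘ α (x ⊗ y) z m)
    (t' := fun m => (1_x ▶ α y z m) ∘ α x (y ⊗ z) m
      ∘ (fwd (tassoc x y z) ▶ 1_m))) => // [a b u|a b u|b].
  + by rewrite /= -compA coh_assoc_natm !compA coh_assoc_natm.
  + rewrite /= -compA bmap_idr -(bmap_idl _ _ u) !compA.
    rewrite (reA (coh_assoc_natm _ _ u)) !compA; congr (_ ∘ _ ∘ _).
    by rewrite -!bmapM !comp1m coh_assoc_natm.
  (* [σ3] identifies the triple action on [J b] with [J (x ▷ y ▷ z ▷ b)]; under it the equation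
     becomes the image under [J] of the pentagon of [K]. *)
  + pose σ3 := iso_comp (σ2 x y (z ▷ b))
      (fmap_iso (fcomp (bif_left H x) (bif_left H y)) (σ z b)).
    apply: (fwd_inj (i := σ3)); rewrite {}/σ3.
    rewrite /= !compA (reA (esym (coh_assoc_natm x y (fwd (σ z b))))) !compA.
    rewrite coh_assoc_inclE (reA3 (coh_assoc_inclE (x ⊗ y) z b)) !compA -fmapM.
    rewrite apentagon.
    have e : (1_x ▶ fwd (σ y (z ▷ b))) ∘ (1_x ▶ (1_y ▶ fwd (σ z b))) ∘ (1_x ▶ α y z (J b)) =
        (1_x ▶ fmap J (fwd (aso y z b))) ∘ (1_x ▶ fwd (σ (y ⊗ z) b)).
      by rewrite -!bmapM !comp1m coh_assoc_inclE.
    rewrite (reA3 e) !compA σ_nat (reA3 (coh_assoc_inclE x (y ⊗ z) b)) !compA.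
    by rewrite -(fmap1 J) -[RHS]compA σ_nat !fmapM !compA.
- move=> x.
  apply: (dense_eq Jd (R := bif_left H (x ⊗ tunit))
    (R' := bif_left H x)
    (t := fun m => (1_x ▶ υ m) ∘ α x tunit m)
    (t' := fun m => fwd (runit x) ▶ 1_m)) => // [a b u|a b u|b].
  + rewrite /= -compA coh_assoc_natm !compA -!bmapM !comp1m.
    by congr (bmap H _ _ ∘ _); apply: (niso_natE coh_unit).
  + by rewrite /= -!bmapM !comp1m !compm1.
  + apply: (fwd_inj (i := σ x b)).
    rewrite /= coh_unit_incl bmap_comp_idl !compA σ_nat.
    rewrite (reA3 (coh_assoc_inclE x tunit b)) compA -fmapM atriangle.
    by rewrite -(fmap1 J) σ_nat.
Defined.

Definition coh_strong : @strong_structure k C K (ModuleCategory coh_str) J.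
Proof.
exists σ; split=> [x x' m m' f g|x y m|m].
- exact: σ_nat.
- by rewrite -coh_assoc_inclE.
- by rewrite -coh_unit_incl.
Defined.

End Coherence.


Section Extension.
Context (k : fieldType) (C : monoidal_category k) (B : module_category C)
  (T : lax_module_monad B).
Hypotheses (Bab : abelian B) (Bex : right_exact2 (act (modstr B)))
  (Tex : right_exact T).
Local Notation A := (modules T).
Local Notation K := (kleisli T).
Local Notation J := (kleisli_incl T).
Local Notation "f *h g" := (bmap (kleisli_act T) f g) (at level 35).
Local Notation U := (forget T).

(** Unfolded, this is [mu ∘ T(lax) - T(x ▷ tm_act a)], the difference of the two maps whose
    coequaliser is the extended action on [a]. *)
Definition ext_rel (x : C) (a : A) := fmap J (1_x *h kleisli_bar a).

Definition ext_cokernel (x : C) (a : A) :=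
  cokernel_choice (ext_rel x a) (modules_abelian Bab Tex).

Definition ext_ob (x : C) (a : A) : A := projT1 (ext_cokernel x a).

Definition ext_proj (x : C) (a : A) :
  hom (J (kleisli_act T x (U a))) (ext_ob x a) := proj1_sig (projT2 (ext_cokernel x a)).

Lemma ext_projP (x : C) (a : A) : is_cokernel (ext_rel x a) (ext_proj x a).
Proof. exact: (proj2_sig (projT2 (ext_cokernel x a))). Qed.

Lemma ext_proj_epi (x : C) (a : A) : is_epi (ext_proj x a).
Proof. exact: is_cokernel_epi (ext_projP x a). Qed.

Lemma ext_proj_rel x x' (a b : A) (f : hom x x') (g : hom a b) :
  ext_proj x' b ∘ fmap J (f *h kl T (fmap U g)) ∘ ext_rel x a = 0.
Proof.
rewrite /ext_rel -compA -fmapM -bmapM kleisli_bar_nat compm1 -(comp1m f) bmapM.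
by rewrite fmapM compA (is_cokernel0 (ext_projP x' b)) comp0m.
Qed.

Definition ext_map x x' (a b : A) (f : hom x x') (g : hom a b) :
  hom (ext_ob x a) (ext_ob x' b) :=
  proj1_sig (cokernel_desc (ext_projP x a) (ext_proj_rel f g)).

Lemma ext_mapE x x' (a b : A) (f : hom x x') (g : hom a b) :
  ext_map f g ∘ ext_proj x a = ext_proj x' b ∘ fmap J (f *h kl T (fmap U g)).
Proof. exact: (proj2_sig (cokernel_desc (ext_projP x a) (ext_proj_rel f g))). Qed.

Lemma kl_lin (a b : B) : linear (fun u : hom a b => kl T u : @hom k (kleisli_cat T) a b).
Proof. exact: comp_linr. Qed.

Definition ext_act : bifunctor C A A.
Proof.
exists ext_ob ext_map.
- move=> x x' a b g l f h; apply: (@ext_proj_epi x a).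
  by rewrite comp_linl !ext_mapE bmap_linl fmap_lin comp_linr.
- move=> x x' a b f l g h; apply: (@ext_proj_epi x a).
  by rewrite comp_linl !ext_mapE fmap_lin kl_lin bmap_linr fmap_lin comp_linr.
- move=> x a; apply: (@ext_proj_epi x a).
  by rewrite ext_mapE comp1m fmap1 kl1 bmap1 fmap1 compm1.
- move=> x x' x'' a b c f' f g' g; apply: (@ext_proj_epi x a).
  rewrite ext_mapE -compA ext_mapE compA ext_mapE -compA -fmapM -bmapM.
  by rewrite -klM -fmapM.
Defined.

Local Notation "f ▶ g" := (bmap ext_act f g) (at level 35).

Lemma ext_actE x x' (a b : A) (f : hom x x') (g : hom a b) :
  (f ▶ g) ∘ ext_proj x a = ext_proj x' b ∘ fmap J (f *h kl T (fmap U g)).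
Proof. exact: ext_mapE. Qed.

Lemma incl_act_kl x x' (a b : B) (f : hom x x') (u : hom a b) :
  fmap J (f *h kl T u) = fmap (free T) (f ▷h u).
Proof. by rewrite kl_act kleisli_incl_kl. Qed.

(** Generators and relations of the action are the free modules on [x ▷ U a] and [x ▷ T (U a)].
    These are right exact in each variable, since [free] is a left adjoint and [forget], [T] and the
    action on [B] are right exact; cokernels then commute with cokernels. *)
Lemma ext_act_right_exact : right_exact2 ext_act.
Proof.
have freeX := ladj_right_exact (free_adj T).
have UX := forget_right_exact Bab Tex.
split=> [x a b c f g kfg|a x y z f g kfg].
- have kUfg := UX _ _ _ _ _ kfg.
  apply: (cokernel_of_cokernels (@ext_proj_epi x a) (ext_projP x b) (ext_projP x c)
    (f := 1_x ▶ f) (g := 1_x ▶ g)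
    (f0 := fmap J (1_x *h kl T (fmap U f))) (g0 := fmap J (1_x *h kl T (fmap U g)))
    (g1 := fmap J (1_x *h kl T (fmap T (fmap U g))))).
  + by rewrite !incl_act_kl; apply/freeX/(Bex.1 x).
  + rewrite incl_act_kl; apply: is_cokernel_epi.
    exact: freeX _ _ _ _ _ (Bex.1 x _ _ _ _ _ (Tex kUfg)).
  + exact: ext_actE.
  + exact: ext_actE.
  + by rewrite /ext_rel -!fmapM -!bmapM kleisli_bar_nat.
- apply: (cokernel_of_cokernels (@ext_proj_epi x a) (ext_projP y a) (ext_projP z a)
    (f := f ▶ 1_a) (g := g ▶ 1_a)
    (f0 := fmap J (f *h kl T (1_(U a)))) (g0 := fmap J (g *h kl T (1_(U a))))
    (g1 := fmap J (g *h kl T (1_(T (U a)))))).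
  + by rewrite !incl_act_kl; apply/freeX/(Bex.2 (U a)).
  + rewrite incl_act_kl; apply: is_cokernel_epi.
    exact: freeX _ _ _ _ _ (Bex.2 (T (U a)) _ _ _ _ _ kfg).
  + exact: ext_actE.
  + exact: ext_actE.
  + by rewrite /ext_rel -!fmapM -!bmapM !kl1 !comp1m !compm1.
Qed.

Lemma ext_sigma_rel (x : C) (b : B) :
  fmap J (1_x *h kleisli_aug T b) ∘ ext_rel x (J b) = 0.
Proof. by rewrite /ext_rel -fmapM -bmapM kleisli_aug_bar bmapm0 fmap0. Qed.

Definition ext_sigma_fwd (x : C) (b : B) :
  hom (ext_act x (J b)) (J (kleisli_act T x b)) :=
  proj1_sig (cokernel_desc (ext_projP x (J b)) (ext_sigma_rel x b)).

Lemma ext_sigma_fwdE (x : C) (b : B) :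
  ext_sigma_fwd x b ∘ ext_proj x (J b) = fmap J (1_x *h kleisli_aug T b).
Proof. exact: (proj2_sig (cokernel_desc (ext_projP x (J b)) (ext_sigma_rel x b))). Qed.

Definition ext_sigma (x : C) (b : B) : iso (ext_act x (J b)) (J (kleisli_act T x b)).
Proof.
exists (ext_sigma_fwd x b) (ext_proj x (J b) ∘ fmap J (1_x *h kl T (eta T b))).
- apply: (@ext_proj_epi x (J b)); rewrite -compA ext_sigma_fwdE comp1m -compA -fmapM.
  rewrite -bmapM comp1m.
  (* By the contraction, [eta] after the augmentation differs from the identity by a multiple of the
     bar map, which dies in the cokernel. *)
  have -> : kl T (eta T b) ∘ kleisli_aug T b =
      1_(T b : kleisli_cat T) + kleisli_bar (J b) ∘ kl T (fmap T (eta T b)).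
    by rewrite kleisli_bar_split addrC subrK.
  rewrite bmapmD bmap1 fmapD fmap1 compmD compm1 -(comp1m (1_x)) bmapM fmapM.
  by rewrite compA (is_cokernel0 (ext_projP x (J b))) comp0m addr0.
- rewrite compA ext_sigma_fwdE -fmapM -bmapM kleisli_aug_eta comp1m bmap1.
  exact: fmap1.
Defined.

Lemma ext_sigma_nat x x' (a b : K) (f : hom x x') (g : hom a b) :
  fwd (ext_sigma x' b) ∘ (f ▶ fmap J g) = fmap J (f ▷h g) ∘ fwd (ext_sigma x a).
Proof.
apply: (@ext_proj_epi x (J a)).
rewrite -compA ext_actE compA -[RHS]compA !ext_sigma_fwdE -!fmapM -!bmapM.
by rewrite kleisli_aug_nat comp1m compm1.
Qed.

Lemma extended_from_kleisli_exists :
  exists E : module_structure C A, extended_from_kleisli E.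
Proof.
have [HX _] := ext_act_right_exact.
exists (coh_str (@kleisli_incl_dense _ _ _ T) HX ext_sigma_nat); split.
- exact: ext_act_right_exact.
- exact/inhabits/coh_strong.
Qed.

End Extension.

(** * Strong module functors and module equivalences *)

Section StrongOperations.
Context (k : fieldType) (C : monoidal_category k).
Implicit Types M N P : module_category C.

Definition strong_comp M N P (F : functor M N) (G : functor N P)
  (s : strong_structure F) (t : strong_structure G) : strong_structure (fcomp G F).
Proof.
exists (fun x m => iso_comp (fmap_iso G (strong s x m)) (strong t x (F m))).
split=> [x x' m m' f g|x y m|m] /=.
- by rewrite -compA strong_nat !compA -!fmapM strong_nat.
- rewrite compA -fmapM strong_assoc !fmapM -!compA strong_assoc !compA.
  rewrite bmap_comp_idl !compA; congr (_ ∘ _ ∘ _).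
  by rewrite -!compA strong_nat.
- by rewrite compA -fmapM !strong_unit.
Defined.

Definition strong_nat_iso M N (F F' : functor M N) (n : nat_iso F F')
  (s : strong_structure F) : strong_structure F'.
Proof.
exists (fun x m => iso_comp (niso n (x ▷ m))
  (iso_comp (strong s x m) (fmap_iso (bif_left (act (modstr N)) x) (iso_sym (niso n m))))).
split=> [x x' m m' f g|x y m|m] /=.
- rewrite -!compA -bmapM comp1m nat_iso_bwd -[f in LHS]compm1 bmapM.
  by rewrite (compA (fwd (strong s _ _))) strong_nat !compA niso_natE.
- rewrite !compA -niso_natE (reA (strong_assoc _ _ _ _)) !compA.
  have e : (1_x ▷h bwd (niso n (y ▷ m))) ∘ (1_x ▷h (fwd (niso n (y ▷ m)) ∘
      fwd (strong s y m) ∘ (1_y ▷h bwd (niso n m)))) =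
      (1_x ▷h fwd (strong s y m)) ∘ (1_x ▷h (1_y ▷h bwd (niso n m))).
    by rewrite -!bmapM !compA bwdK !comp1m.
  rewrite (reA e) !compA -!(compA _ (fwd (aso _ _ _))) -(bmap1 tens) aassoc_nat.
  by rewrite !compA.
- rewrite !compA -niso_natE (reA (strong_unit _ _)) -!compA aunit_nat.
  by rewrite compA fwdK comp1m.
Defined.

(** The constraint of [G] is defined by its image under [F], read off from [F G ≅ id] and the
    constraint of [F]. Each axiom is then checked after the faithful functor [F]. *)
Definition strong_inverse M N (F : functor M N) (G : functor N M)
  (s : strong_structure F) (Ffaith : faithful F) (Ffull : full F)
  (n : nat_iso (fcomp F G) (fid N)) : strong_structure G.
Proof.
pose i x m : iso (F (x ▷ G m)) (F (G (x ▷ m))) :=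
  iso_comp (iso_sym (niso n (x ▷ m))) (iso_comp
    (fmap_iso (bif_left (act (modstr N)) x) (niso n m)) (iso_sym (strong s x (G m)))).
pose j x m : hom (x ▷ G m) (G (x ▷ m)) := fwd (preim_iso Ffaith Ffull (i x m)).
have jE x m : fmap F (j x m) =
    bwd (niso n (x ▷ m)) ∘ (1_x ▷h fwd (niso n m)) ∘ bwd (strong s x (G m)).
  by rewrite /j /= preimK compA.
suff jP : is_lax (F := G) j by exists (fun x m => preim_iso Ffaith Ffull (i x m)).
move: j jE => j jE {i}.
split=> [x x' m m' f g|x y m|m]; apply: Ffaith; rewrite !fmapM !jE.
- rewrite (reA (strong_bwd_nat s f (fmap G g))) !compA.
  have e : (1_x' ▷h fwd (niso n m')) ∘ (f ▷h fmap F (fmap G g)) =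
      (f ▷h g) ∘ (1_x ▷h fwd (niso n m)).
    by rewrite -!bmapM comp1m compm1; congr (_ ▷h _); apply: (niso_natE n).
  rewrite (reA e) !compA; congr (_ ∘ _ ∘ _).
  exact: (nat_iso_bwd n (f ▷h g)).
- have e1 : fwd (aso x y m) ∘ (1_(x ⊗ y) ▷h fwd (niso n m)) =
      (1_x ▷h (1_y ▷h fwd (niso n m))) ∘ fwd (aso x y (F (G m))).
    by rewrite -(bmap1 tens) aassoc_nat.
  have e2 : (1_x ▷h fwd (niso n (y ▷ m))) ∘ (1_x ▷h fmap F (j y m)) =
      (1_x ▷h (1_y ▷h fwd (niso n m))) ∘ (1_x ▷h bwd (strong s y (G m))).
    by rewrite -!bmapM jE !comp1m !compA fwdK comp1m.
  have /= e := nat_iso_bwd n (fwd (aso x y m)).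
  rewrite !compA -e (reA e1) !compA (reA (strong_bwd_assoc s x y (G m))) !compA.
  by rewrite (reA (strong_bwd_nat s (1_x) (j y m))) !compA (reA e2) !compA.
- have /= e := nat_iso_bwd n (fwd (uno m)).
  rewrite !compA -e (reA (aunit_nat (modstr N) (fwd (niso n m)))) !compA bwdK comp1m.
  by rewrite -(strong_unit s) -compA fwdK compm1.
Defined.

End StrongOperations.
Section ModuleEquivalence.
Context (k : fieldType) (C : monoidal_category k).
Implicit Types M N P : module_category C.

Lemma module_equivalent_sym M N : module_equivalent M N -> module_equivalent N M.
Proof.
move=> [F [[s] eF]]; have [G [n [n']]] := eF.
exists G; split; last by exists F; split; first exact: inhabits.
apply: inhabits; apply: strong_inverse s _ _ n'.
- exact: equivalence_faithful.
- exact: equivalence_full.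
Qed.

Lemma module_equivalent_trans M N P :
  module_equivalent M N -> module_equivalent N P -> module_equivalent M P.
Proof.
move=> [F [[s] eF]] [G [[t] eG]]; exists (fcomp G F); split.
- exact/inhabits/(strong_comp s t).
- exact: is_equivalence_comp.
Qed.

End ModuleEquivalence.

Section StrongExtension.
Context (k : fieldType) (C : monoidal_category k) (K M N : module_category C)
  (J : functor K M) (Φ : functor M N) (s : strong_structure J)
  (t : strong_structure (fcomp Φ J)).
Hypotheses (Jd : dense J) (Φex : right_exact Φ)
  (Mex : forall x, right_exact (bif_left (act (modstr M)) x))
  (Nex : forall x, right_exact (bif_left (act (modstr N)) x)).

(** On [J b] the constraint is forced: it is [t] corrected by the image under [Φ] of [s]. Since [Φ]
    and both actions are right exact, density extends it to all of [M]. *)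
Lemma strong_extend_ex (x : C) :
  exists n : nat_iso (fcomp (bif_left (act (modstr N)) x) Φ)
      (fcomp Φ (bif_left (act (modstr M)) x)),
    forall b, fmap Φ (fwd (strong s x b)) ∘ fwd (niso n (J b)) = fwd (strong t x b).
Proof.
pose u b : iso (x ▷ Φ (J b)) (Φ (x ▷ J b)) :=
  iso_comp (iso_sym (fmap_iso Φ (strong s x b))) (strong t x b).
have [|||n nE] := dense_ext Jd (R := fcomp (bif_left (act (modstr N)) x) Φ)
  (R' := fcomp Φ (bif_left (act (modstr M)) x)) (t := u).
- exact: right_exact_comp.
- exact: right_exact_comp.
- move=> b b' g; apply: (fwd_inj (i := fmap_iso Φ (strong s x b'))) => /=.
  rewrite !compA -!fmapM fwdK fmap1 comp1m strong_nat -compA fwdK compm1.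
  exact: (strong_nat t).
- by exists n => b; rewrite nE /= compA -fmapM fwdK fmap1 comp1m.
Qed.

Definition strong_extend_iso (x : C) :=
  proj1_sig (constructive_indefinite_description _ (strong_extend_ex x)).

Local Notation τ x m := (fwd (niso (strong_extend_iso x) m)).

Lemma strong_extend_incl (x : C) b :
  fmap Φ (fwd (strong s x b)) ∘ τ x (J b) = fwd (strong t x b).
Proof.
exact: (proj2_sig (constructive_indefinite_description _ (strong_extend_ex x))).
Qed.

Lemma strong_extend_natm (x : C) a b (f : hom a b) :
  τ x b ∘ (1_x ▷h fmap Φ f) = fmap Φ (1_x ▷h f) ∘ τ x a.
Proof. exact: (niso_natE (strong_extend_iso x)). Qed.

Lemma strong_extend_nat x x' a b (f : hom x x') (g : hom a b) :
  τ x' b ∘ (f ▷h fmap Φ g) = fmap Φ (f ▷h g) ∘ τ x a.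
Proof.
have natx c : τ x' c ∘ (f ▷h 1_(Φ c)) = fmap Φ (f ▷h 1_c) ∘ τ x c.
  apply: (dense_eq Jd (R := fcomp (bif_left (act (modstr N)) x) Φ)
    (R' := fcomp Φ (bif_left (act (modstr M)) x'))
    (t := fun c => τ x' c ∘ (f ▷h 1_(Φ c)))
    (t' := fun c => fmap Φ (f ▷h 1_c) ∘ τ x c)) => [|d e u|d e u|d].
  - exact: right_exact_comp.
  - rewrite /= -compA bmap_idr -(bmap_idl _ _ (fmap Φ u)) !compA.
    by rewrite strong_extend_natm.
  - rewrite /= -compA strong_extend_natm !compA -!fmapM -!bmapM.
    by rewrite !comp1m !compm1.
  - apply: (fwd_inj (i := fmap_iso Φ (strong s x' d))) => /=.
    rewrite !compA strong_extend_incl -fmapM -(fmap1 J) strong_nat fmapM -compA.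
    rewrite strong_extend_incl; have /= <- := strong_nat t f (1_d).
    by rewrite !fmap1.
rewrite -(bmap_idr _ f (fmap Φ g)) compA natx -compA strong_extend_natm compA.
by rewrite -fmapM bmap_idr.
Qed.

Definition strong_extend : strong_structure Φ.
Proof.
exists (fun x m => niso (strong_extend_iso x) m); split=> [x x' m m' f g|x y|].
- exact: strong_extend_nat.
- apply: (dense_eq Jd (R := fcomp (bif_left (act (modstr N)) (x ⊗ y)) Φ)
    (R' := fcomp Φ (fcomp (bif_left (act (modstr M)) x) (bif_left (act (modstr M)) y)))
    (t := fun m => fmap Φ (fwd (aso x y m)) ∘ τ (x ⊗ y) m)
    (t' := fun m => τ x (y ▷ m) ∘ (1_x ▷h τ y m) ∘ fwd (aso x y (Φ m))))
    => [|a b u|a b u|b].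
  + exact: right_exact_comp.
  + rewrite /= -compA strong_extend_natm !compA -!fmapM -(bmap1 tens).
    by rewrite aassoc_nat.
  + rewrite /= -compA -(bmap1 tens) aassoc_nat !compA.
    have e : (1_x ▷h τ y b) ∘ (1_x ▷h (1_y ▷h fmap Φ u)) =
        (1_x ▷h fmap Φ (1_y ▷h u)) ∘ (1_x ▷h τ y a).
      by rewrite -!bmapM !comp1m strong_extend_natm.
    by rewrite (reA e) !compA strong_extend_natm.
  + apply: (fwd_inj (i := fmap_iso Φ (iso_comp (strong s x (y ▷ b))
      (fmap_iso (bif_left (act (modstr M)) x) (strong s y b))))) => /=.
    rewrite compA -fmapM -strong_assoc fmapM -compA strong_extend_incl.
    have /= -> := strong_assoc t x y b.
    rewrite !compA fmapM (reA (esym (strong_extend_natm x (fwd (strong s y b))))).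
    rewrite !compA strong_extend_incl; congr (_ ∘ _).
    by rewrite -[RHS]compA -bmapM comp1m strong_extend_incl.
- apply: (dense_eq Jd (R := fcomp (bif_left (act (modstr N)) tunit) Φ) (R' := Φ)
    (t := fun m => fmap Φ (fwd (uno m)) ∘ τ tunit m)
    (t' := fun m => fwd (uno (Φ m)))) => [|a b u|a b u|b].
  + exact: right_exact_comp.
  + by rewrite /= -compA strong_extend_natm !compA -!fmapM aunit_nat.
  + by rewrite /= aunit_nat.
  + rewrite -(strong_unit s b) fmapM -compA strong_extend_incl.
    exact: (strong_unit t).
Defined.

End StrongExtension.

Definition fid_left k (A D : category k) (F : functor A D) :
  nat_iso F (fcomp (fid D) F).
Proof.
apply: (@NatIso k A D F (fcomp (fid D) F) (fun a => iso_refl (F a))).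
by move=> a b f; rewrite /= comp1m compm1.
Defined.

Lemma fid_equivalence k (A : category k) : is_equivalence (fid A).
Proof.
exists (fid A); split; apply: inhabits;
  exact: nat_iso_sym (fid_left (fid A)).
Qed.

Section ExtendedUnique.
Context (k : fieldType) (C : monoidal_category k) (B : module_category C)
  (T : lax_module_monad B).

(** The equivalence is the identity functor. Its restriction to the Kleisli category is the
    inclusion, which is strong for both structures, and this strong structure extends. *)
Lemma extended_unique (E E' : module_structure C (modules T)) :
  extended_from_kleisli E -> extended_from_kleisli E' ->
  module_equivalent (ModuleCategory E) (ModuleCategory E').
Proof.
move=> [[Eex _] [s]] [[Eex' _] [s']].
pose Φ : functor (ModuleCategory E) (ModuleCategory E') := fid (modules T).
have t : strong_structure (fcomp Φ (kleisli_incl T)).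
  exact: (@strong_nat_iso k C (kleisli T) (ModuleCategory E') (kleisli_incl T) _
    (fid_left (kleisli_incl T)) s').
exists Φ; split; last exact: fid_equivalence.
have Φex : right_exact Φ by [].
exact: inhabits (strong_extend s t (kleisli_incl_dense T) Φex Eex Eex').
Qed.

End ExtendedUnique.

(** * The comparison functor *)

Section Comparison.
Context (k : fieldType) (C : monoidal_category k) (B M : module_category C)
  (F : functor B M) (G : functor M B) (s : strong_structure F)
  (adj : adjunction F G).
Local Notation η := (adj_unit adj).
Local Notation ε := (adj_counit adj).
Local Notation T := (adj_monad s adj).
Local Notation φ x m := (fwd (strong s x m)).

Definition comparison_ob (m : M) : modules T.
Proof.
exists (G m) (fmap G (ε m)).
- exact: unit_counit.
- by rewrite /= -!fmapM (counit_natE adj).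
Defined.

Lemma comparison_map_proof (m n : M) (f : hom m n) :
  fmap G f ∘ tm_act (comparison_ob m) = tm_act (comparison_ob n) ∘ fmap T (fmap G f).
Proof. by rewrite /= -!fmapM (counit_natE adj). Qed.

Definition comparison : functor M (modules T).
Proof.
exists comparison_ob (fun m n f =>
  @tm_mk k C B T (comparison_ob m) (comparison_ob n) _ (comparison_map_proof f)).
- by move=> m n l f g; apply: tm_hom_inj; rewrite /= fmap_lin.
- by move=> m; apply: tm_hom_inj; rewrite /= fmap1.
- by move=> m n p g f; apply: tm_hom_inj; rewrite /= fmapM.
Defined.

Lemma tm_hom_bwd (a b : modules T) (i : iso (tm_ob a) (tm_ob b)) :
  fwd i ∘ tm_act a = tm_act b ∘ fmap T (fwd i) ->
  bwd i ∘ tm_act b = tm_act a ∘ fmap T (bwd i).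
Proof.
move=> e; apply/esym/iso_eql; rewrite compA e -compA -fmapM fwdK fmap1.
exact: compm1.
Qed.

Definition modules_iso (a b : modules T) (i : iso (tm_ob a) (tm_ob b))
  (e : fwd i ∘ tm_act a = tm_act b ∘ fmap T (fwd i)) : iso a b.
Proof.
exists (tm_mk e) (tm_mk (tm_hom_bwd e)); apply: tm_hom_inj.
- exact: bwdK.
- exact: fwdK.
Defined.

Hypotheses (Mab : abelian M) (Gex : right_exact G) (εepi : forall m, is_epi (ε m)).

(** The epimorphism [ε m] is the cokernel of its kernel [i], so it suffices that [h ∘ i = 0]. This
    is tested after the epimorphism [ε c], where naturality and the hypothesis turn it into
    [h ∘ F G (ε m ∘ i) = 0]. *)
Lemma counit_cokernel (m n : M) (h : hom (F (G m)) n) :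
  h ∘ ε (F (G m)) = h ∘ fmap F (fmap G (ε m)) -> exists h', h' ∘ ε m = h.
Proof.
move=> e; have [c [i ki]] := ab_kernel Mab (ε m).
apply: (is_cokernel_factor (epi_is_cokernel Mab (@εepi m) ki)).
apply: (εepi (m := c)).
rewrite comp0m -compA -(counit_natE adj i) compA e -compA -!fmapM (is_kernel0 ki).
by rewrite !fmap0 compm0.
Qed.

Lemma comparison_faithful : faithful comparison.
Proof.
move=> m n f g /(congr1 (fun u => fmap (forget T) u)) /= e.
by apply: (εepi (m := m)); rewrite -!(counit_natE adj) e.
Qed.

Lemma comparison_full : full comparison.
Proof.
move=> m n g; have /= eg := tm_homP g.
have [h hE] : exists h, h ∘ ε m = ε n ∘ fmap F (fmap (forget T) g).
  apply: counit_cokernel => /=.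
  rewrite -[RHS]compA -fmapM eg fmapM [RHS]compA (counit_natE adj (ε n)) -[RHS]compA.
  by rewrite (counit_natE adj (fmap F (lin_val g))) compA.
exists h; apply: (@tm_hom_inj _ _ _ T (comparison m) (comparison n)); apply: (adj_injr (adj := adj)).
by rewrite /= (counit_natE adj h) hE.
Qed.

Lemma tm_act_cokernel (a : modules T) :
  is_cokernel (fmap T (tm_act a) - mu T a) (tm_act a).
Proof.
apply: is_cokernelI.
- by rewrite compmB tm_assoc subrr.
- exact: split_epi (tm_unit a).
move=> d h /eqP; rewrite compmB subr_eq0 => /eqP e.
exists (h ∘ eta T a); rewrite -compA eta_natE compA e -compA.
by rewrite mu_etal compm1.
Qed.

(** The preimage [m] of a module is the coequaliser in [M] of [F(tm_act a)] and [ε] at [F a]. As [G]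
    is right exact, [G m] is the cokernel of [T(tm_act a) - mu], which is [a]. *)
Lemma comparison_ess_surj : ess_surj comparison.
Proof.
move=> a; have [m [q kq]] := ab_cokernel Mab (fmap F (tm_act a) - ε (F (tm_ob a))).
have kGq := Gex kq; rewrite fmapB in kGq.
have [l lE] := cokernel_unique (tm_act_cokernel a) kGq.
exists m; apply: inhabits; apply: iso_sym; apply: (@modules_iso a (comparison m) l).
(* Linearity of [l] over [T] is tested after the split epimorphism [T(tm_act a)], where
   [l ∘ tm_act a = G q] reduces it to naturality of the counit. *)
apply: (split_epi (e := fmap T (tm_act a)) (s := fmap T (eta T a))).
  by rewrite -fmapM tm_unit fmap1.
rewrite -compA -tm_assoc compA lE -[in RHS]compA -fmapM lE /=.
by rewrite -!fmapM (counit_natE adj q).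
Qed.

Lemma comparison_equivalence : is_equivalence comparison.
Proof.
exact: ff_es_equivalence comparison_faithful comparison_full comparison_ess_surj.
Qed.

Definition kleisli_to : functor (kleisli T) M.
Proof.
refine (@Functor k (kleisli T) M F
  (fun a b (f : hom (a : B) (G (F b))) => ε (F b) ∘ fmap F f) _ _ _).
- move=> a b l f g; have /= e := @fmap_lin k B M F a (G (F b)) l f g.
  by rewrite [X in comp _ X]e comp_linr.
- exact: (counit_unit adj).
- move=> a b c g f.
  rewrite [X in fmap F X]kleisli_compE !fmapM !compA (counit_natE adj (ε (F c))).
  by rewrite -!compA (compA (ε (F (G (F c))))) (counit_natE adj (fmap F g)) !compA.
Defined.

(** The constraint is that of [F]. Its naturality along Kleisli morphisms is [adj_lax_trans]: the
    lax structure of the monad was defined as the mate of this constraint. *)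
Definition kleisli_to_strong : strong_structure kleisli_to.
Proof.
apply: (@StrongStructure k C (kleisli T) M kleisli_to (fun x b => strong s x b)).
split=> [x x' a b f g|x y b|b].
- rewrite /= fmapM compA (adj_lax_trans s adj).
  rewrite (reA (strong_bwd_nat s f (g : hom (a : B) (G (F b))))).
  rewrite !compA (reA (bwdK (strong s x a))) compm1 -[RHS]compA -bmapM.
  by rewrite comp1m.
- by rewrite /= /kl fmapM compA counit_unit comp1m strong_assoc.
- by rewrite /= /kl fmapM compA counit_unit comp1m strong_unit.
Defined.

Lemma comparison_free_hom (b : B) :
  1_(G (F b)) ∘ tm_act (comparison (F b)) = tm_act (free T b) ∘ fmap T (1_(G (F b))).
Proof. by rewrite fmap1 compm1 comp1m. Qed.

(** The two modules have the same object and action and differ only in the proofs of the module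
    laws, so the identity is an isomorphism between them. *)
Definition comparison_free (b : B) : iso (comparison (F b)) (free T b) :=
  @modules_iso (comparison (F b)) (free T b) (iso_refl (G (F b))) (comparison_free_hom b).

Definition comparison_kleisli : nat_iso (fcomp comparison kleisli_to) (kleisli_incl T).
Proof.
apply: (@NatIso k (kleisli T) (modules T) (fcomp comparison kleisli_to)
  (kleisli_incl T) comparison_free).
move=> a b f; apply: (@tm_hom_inj _ _ _ T (comparison (F a)) (free T b)).
change (1_(G (F b)) ∘ fmap G (ε (F b) ∘ fmap F (f : hom (a : B) (G (F b)))) =
  fmap G (ε (F b)) ∘ fmap G (fmap F (f : hom (a : B) (G (F b)))) ∘ 1_(G (F a))).
by rewrite compm1 comp1m fmapM.
Qed.

Lemma comparison_module_equivalent (E : module_structure C (modules T)) :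
  right_exact2 (act (modstr M)) -> extended_from_kleisli E ->
  module_equivalent M (ModuleCategory E).
Proof.
move=> [Mex _] [[Eex _] [t]]; apply: module_equivalent_sym.
(* Density controls functors out of the modules, so the quasi-inverse is the one to be made
   strong. *)
have [Φ' [[n] [n']]] := comparison_equivalence.
pose Φ : functor (ModuleCategory E) M := Φ'.
have Φeq : is_equivalence Φ by exists comparison; split; apply: inhabits.
have u : strong_structure (fcomp Φ (kleisli_incl T)).
  apply: strong_nat_iso kleisli_to_strong.
  exact: nat_iso_unwhisker comparison_kleisli n.
exists Φ; split=> //; apply: inhabits.
exact: (strong_extend t u (kleisli_incl_dense T) (equivalence_right_exact Φeq) Eex Mex).
Qed.

End Comparison.

Lemma equivalence_epi k (C D : category k) (F : functor C D) (a b : C) (e : hom a b) :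
  abelian C -> is_equivalence F -> is_epi e -> is_epi (fmap F e).
Proof. by move=> Cab eF; apply/right_exact_epi/equivalence_right_exact. Qed.

Lemma equivalence_sym k (C D : category k) (F : functor C D) (G : functor D C) :
  inhabited (nat_iso (fcomp G F) (fid C)) -> inhabited (nat_iso (fcomp F G) (fid D)) ->
  is_equivalence G.
Proof. by move=> n n'; exists F. Qed.

Lemma equivalence_projective k (C D : category k) (F : functor C D) (p : C) :
  abelian D -> is_equivalence F -> projective p -> projective (F p).
Proof.
move=> Dab eF.
pose f := equivalence_faithful eF; pose g := equivalence_full eF.
pose h := equivalence_ess_surj eF.
apply: (projective_ladj (quasi_inverse_adj f g h)) => a b e.
apply: equivalence_epi => //; apply: equivalence_sym (inhabits _) (inhabits _).
- exact: quasi_inverse_unit.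
- exact: quasi_inverse_counit.
Qed.

Lemma summand_split_epi k (C : category k) (a s : C) :
  direct_summand a s -> exists p : hom s a, is_epi p.
Proof. by move=> [b [i [j [p [q [pi _ _ _ _]]]]]]; exists p; apply: split_epi pi. Qed.

Lemma projective_summand k (C : category k) (a p : C) (e : hom a p) :
  abelian C -> projective p -> is_epi e -> direct_summand p a.
Proof.
by move=> Cab pp ee; have [s es] := pp _ _ _ (1_p) ee; apply: split_epi_summand es.
Qed.

(** * Conditions (a)-(c) and the bijection for monads *)

Section ProjectiveConditions.
Context (k : fieldType) (C : monoidal_category k).

(** Meant for the unit object, where acting on it is isomorphic to the identity functor; the general
    form serves both the regular module category and its opposite. *)
Lemma proj_conditions_equivalence (M : module_category C) (l : M) :
  abelian C -> abelian M -> enough_projectives M -> right_exact2 (act (modstr M)) ->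
  is_equivalence (act_on l) -> proj_conditions l.
Proof.
move=> Cab Mab Mp Mex eF; split=> //.
- exists (quasi_inverse (equivalence_faithful eF) (equivalence_full eF)
    (equivalence_ess_surj eF)).
  exact: inhabits (quasi_inverse_adj _ _ _).
- by move=> x px; apply: (@equivalence_projective _ _ _ (act_on l)).
- move=> p pp; have [G [n [n']]] := eF; exists (G p); split.
    by apply: (equivalence_projective Cab (equivalence_sym n (inhabits n'))).
  exact: (projective_summand Mab pp (@iso_epi _ _ _ _ (niso n' p))).
Qed.

Lemma proj_conditions_regular :
  abelian C -> enough_projectives C -> right_exact2 (tens (m := C)) ->
  proj_conditions (M := regular C) tunit.
Proof.
move=> Cab Cp Cex; apply: proj_conditions_equivalence => //.
exists (fid C); split; apply: inhabits.
- apply: (@NatIso k C C (fcomp (fid C) (act_on (M := regular C) tunit)) (fid C)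
    (fun x => runit x)); exact: runit_nat.
- apply: (@NatIso k C C (fcomp (act_on (M := regular C) tunit) (fid C)) (fid C)
    (fun x => runit x)); exact: runit_nat.
Qed.

(** Transposing a projective cover of [G a] covers [a] by some [F p]. For (c), a projective [p] of
    [N] is thus a quotient of [F q], and [q] is a summand of some [x ▷ l]; so [x ▷ F l ≅ F (x ▷ l)]
    maps onto [p], and projectivity splits the map. It is applied to the free module functor and, in
    the dual half, to an equivalence. *)
Lemma proj_conditions_ladj (B N : module_category C) (F : functor B N)
    (G : functor N B) (s : strong_structure F) (adj : adjunction F G) (l : B) :
  (forall a b (e : hom a b), is_epi e -> is_epi (fmap G e)) ->
  (forall n, is_epi (adj_counit adj n)) ->
  abelian N -> right_exact2 (act (modstr N)) ->
  proj_conditions l -> proj_conditions (F l).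
Proof.
move=> Gepi εepi Nab Nex [Bab Bp Bex [H [adjH]] presl genl].
have Fproj p : projective p -> projective (F p) by apply: projective_ladj adj p Gepi.
have cover (a : N) : exists (p : B) (e : hom (F p) a), projective p /\ is_epi e.
  have [p [e [pp ee]]] := Bp (G a).
  exists p, (adj_counit adj a ∘ fmap F e); split=> //; apply: epi_comp => //.
  exact: right_exact_epi Bab (ladj_right_exact adj) ee.
split=> //.
- by move=> a; have [p [e [pp ee]]] := cover a; exists (F p), e; split=> //; apply: Fproj.
- exists (fcomp H G); apply: inhabits.
  apply: adjunction_iso (adjunction_comp adjH adj); apply: nat_iso_sym.
  apply: (@NatIso k (regular C) N (act_on (F l)) (fcomp F (act_on l))
    (fun x => strong s x l)).
  move=> x y f /=; rewrite -(strong_nat s f (1_l)).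
  by rewrite fmap1.
- move=> x px; apply: (projective_iso (iso_sym (strong s x l))).
  exact/Fproj/presl.
- move=> p pp; have [q [e [pq ee]]] := cover p.
  have [x [px /summand_split_epi [r er]]] := genl q pq.
  exists x; split=> //; apply: (projective_summand (e := e ∘ (fmap F r ∘ fwd (strong s x l)))) => //.
  apply: epi_comp => //; apply: epi_comp; last exact: iso_epi.
  exact: right_exact_epi Bab (ladj_right_exact adj) er.
Qed.

(** Every map from [x ▷ l] to [m] factors through the counit at [m], by transposition; an epimorphic
    one exists by (c) and enough projectives. *)
Lemma counit_epi (M : module_category C) (l : M) (G : functor M (regular C))
    (adj : adjunction (act_on l) G) :
  proj_conditions l -> forall m, is_epi (adj_counit adj m).
Proof.
move=> [_ Mp _ _ _ gen] m; have [p [e [pp ee]]] := Mp m.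
have [x [_ /summand_split_epi [r er]]] := gen p pp.
have /= eE := adj_transr adj (e ∘ r : hom (act_on l x) m).
apply: (epi_comp_left (f := fmap (act_on l) (fmap G (e ∘ r) ∘ adj_unit adj x))).
by rewrite [X in is_epi X]eE; apply: epi_comp.
Qed.

(** Restriction of [s] along the functor [kl] from [B] to the Kleisli category, whose composite with
    the inclusion is [free]. *)
Definition free_strong (B : module_category C) (T : lax_module_monad B)
    (E : module_structure C (modules T))
    (s : @strong_structure k C (kleisli T) (ModuleCategory E) (kleisli_incl T)) :
  @strong_structure k C B (ModuleCategory E) (free T).
Proof.
apply: (@StrongStructure k C B (ModuleCategory E) (free T) (fun x b => strong s x b)).
split=> [x x' a b f g|x y b|b].
- rewrite -kleisli_incl_kl (strong_nat s f) [f ▷h _](kl_act T).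
  by rewrite kleisli_incl_kl.
- rewrite -kleisli_incl_kl; exact: (strong_assoc s x y b).
- rewrite -kleisli_incl_kl; exact: (strong_unit s b).
Qed.

Lemma proj_conditions_modules (B : module_category C) (T : lax_module_monad B)
    (E : module_structure C (modules T)) (l : B) :
  right_exact T -> extended_from_kleisli E -> proj_conditions l ->
  proj_conditions (M := ModuleCategory E) (free_module T l).
Proof.
move=> Tex [Eex [s]] pl; have Bab := pc_abelian pl.
apply: (@proj_conditions_ladj B (ModuleCategory E) (free T) (forget T)
  (free_strong s) (free_adj T)) => //.
- by move=> a b e; apply: forget_epi.
- move=> a; exact: is_cokernel_epi (tm_aug_cokernel a).
- exact: modules_abelian.
Qed.

End ProjectiveConditions.

Section Reconstruction.
Context (k : fieldType) (C : monoidal_category k).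
Hypotheses (Cab : abelian C) (Cp : enough_projectives C).

Lemma adj_monad_right_exact (M : module_category C) (l : M)
    (G : functor M (regular C)) (adj : adjunction (act_on l) G) :
  proj_conditions l -> right_exact (adj_monad (act_on_strong l) adj).
Proof.
move=> pl; apply: (right_exact_comp (F := act_on l)); last exact: (pc_exact pl).2.
apply: (radj_right_exact adj) => //; first exact: pc_abelian pl.
exact: pc_preserve pl.
Qed.

Lemma module_category_reconstruction (M : module_category C) (l : M)
    (G : functor M (regular C)) (adj : adjunction (act_on l) G)
    (E : module_structure C (modules (adj_monad (act_on_strong l) adj))) :
  proj_conditions l -> extended_from_kleisli E ->
  module_equivalent M (ModuleCategory E).
Proof.
move=> pl; apply: comparison_module_equivalent.
- exact: pc_abelian pl.
- apply: (radj_right_exact adj) => //; first exact: pc_abelian pl.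
  exact: pc_preserve pl.
- exact: counit_epi.
- exact: pc_exact pl.
Qed.

End Reconstruction.

(* D y z says that z is the category of (co)modules of y with an extended
   structure, which is unique up to equivalence only. *)
Lemma mutually_inverse_mod_of k (C : monoidal_category k) (X Y : Type)
    (mc : X -> module_category C) (D : Y -> module_category C -> Prop)
    (RX : X -> X -> Prop) (RY : Y -> Y -> Prop) (f : X -> Y -> Prop)
    (g : Y -> X -> Prop) :
  (forall x x', RX x x' <-> module_equivalent (mc x) (mc x')) ->
  (forall y y', RY y y' <->
     exists z z', D y z /\ D y' z' /\ module_equivalent z z') ->
  (forall x, exists y, f x y) -> (forall y, exists x, g y x) ->
  (forall y, exists z, D y z) ->
  (forall y z z', D y z -> D y z' -> module_equivalent z z') ->
  (forall y x, g y x -> D y (mc x)) ->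
  (forall x y z, f x y -> D y z -> module_equivalent (mc x) z) ->
  mutually_inverse_mod RX RY f g.
Proof.
move=> rx ry ft gt Dt Du gD fD; split=> //.
- move=> x x' y y' /rx xx' fxy fxy'; apply/ry.
  have [z yz] := Dt y; have [z' yz'] := Dt y'; exists z, z'; split=> //; split=> //.
  apply: module_equivalent_trans (fD _ _ _ fxy' yz').
  exact: module_equivalent_trans (module_equivalent_sym (fD _ _ _ fxy yz)) xx'.
- move=> y y' x x' /ry [z [z' [yz [yz' zz']]]] /gD yx /gD yx'; apply/rx.
  apply: module_equivalent_trans (Du _ _ _ yz' yx').
  exact: module_equivalent_trans (Du _ _ _ yx yz) zz'.
- by move=> x y x' fxy /gD yx'; apply/rx/(fD _ _ _ fxy).
- move=> y x y' /gD yx fxy'; apply/ry; have [z' yz'] := Dt y'.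
  by exists (mc x), z'; split=> //; split=> //; apply: fD yz'.
Qed.

Lemma projective_bijection k (C : monoidal_category k) :
  abelian C -> enough_projectives C -> right_exact2 (tens (m := C)) ->
  mutually_inverse_mod (@pp_equiv k C) (@rem_equiv k C)
    (@pair_to_monad k C) (@monad_to_pair k C).
Proof.
move=> Cab Cp Cex.
pose D (T : right_exact_monad C) (z : module_category C) :=
  exists2 E : module_structure C (modules T), extended_from_kleisli E & z = ModuleCategory E.
have ext (T : right_exact_monad C) := @extended_from_kleisli_exists k C (regular C) T
  Cab Cex (@rem_exact _ _ T).
apply: (@mutually_inverse_mod_of k C _ _ (@pp_cat k C) D) => //.
- move=> T U; split=> [[E [E' [e [e' m]]]]|[_ [_ [[E e ->] [[E' e' ->] m]]]]].
    by exists (ModuleCategory E), (ModuleCategory E'); split; [exists E|split; [exists E'|]].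
  by exists E, E'.
- move=> [M l pl]; have [G [adj]] := pc_adjoint pl.
  by exists (RightExactMonad (adj_monad_right_exact Cab Cp adj pl)), G, adj.
- move=> T; have [E e] := ext T.
  have c := proj_conditions_modules (rem_exact T) e (proj_conditions_regular Cab Cp Cex).
  by exists (ProjPair c), E, e, c.
- by move=> T; have [E e] := ext T; exists (ModuleCategory E), E.
- by move=> T _ _ [E e ->] [E' e' ->]; apply: extended_unique.
- by move=> T _ [E [e [c ->]]]; exists E.
- move=> [M l pl] [T Tex] _ [G [adj /= eT]] [E e ->]; rewrite /= in E e *.
  (* [pair_to_monad] specifies the monad by an equation, so everything that depends on [T] must be
     generalised before substituting. *)
  by move: E e Tex; rewrite eT => E e Tex; apply: module_category_reconstruction.
Qed.

(** * Opposite categories *)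

Section Opposite.
Context (k : fieldType).

Definition op (C : category k) : category k.
Proof.
exists (ob C) (fun a b => @hom k C b a) (fun a => 1_a) (fun a b c g f => f ∘ g).
- by move=> *; rewrite compA.
- by move=> *; apply: compm1.
- by move=> *; apply: comp1m.
- by move=> a b c f; apply: comp_linr.
- by move=> a b c g; apply: comp_linl.
Defined.

Definition fop (C D : category k) (F : functor C D) : functor (op C) (op D).
Proof.
apply: (@Functor k (op C) (op D) F (fun a b (f : @hom k C b a) => fmap F f)).
- by move=> a b; exact: (@fmap_lin k C D F b a).
- by move=> a; exact: (fmap1 F).
- by move=> a b c g f; exact: (@fmapM k C D F c b a f g).
Defined.

(** [op (op C)] is not convertible to [C], so applying [fop] again would not return a functor
    between the original categories. The other constructions read back from opposites have the same
    form. *)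
Definition funop (C D : category k) (F : functor (op C) (op D)) : functor C D.
Proof.
apply: (@Functor k C D F (fun a b (f : @hom k (op C) b a) => fmap F f)).
- by move=> a b; exact: (@fmap_lin k (op C) (op D) F b a).
- by move=> a; exact: (fmap1 F).
- by move=> a b c g f; exact: (@fmapM k (op C) (op D) F c b a f g).
Defined.

Definition bifop (A B C : category k) (H : bifunctor A B C) :
  bifunctor (op A) (op B) (op C).
Proof.
apply: (@Bifunctor k (op A) (op B) (op C) H
  (fun a a' b b' (f : @hom k A a' a) (g : @hom k B b' b) => bmap H f g)).
- by move=> a a' b b' g; exact: (@bmap_linl _ _ _ _ H a' a b' b g).
- by move=> a a' b b' f; exact: (@bmap_linr _ _ _ _ H a' a b' b f).
- by move=> a b; exact: (bmap1 H).
- by move=> a a' a'' b b' b'' f' f g' g; exact: (@bmapM _ _ _ _ H a'' a' a b'' b' b f f' g g').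
Defined.

Definition bifunop (A B C : category k) (H : bifunctor (op A) (op B) (op C)) :
  bifunctor A B C.
Proof.
apply: (@Bifunctor k A B C H
  (fun a a' b b' (f : @hom k (op A) a' a) (g : @hom k (op B) b' b) => bmap H f g)).
- by move=> a a' b b' g; exact: (@bmap_linl _ _ _ _ H a' a b' b g).
- by move=> a a' b b' f; exact: (@bmap_linr _ _ _ _ H a' a b' b f).
- by move=> a b; exact: (bmap1 H).
- by move=> a a' a'' b b' b'' f' f g' g; exact: (@bmapM _ _ _ _ H a'' a' a b'' b' b f f' g g').
Defined.

Definition iso_op (C : category k) (a b : C) (i : iso a b) : @iso k (op C) a b :=
  @Iso k (op C) a b (bwd i) (fwd i) (bwdK i) (fwdK i).

Definition iso_unop (C : category k) (a b : C) (i : @iso k (op C) a b) : @iso k C a b :=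
  @Iso k C a b (bwd i) (fwd i) (bwdK i) (fwdK i).

Lemma abelian_op (C : category k) : abelian C <-> abelian (op C).
Proof.
have bip (D : category k) (a b s : D) (i : hom a s) (j : hom b s) p q :
    is_biproduct i j p q -> @is_biproduct k (op D) a b s p q i j.
  by case=> *; split.
have bip' (D : category k) (a b s : D) (i : hom a s) (j : hom b s) p q :
    @is_biproduct k (op D) a b s p q i j -> is_biproduct i j p q.
  by case=> *; split.
split=> [] [z s ker cok mono epi]; split.
- by have [o [o1 o2]] := z; exists o; split.
- move=> a b; have [c [i [j [p [q h]]]]] := s a b.
  by exists c, p, q, i, j; apply: bip.
- by move=> b c g; have [a [f h]] := cok c b g; exists a, f.
- by move=> a b f; have [c [g h]] := ker b a f; exists c, g.
- by move=> a b f mf; have [c [g h]] := epi b a f mf; exists c, g.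
- by move=> a b f mf; have [c [g h]] := mono b a f mf; exists c, g.
- by have [o [o1 o2]] := z; exists o; split.
- move=> a b; have [c [i [j [p [q h]]]]] := s a b.
  by exists c, p, q, i, j; apply: bip'.
- by move=> b c g; have [a [f h]] := cok c b g; exists a, f.
- by move=> a b f; have [c [g h]] := ker b a f; exists c, g.
- by move=> a b f mf; have [c [g h]] := epi b a f mf; exists c, g.
- by move=> a b f mf; have [c [g h]] := mono b a f mf; exists c, g.
Qed.

Lemma projective_op (C : category k) (q : C) :
  injective_ob q <-> projective (q : op C).
Proof. by split=> h a b e f; apply: h. Qed.

Lemma enough_projectives_op (C : category k) :
  enough_injectives C <-> enough_projectives (op C).
Proof.
by split=> h a; have [q [i [iq mi]]] := h a; exists q, i; split=> //; apply/projective_op.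
Qed.

Lemma direct_summand_op (C : category k) (a s : C) :
  direct_summand a s <-> @direct_summand k (op C) a s.
Proof.
by split=> -[b [i [j [p [q [? ? ? ? ?]]]]]]; exists b, p, q, i, j; split.
Qed.

Lemma right_exact2_op (A B C : category k) (H : bifunctor A B C) :
  left_exact2 H <-> right_exact2 (bifop H).
Proof.
split=> [] [h1 h2]; split=> x a b c f g.
- exact: (h1 x c b a g f).
- exact: (h2 x c b a g f).
- exact: (h1 x c b a g f).
- exact: (h2 x c b a g f).
Qed.

Lemma left_exact2_unop (A B C : category k) (H : bifunctor (op A) (op B) (op C)) :
  right_exact2 H -> left_exact2 (bifunop H).
Proof.
by move=> [h1 h2]; split=> x a b c f g; [apply: (h1 x c b a g f)|apply: (h2 x c b a g f)].
Qed.

Definition adjunction_op (C D : category k) (F : functor C D) (G : functor D C)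
  (adj : adjunction F G) : adjunction (fop G) (fop F).
Proof.
exists (adj_counit adj) (adj_unit adj).
- by move=> a b f; apply/esym/(counit_nat adj).
- by move=> a b f; apply/esym/(unit_nat adj).
- exact: (unit_counit adj).
- exact: (counit_unit adj).
Defined.

End Opposite.

Section BackwardCoherence.
Context (k : fieldType) (C : monoidal_category k) (M : category k)
  (E : module_structure C M).
Local Notation "f *h g" := (bmap (act E) f g) (at level 35, right associativity).

Lemma aassoc_bwd_nat x x' y y' m m' (f : hom x x') (g : hom y y') (h : hom m m') :
  bwd (aassoc E x' y' m') ∘ (f *h (g *h h)) = ((f ⊗h g) *h h) ∘ bwd (aassoc E x y m).
Proof. by apply/esym/iso_eql; rewrite compA; apply/esym/iso_eqr; rewrite aassoc_nat. Qed.

Lemma aunit_bwd_nat m m' (f : hom m m') :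
  bwd (aunit E m') ∘ f = (1_tunit *h f) ∘ bwd (aunit E m).
Proof. by apply/esym/iso_eql; rewrite compA; apply/esym/iso_eqr; rewrite aunit_nat. Qed.

(** Passing to the opposite category exchanges the two directions of an isomorphism, so the
    coherence axioms of the opposite structure are the inverted ones. *)
Lemma apentagon_bwd x y z m :
  bwd (aassoc E (x ⊗ y) z m) ∘ bwd (aassoc E x y (act E z m)) =
  (bwd (tassoc x y z) *h 1_m) ∘
    (bwd (aassoc E x (y ⊗ z) m) ∘ (1_x *h bwd (aassoc E y z m))).
Proof.
pose i := iso_comp (aassoc E x y (act E z m)) (aassoc E (x ⊗ y) z m).
apply: (fwd_surj (i := i)); rewrite (bwdK i) /= apentagon !compA.
have e : (1_x *h bwd (aassoc E y z m)) ∘ (1_x *h fwd (aassoc E y z m)) = 1_(act E x _).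
  by rewrite -bmapM bwdK comp1m bmap1.
rewrite (reA e) compm1 (reA (bwdK _)) compm1 -bmapM bwdK comp1m.
exact: esym (bmap1 _ _ _).
Qed.

Lemma atriangle_bwd x m :
  bwd (aassoc E x tunit m) ∘ (1_x *h bwd (aunit E m)) = bwd (runit x) *h 1_m.
Proof.
apply/esym/iso_eql.
have e : (1_x *h bwd (aunit E m)) ∘ (1_x *h fwd (aunit E m)) = 1_(act E x (act E tunit m)).
  by rewrite -bmapM bwdK comp1m bmap1.
rewrite -[LHS]comp1m -e -!compA (compA (_ *h fwd _)) atriangle -bmapM.
by rewrite fwdK comp1m bmap1 compm1.
Qed.

End BackwardCoherence.

Section BackwardStrong.
Context (k : fieldType) (C : monoidal_category k) (M N : module_category C)
  (F : functor M N) (s : strong_structure F).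
Local Notation ψ x m := (bwd (strong s x m)).

Lemma strong_bwd_assoc' x y m :
  ψ (x ⊗ y) m ∘ fmap F (bwd (aso x y m)) =
  bwd (aso x y (F m)) ∘ ((1_x ▷h ψ y m) ∘ ψ x (y ▷ m)).
Proof.
apply/iso_eql; rewrite compA strong_bwd_assoc -compA -fmapM fwdK fmap1.
exact: compm1.
Qed.

Lemma strong_bwd_unit m : ψ tunit m ∘ fmap F (bwd (uno m)) = bwd (uno (F m)).
Proof.
rewrite -[RHS]compm1 -fmap1 -(fwdK (uno m)) fmapM compA; congr (_ ∘ _).
by apply/iso_eql; rewrite -(strong_unit s) -compA fwdK compm1.
Qed.

End BackwardStrong.

Definition mop k (C : monoidal_category k) : monoidal_category k.
Proof.
apply: (@MonoidalCategory k (op C) (bifop tens) (tunit (m := C))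
  (fun x y z => iso_op (tassoc x y z)) (fun x => iso_op (lunit x))
  (fun x => iso_op (runit x))).
(* Coherence of the tensor product is that of the regular module category, so the inverted axioms
   for modules apply; only naturality of the right unitor lies outside a module structure. *)
- by move=> x x' y y' z z' f g h; apply/esym/(aassoc_bwd_nat (modstr (regular C))).
- by move=> x x' f; apply/esym/(aunit_bwd_nat (modstr (regular C))).
- move=> x x' f /=; apply/iso_eql; rewrite compA; apply/esym/iso_eqr.
  exact: esym (@runit_nat k C x' x f).
- by move=> x y z t; apply: (apentagon_bwd (modstr (regular C))).
- by move=> x y; apply: (atriangle_bwd (modstr (regular C))).
Defined.

Section OppositeModules.
Context (k : fieldType) (C : monoidal_category k).

Definition strop (M : category k) (E : module_structure C M) :
  module_structure (mop C) (op M).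
Proof.
apply: (@ModuleStructure k (mop C) (op M) (bifop (act E))
  (fun x y m => iso_op (aassoc E x y m)) (fun m => iso_op (aunit E m))).
- by move=> x x' y y' z z' f g h; apply/esym/aassoc_bwd_nat.
- by move=> x x' f; apply/esym/aunit_bwd_nat.
- by move=> x y z t; apply: apentagon_bwd.
- by move=> x y; apply: atriangle_bwd.
Defined.

Definition strunop (M : category k) (E : module_structure (mop C) (op M)) :
  module_structure C M.
Proof.
apply: (@ModuleStructure k C M (bifunop (act E))
  (fun x y m => iso_unop (aassoc E x y m)) (fun m => iso_unop (aunit E m))).
- by move=> x x' y y' z z' f g h; apply/esym/(aassoc_bwd_nat E).
- by move=> x x' f; apply/esym/(aunit_bwd_nat E).
- by move=> x y z t; apply: (apentagon_bwd E).
- by move=> x y; apply: (atriangle_bwd E).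
Defined.

Definition modop (M : module_category C) : module_category (mop C) :=
  ModuleCategory (strop (modstr M)).

Lemma proj_conditions_op (M : module_category C) (l : M) :
  inj_conditions l <-> proj_conditions (M := modop M) l.
Proof.
split=> [] [ab en ex [G [adj]] pres gen]; split.
- exact: (abelian_op M).1 ab.
- exact: (enough_projectives_op M).1 en.
- exact: (right_exact2_op _).1 ex.
- exists (fop G); apply: inhabits.
  (* The opposite of [act_on l] and [act_on] of the opposite module category agree in data but not
     in proofs, so the adjunction is rebuilt from its fields. *)
  by have := adjunction_op adj; case=> *; apply: Adjunction; eassumption.
- by move=> x /projective_op px; apply/projective_op/pres.
- move=> p /projective_op /gen [x [px s]]; exists x; split; first exact/projective_op.
  exact: (@direct_summand_op k M p (x ▷ l)).1 s.
- exact: (abelian_op M).2 ab.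
- exact: (enough_projectives_op M).2 en.
- exact: (right_exact2_op _).2 ex.
- exists (funop G); apply: inhabits; case: adj => u c un cn cu uc.
  apply: (@Adjunction k M C (funop G) (act_on l) c u).
  + by move=> a b f; apply/esym/(cn b a f).
  + by move=> a b f; apply/esym/(un b a f).
  + exact: uc.
  + exact: cu.
- by move=> x px; apply/projective_op/pres/projective_op.
- move=> p /projective_op /gen [x [px s]]; exists x; split; first exact/projective_op.
  have [_ h] := @direct_summand_op k M p (act (modstr M) x l); exact: h s.
Qed.

Definition strong_op (M N : module_category C) (F : functor M N)
  (s : strong_structure F) :
  @strong_structure k (mop C) (modop M) (modop N) (fop F).
Proof.
apply: (@StrongStructure k (mop C) (modop M) (modop N) (fop F)
  (fun x m => iso_op (strong s x m))); split.
- by move=> x x' m m' f g; apply/esym/strong_bwd_nat.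
- by move=> x y m; apply: strong_bwd_assoc'.
- by move=> m; apply: strong_bwd_unit.
Defined.

Definition strong_unop (M N : module_category C) (F : functor (modop M) (modop N))
  (s : strong_structure F) : @strong_structure k C M N (funop F).
Proof.
apply: (@StrongStructure k C M N (funop F) (fun x m => iso_unop (strong s x m))); split.
- by move=> x x' m m' f g; apply/esym/(strong_bwd_nat s).
- by move=> x y m; apply: (strong_bwd_assoc' s).
- by move=> m; apply: (strong_bwd_unit s).
Defined.

End OppositeModules.

(** * Transport of a module structure along an equivalence *)

Section Transport.
Context (k : fieldType) (C : monoidal_category k) (A : category k)
  (N : module_category C) (Φ : functor A N).
Hypotheses (Φf : faithful Φ) (Φu : full Φ) (Φs : ess_surj Φ).

Let ob x a : A := projT1 (ess_surj_choice Φs (x ▷ Φ a)).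
Let i x a : iso (Φ (ob x a)) (x ▷ Φ a) := projT2 (ess_surj_choice Φs (x ▷ Φ a)).
Let pre a b (g : hom (Φ a) (Φ b)) : hom a b := preim Φu g.
Let preE a b (g : hom (Φ a) (Φ b)) : fmap Φ (pre g) = g := preimK Φu g.

(** [ob x a] is a chosen object whose image under [Φ] is isomorphic to [x ▷ Φ a]. The choice makes
    [Φ] strong with the isomorphisms [i] as constraint, and all axioms are checked in [N]. *)
Definition transport_act : bifunctor C A A.
Proof.
exists ob (fun x x' a a' f g => pre (bwd (i x' a') ∘ (f ▷h fmap Φ g) ∘ fwd (i x a))).
- move=> x x' a a' g l f h; apply: Φf.
  by rewrite fmap_lin !preE bmap_linl comp_linr comp_linl.
- move=> x x' a a' f l g h; apply: Φf.
  by rewrite !fmap_lin !preE bmap_linr comp_linr comp_linl.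
- by move=> x a; apply: Φf; rewrite preE !fmap1 bmap1 compm1 bwdK.
- move=> x x' x'' a a' a'' f' f g' g; apply: Φf.
  by rewrite !fmapM !preE bmapM !compA (reA (fwdK (i x' a'))) compm1.
Defined.

Lemma transport_actE x x' a a' (f : hom x x') (g : hom a a') :
  fwd (i x' a') ∘ fmap Φ (bmap transport_act f g) = (f ▷h fmap Φ g) ∘ fwd (i x a).
Proof. by rewrite /= preE !compA fwdK comp1m. Qed.

Definition transport_assoc x y a :
    iso (transport_act (x ⊗ y) a) (transport_act x (transport_act y a)) :=
  preim_iso Φf Φu (iso_comp (iso_sym (i x (ob y a)))
    (iso_comp (fmap_iso (bif_left (act (modstr N)) x) (iso_sym (i y a)))
      (iso_comp (aso x y (Φ a)) (i (x ⊗ y) a)))).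

Definition transport_unit a : iso (transport_act tunit a) a :=
  preim_iso Φf Φu (iso_comp (uno (Φ a)) (i tunit a)).

Lemma transport_assocE x y a :
  (1_x ▷h fwd (i y a)) ∘ fwd (i x (transport_act y a)) ∘ fmap Φ (fwd (transport_assoc x y a)) =
  fwd (aso x y (Φ a)) ∘ fwd (i (x ⊗ y) a).
Proof.
rewrite preimK /= !compA (reA (fwdK _)) compm1 -bmapM fwdK comp1m bmap1.
by rewrite comp1m.
Qed.

Lemma transport_unitE a :
  fmap Φ (fwd (transport_unit a)) = fwd (uno (Φ a)) ∘ fwd (i tunit a).
Proof. exact: preimK. Qed.

Let i2 x y a : iso (Φ (transport_act x (transport_act y a))) (x ▷ y ▷ Φ a) :=
  iso_comp (fmap_iso (bif_left (act (modstr N)) x) (i y a)) (i x (transport_act y a)).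

Let i2E x y a : fwd (i2 x y a) = (1_x ▷h fwd (i y a)) ∘ fwd (i x (transport_act y a)).
Proof. by []. Qed.

Let nat2 x x' y y' a b (f : hom x x') (g : hom y y') (h : hom a b) :
  fwd (i2 x' y' b) ∘ fmap Φ (bmap transport_act f (bmap transport_act g h)) =
  (f ▷h (g ▷h fmap Φ h)) ∘ fwd (i2 x y a).
Proof.
rewrite !i2E -compA transport_actE compA -bmapM comp1m transport_actE.
by rewrite compA -bmapM compm1.
Qed.

Definition transport_str : module_structure C A.
Proof.
exists transport_act transport_assoc transport_unit.
- move=> x x' y y' a b f g h; apply: Φf; rewrite !fmapM.
  apply: (fwd_inj (i := i2 x' y' b)).
  rewrite !compA nat2 !i2E transport_assocE -(compA _ (fwd (i (x' ⊗ y') b))).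
  rewrite transport_actE compA aassoc_nat -compA -transport_assocE.
  by rewrite !compA.
- move=> a b f; apply: Φf; rewrite !fmapM !transport_unitE -compA transport_actE.
  by rewrite compA aunit_nat compA.
- move=> x y z a; apply: Φf; rewrite !fmapM.
  pose i3 := iso_comp (fmap_iso (bif_left (act (modstr N)) x) (i2 y z a))
    (i x (transport_act y (transport_act z a))).
  apply: (fwd_inj (i := i3)).
  have e3 : fwd i3 = (1_x ▷h fwd (i2 y z a)) ∘ fwd (i x (transport_act y (transport_act z a))).
    by [].
  rewrite !e3 !compA.
  (* After [i3] the two sides become the two sides of the pentagon of [N] at [Φ a]. *)
  transitivity (fwd (aso x y (z ▷ Φ a)) ∘ fwd (aso (x ⊗ y) z (Φ a)) ∘ fwd (i ((x ⊗ y) ⊗ z) a)).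
    rewrite i2E bmap_comp_idl (reA3 (transport_assocE x y (transport_act z a))) !compA.
    by rewrite -aassoc_nat bmap1 (reA3 (transport_assocE (x ⊗ y) z a)) !compA.
  have e : (1_x ▷h fwd (i2 y z a)) ∘ (1_x ▷h fmap Φ (fwd (transport_assoc y z a))) =
      (1_x ▷h fwd (aso y z (Φ a))) ∘ (1_x ▷h fwd (i (y ⊗ z) a)).
    by rewrite -!bmap_comp_idl i2E transport_assocE.
  rewrite (reA (transport_actE (1_x) (fwd (transport_assoc y z a)))) !compA e.
  rewrite (reA3 (transport_assocE x (y ⊗ z) a)) !compA.
  rewrite (reA (transport_actE (fwd (tassoc x y z)) (1_a))) !compA fmap1.
  by rewrite apentagon.
- move=> x a; apply: Φf; rewrite !fmapM.
  apply: (fwd_inj (i := i x a)).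
  rewrite !compA !transport_actE transport_unitE bmap_comp_idl fmap1.
  by rewrite (reA3 (transport_assocE x tunit a)) !compA atriangle.
Defined.

Definition transport_strong :
  @strong_structure k C (ModuleCategory transport_str) N Φ.
Proof.
refine (@StrongStructure k C (ModuleCategory transport_str) N Φ
  (fun x a => iso_sym (i x a)) _).
split=> [x x' a b f g|x y a|a] /=.
- by apply/esym/iso_eql; rewrite compA transport_actE -compA fwdK compm1.
- apply: (fwd_inj (i := i2 x y a)).
  change (fwd (i2 x y a) ∘
      (fmap Φ (fwd (transport_assoc x y a)) ∘ bwd (i (x ⊗ y) a)) =
    fwd (i2 x y a) ∘ (bwd (i x (transport_act y a)) ∘ (1_x ▷h bwd (i y a))
      ∘ fwd (aso x y (Φ a)))).
  rewrite !compA i2E transport_assocE (reA (fwdK (i (x ⊗ y) a))) compm1.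
  rewrite (reA (fwdK (i x (transport_act y a)))) compm1.
  by rewrite -bmapM fwdK comp1m bmap1 comp1m.
- rewrite [X in X ∘ _](transport_unitE a) -compA fwdK.
  exact: compm1.
Defined.

End Transport.

(** An equivalence preserves and reflects cokernels, and the constraint of [F] identifies the two
    actions. *)
Lemma strong_right_exact2 k (C : monoidal_category k) (M N : module_category C)
    (F : functor M N) :
  strong_structure F -> is_equivalence F -> right_exact2 (act (modstr N)) ->
  right_exact2 (act (modstr M)).
Proof.
move=> s eF [ex1 ex2]; have Fex := equivalence_right_exact eF.
have refl := reflect_cokernel (equivalence_faithful eF) (equivalence_full eF).
split=> [x a b c f g kfg|m x y z f g kfg]; apply: refl.
- apply: cokernel_iso (strong s x a) (strong s x b) (strong s x c) _ _ (ex1 x _ _ _ _ _ (Fex _ _ _ _ _ kfg)).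
  + exact: strong_nat.
  + exact: strong_nat.
- apply: cokernel_iso (strong s x m) (strong s y m) (strong s z m) _ _ (ex2 (F m) _ _ _ _ _ kfg).
  + by rewrite /= -(strong_nat s) fmap1.
  + by rewrite /= -(strong_nat s) fmap1.
Qed.

(** * Comonads as monads on the opposite module category *)

Section OppositeComonad.
Context (k : fieldType) (C : monoidal_category k) (M : module_category C)
  (S : oplax_module_comonad M).

Lemma oplax_bwd_assoc x y m :
  oplax S (x ⊗ y) m ∘ fmap S (bwd (aso x y m)) =
  bwd (aso x y (S m)) ∘ ((1_x ▷h oplax S y m) ∘ oplax S x (y ▷ m)).
Proof.
apply/iso_eql; rewrite compA (oplax_assoc (oplaxP S)) -compA -fmapM fwdK fmap1.
exact: compm1.
Qed.

Lemma oplax_bwd_unit m :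
  oplax S tunit m ∘ fmap S (bwd (uno m)) = bwd (uno (S m)).
Proof.
rewrite -[RHS]compm1 -(fmap1 S); apply/iso_eql.
by rewrite compA (oplax_unit (oplaxP S)) -fmapM fwdK.
Qed.

Definition comonad_op : lax_module_monad (modop M).
Proof.
apply: (@LaxModuleMonad k (mop C) (modop M) (fop S) (delta S) (cou S)
  _ _ _ _ _ (oplax S)).
- by move=> a b f; apply/esym/(@delta_nat _ _ _ S b a f).
- by move=> a b f; apply/esym/(@cou_nat _ _ _ S b a f).
- exact: (delta_assoc S).
- exact: (delta_coul S).
- exact: (delta_cour S).
- split.
  + by move=> x x' m m' f g; apply/esym/(oplax_nat (oplaxP S)).
  + exact: oplax_bwd_assoc.
  + exact: oplax_bwd_unit.
- exact: (oplax_cou S).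
- by move=> x m; rewrite [LHS](oplax_delta S) -compA.
Defined.

Local Notation T := comonad_op.

Definition comodule_of (a : modules T) : comodules S :=
  @SComod k C M S (tm_ob a) (tm_act a) (tm_unit a) (tm_assoc a).

Definition module_of (a : comodules S) : modules T :=
  @TMod k (mop C) (modop M) T (sc_ob a) (sc_coact a) (sc_counit a) (sc_coassoc a).

Definition comodule_map (a b : modules T) (f : tm_hom a b) :
    @hom k (comodules S) (comodule_of b) (comodule_of a) :=
  @sc_mk k C M S (comodule_of b) (comodule_of a) (lin_val f) (esym (tm_homP f)).

(* The two categories are not convertible: their maps are the solutions of the
   same equation with its two sides exchanged. *)
Definition modules_to_comodules : functor (modules T) (op (comodules S)).
Proof.
apply: (@Functor k (modules T) (op (comodules S)) comodule_of comodule_map).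
- by move=> a b l f g; apply: val_inj.
- by move=> a; apply: val_inj.
- by move=> a b c g f; apply: val_inj.
Defined.

Lemma modules_to_comodules_equivalence : is_equivalence modules_to_comodules.
Proof.
apply: ff_es_equivalence => [a b f g /(congr1 (fun u : sc_hom _ _ => lin_val u)) e|a b g|d].
- exact: val_inj.
- exists (@tm_mk k (mop C) (modop M) T a b (lin_val (g : sc_hom _ _)) (esym (sc_homP g))).
  exact: val_inj.
- exists (module_of d); apply: inhabits.
  have e : fmap S (1_(sc_ob d)) ∘ sc_coact d = sc_coact d ∘ 1_(sc_ob d).
    by rewrite fmap1 comp1m compm1.
  apply: (@Iso k (op (comodules S)) (comodule_of (module_of d)) d
    (@sc_mk k C M S d (comodule_of (module_of d)) (1_(sc_ob d)) e)
    (@sc_mk k C M S (comodule_of (module_of d)) d (1_(sc_ob d)) e)).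
  + by apply: val_inj; apply: comp1m.
  + by apply: val_inj; apply: comp1m.
Qed.

(** An equality and not just an isomorphism, so that the distinguished object of the module side can
    be rewritten into [S1]. *)
Lemma cofree_comoduleE (m : M) :
  modules_to_comodules (free_module T m) = cofree_comodule S m.
Proof.
rewrite /= /comodule_of /cofree_comodule /=.
by congr SComod; apply: proof_irrelevance.
Qed.

End OppositeComonad.

Section ComonadDuality.
Context (k : fieldType) (C : monoidal_category k) (M : module_category C)
  (S : oplax_module_comonad M).
Local Notation T := (comonad_op S).
Local Notation Θ := (modules_to_comodules S).

(** The Kleisli category of the opposite monad and the opposite of the coKleisli category share
    objects, maps and identities, but their compositions are bracketed differently. The opposite of
    the inclusion is therefore retyped, with one use of associativity. *)
Definition cokleisli_incl_op : functor (kleisli T) (op (comodules S)).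
Proof.
apply: (@Functor k (kleisli T) (op (comodules S)) (cofree_comodule S)
  (fun a b (f : hom (S b) (a : M)) => fmap (cokleisli_incl S) (f : @hom k (cokleisli_cat S) b a))).
- move=> a b; exact: (@fmap_lin k _ _ (cokleisli_incl S) b a).
- move=> a; exact: (fmap1 (cokleisli_incl S) a).
- move=> a b c g f.
  refine (etrans (congr1 (fun u : @hom k (cokleisli_cat S) c a => fmap (cokleisli_incl S) u) _)
    (@fmapM k _ _ (cokleisli_incl S) c b a f g)).
  exact: (@compA k M _ _ _ _ f (fmap S (g : hom (S c) (b : M))) (delta S c)).
Defined.

Lemma kleisli_incl_op_hom (m : M) :
  fmap S (1_(S m)) ∘ delta S m = delta S m ∘ 1_(S m).
Proof. by rewrite fmap1 comp1m compm1. Qed.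

Definition kleisli_incl_op_iso (m : M) :
  @iso k (op (comodules S)) (Θ (kleisli_incl T m)) (cofree_comodule S m).
Proof.
apply: (@Iso k (op (comodules S)) (Θ (kleisli_incl T m)) (cofree_comodule S m)
  (@sc_mk k C M S (cofree_comodule S m) (Θ (kleisli_incl T m)) _ (kleisli_incl_op_hom m))
  (@sc_mk k C M S (Θ (kleisli_incl T m)) (cofree_comodule S m) _ (kleisli_incl_op_hom m))).
- by apply: val_inj; apply: comp1m.
- by apply: val_inj; apply: comp1m.
Defined.

Definition kleisli_incl_op : nat_iso (fcomp Θ (kleisli_incl T)) cokleisli_incl_op.
Proof.
apply: (@NatIso k (kleisli T) (op (comodules S)) (fcomp Θ (kleisli_incl T))
  cokleisli_incl_op kleisli_incl_op_iso).
move=> a b f; apply: val_inj.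
by apply: (etrans (compm1 _) (esym (comp1m _))).
Defined.

Definition cokleisli_strong_op (E : module_structure C (comodules S))
  (s : @strong_structure k C (cokleisli S) (ModuleCategory E) (cokleisli_incl S)) :
  @strong_structure k (mop C) (kleisli T) (modop (ModuleCategory E)) cokleisli_incl_op.
Proof.
have t := strong_op s.
refine (@StrongStructure k (mop C) (kleisli T) (modop (ModuleCategory E))
  cokleisli_incl_op (fun x m => strong t x m) _); split.
- exact: (lax_nat (strongP t)).
- exact: (lax_assoc (strongP t)).
- exact: (lax_unit (strongP t)).
Defined.

Definition cokleisli_strong_unop (E : module_structure (mop C) (op (comodules S)))
  (s : @strong_structure k (mop C) (kleisli T) (ModuleCategory E) cokleisli_incl_op) :
  @strong_structure k C (cokleisli S) (ModuleCategory (strunop E)) (cokleisli_incl S).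
Proof.
refine (@StrongStructure k C (cokleisli S) (ModuleCategory (strunop E))
  (cokleisli_incl S) (fun x m => iso_unop (strong s x m)) _); split.
- by move=> x x' m m' f g; apply/esym/(@strong_bwd_nat _ _ _ _ _ s x' x m' m f g).
- by move=> x y m; exact: (strong_bwd_assoc' s x y m).
- by move=> m; exact: (strong_bwd_unit s m).
Defined.

(** Transport along [Θ] makes [Θ] strong. The Kleisli inclusion is isomorphic to the opposite of the
    coKleisli inclusion followed by the quasi-inverse [Ω], and [Ω] is strong as the inverse of a
    strong functor. *)
Lemma extended_of_coextended (E : module_structure C (comodules S)) :
  extended_from_cokleisli E ->
  exists E' : module_structure (mop C) (modules T), extended_from_kleisli E' /\
    inhabited (@strong_structure k (mop C) (ModuleCategory E')
      (modop (ModuleCategory E)) Θ).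
Proof.
move=> [Eex [s]]; have eΘ := modules_to_comodules_equivalence S.
pose N := modop (ModuleCategory E).
pose Θf : functor (modules T) N := Θ.
have f : faithful Θf by exact: equivalence_faithful eΘ.
have u : full Θf by exact: equivalence_full eΘ.
have es : ess_surj Θf by exact: equivalence_ess_surj eΘ.
have t := transport_strong f u es.
exists (transport_str f u es); split; last exact: inhabits t.
split; first exact: (strong_right_exact2 t eΘ (proj1 (right_exact2_op _) Eex)).
have [Ω [[n] [n']]] := eΘ.
apply: inhabits.
apply: (@strong_nat_iso k (mop C) (kleisli T) (ModuleCategory (transport_str f u es))
  (fcomp Ω cokleisli_incl_op)).
  by apply: nat_iso_sym; apply: nat_iso_unwhisker kleisli_incl_op n.
exact: (strong_comp (cokleisli_strong_op s) (strong_inverse t f u n')).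
Qed.

(** Here the structure travels along the quasi-inverse [Ω] to the opposite of the comodules, and
    [strunop] reads it on the comodules themselves. *)
Lemma coextended_of_extended (E' : module_structure (mop C) (modules T)) :
  extended_from_kleisli E' ->
  exists E : module_structure C (comodules S), extended_from_cokleisli E.
Proof.
move=> [Eex [s]]; have eΘ := modules_to_comodules_equivalence S.
have [Ω [n n']] := eΘ; have eΩ := equivalence_sym n n'.
pose Ωf : functor (op (comodules S)) (ModuleCategory E') := Ω.
have f : faithful Ωf by exact: equivalence_faithful eΩ.
have u : full Ωf by exact: equivalence_full eΩ.
have es : ess_surj Ωf by exact: equivalence_ess_surj eΩ.
have t := transport_strong f u es.
have ex := strong_right_exact2 t eΩ Eex.
exists (strunop (transport_str f u es)); split; first exact: left_exact2_unop ex.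
case: n => n; apply: inhabits; apply: cokleisli_strong_unop.
apply: (@strong_nat_iso k (mop C) (kleisli T) (ModuleCategory (transport_str f u es))
  (fcomp Θ (kleisli_incl T))); first exact: kleisli_incl_op.
exact: (strong_comp s (strong_inverse t f u n)).
Qed.

End ComonadDuality.

Lemma module_equivalent_unop k (C : monoidal_category k) (M N : module_category C) :
  module_equivalent (modop M) (modop N) -> module_equivalent M N.
Proof.
move=> [F [[s] eF]]; exists (funop F); split; first exact: inhabits (strong_unop s).
have [G [[n] [n']]] := eF; exists (funop G); split; apply: inhabits.
- apply: (@NatIso k M M (fcomp (funop G) (funop F)) (fid M)
    (fun a => iso_unop (niso n a))).
  by move=> a b f; apply/esym/(@nat_iso_bwd k _ _ _ _ n b a f).
- apply: (@NatIso k N N (fcomp (funop F) (funop G)) (fid N)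
    (fun a => iso_unop (niso n' a))).
  by move=> a b f; apply/esym/(@nat_iso_bwd k _ _ _ _ n' b a f).
Qed.

Lemma lax_module_monad_irr k (C : monoidal_category k) (B : module_category C)
    (ob : B -> B) (fm : forall a b, hom a b -> hom (ob a) (ob b))
    l1 i1 m1 l2 i2 m2
    (mu : forall m, hom (ob (ob m)) (ob m)) (eta : forall m, hom m (ob m))
    (lax : forall x m, hom (x ▷ ob m) (ob (x ▷ m)))
    p1 p2 p3 p4 p5 p6 p7 p8 q1 q2 q3 q4 q5 q6 q7 q8 :
  @LaxModuleMonad k C B (@Functor k B B ob fm l1 i1 m1) mu eta p1 p2 p3 p4 p5 lax p6 p7 p8 =
  @LaxModuleMonad k C B (@Functor k B B ob fm l2 i2 m2) mu eta q1 q2 q3 q4 q5 lax q6 q7 q8.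
Proof.
have ? := proof_irrelevance _ l1 l2; have ? := proof_irrelevance _ i1 i2.
have ? := proof_irrelevance _ m1 m2; subst l2 i2 m2.
have ? := proof_irrelevance _ p1 q1; have ? := proof_irrelevance _ p2 q2.
have ? := proof_irrelevance _ p3 q3; have ? := proof_irrelevance _ p4 q4.
have ? := proof_irrelevance _ p5 q5; have ? := proof_irrelevance _ p6 q6.
have ? := proof_irrelevance _ p7 q7; have ? := proof_irrelevance _ p8 q8.
by subst.
Qed.

(** The dual of the oplax mate is the lax mate by conversion, so the two monads have the same data
    and proof irrelevance identifies them. *)
Lemma comonad_op_adj k (C : monoidal_category k) (M N : module_category C)
    (F : functor M N) (G : functor N M) (s : strong_structure G)
    (adj : adjunction F G) :
  comonad_op (adj_comonad s adj) = adj_monad (strong_op s) (adjunction_op adj).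
Proof. exact: lax_module_monad_irr. Qed.

(** * Comodules *)

Section AbelianEquivalence.
Context (k : fieldType).

Lemma ff_es_epi (C D : category k) (F : functor C D) a b (e : hom a b) :
  faithful F -> full F -> ess_surj F -> is_epi e -> is_epi (fmap F e).
Proof.
move=> Ff Fu Fs ee d u v uv; have [c [i]] := Fs d.
have [u' uE] := Fu _ _ (bwd i ∘ u); have [v' vE] := Fu _ _ (bwd i ∘ v).
apply: (fwd_inj (i := iso_sym i)); rewrite /= -uE -vE; congr (fmap F _).
by apply/ee/Ff; rewrite !fmapM uE vE -!compA uv.
Qed.

Lemma faithful_op (C D : category k) (F : functor C D) : faithful F -> faithful (fop F).
Proof. by move=> Ff a b; apply: Ff. Qed.

Lemma full_op (C D : category k) (F : functor C D) : full F -> full (fop F).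
Proof. by move=> Fu a b; apply: Fu. Qed.

Lemma ess_surj_op (C D : category k) (F : functor C D) : ess_surj F -> ess_surj (fop F).
Proof. by move=> Fs d; have [c [i]] := Fs d; exists c; apply: inhabits (iso_op i). Qed.

(** Only the cokernel half of the abelian axioms, so that applying it to the opposite functor yields
    the kernel half. *)
Lemma pullback_cokernels (C D : category k) (F : functor C D) :
  faithful F -> full F -> ess_surj F -> abelian D ->
  (forall (a b : C) (f : hom a b), exists c (g : hom b c), is_cokernel f g) /\
  (forall (b c : C) (g : hom b c), is_epi g -> exists a (f : hom a b), is_cokernel f g).
Proof.
move=> Ff Fu Fs Dab; split=> [a b f|b c g eg].
- have [d [g kg]] := ab_cokernel Dab (fmap F f); have [c [i]] := Fs d.
  have [g' gE] := Fu _ _ (bwd i ∘ g); exists c, g'; apply: (reflect_cokernel Ff Fu).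
  apply: (@cokernel_iso _ _ _ _ _ _ _ _ _ _ _ _ (iso_refl _) (iso_refl _) (iso_sym i) _ _ kg).
  + by rewrite comp1m compm1.
  + by rewrite /= gE compm1.
- have [d [f kf]] := ab_epi Dab (ff_es_epi Ff Fu Fs eg); have [a [i]] := Fs d.
  have [f' fE] := Fu _ _ (f ∘ fwd i); exists a, f'; apply: (reflect_cokernel Ff Fu).
  apply: (@cokernel_iso _ _ _ _ _ _ _ _ _ _ _ _ (iso_sym i) (iso_refl _) (iso_refl _) _ _ kf).
  + by rewrite /= fE comp1m -compA fwdK compm1.
  + by rewrite comp1m compm1.
Qed.

Lemma abelian_equivalence (C D : category k) (F : functor C D) :
  is_equivalence F -> abelian D -> abelian C.
Proof.
move=> eF Dab.
have Ff := equivalence_faithful eF; have Fu := equivalence_full eF.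
have Fs := equivalence_ess_surj eF.
have [cok epi] := pullback_cokernels Ff Fu Fs Dab.
have [ker mono] := pullback_cokernels (faithful_op Ff) (full_op Fu) (ess_surj_op Fs)
  (proj1 (abelian_op D) Dab).
split=> [||b c g|//|a b f mf|//].
- have [z [z1 z2]] := ab_zero Dab; have [c [i]] := Fs z; exists c.
  split=> a f; apply: Ff; rewrite fmap0.
  + by rewrite -[LHS]compm1 -(bwdK i) compA [fmap F f ∘ _]z1 comp0m.
  + by rewrite -[LHS]comp1m -(bwdK i) -compA [fwd i ∘ _]z2 compm0.
- move=> a b; have [s [i [j [p [q [pi qj pj qi sum]]]]]] := ab_biproduct Dab (F a) (F b).
  have [c [l]] := Fs s; exists c.
  have [i' iE] := Fu _ _ (bwd l ∘ i); have [j' jE] := Fu _ _ (bwd l ∘ j).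
  have [p' pE] := Fu _ _ (p ∘ fwd l); have [q' qE] := Fu _ _ (q ∘ fwd l).
  have cancel x y (u : hom s x) (v : hom y s) : u ∘ fwd l ∘ (bwd l ∘ v) = u ∘ v.
    by rewrite compA (reA (fwdK l)) compm1.
  exists i', j', p', q'; split; apply: Ff;
    rewrite ?fmapD !fmapM ?fmap1 ?fmap0 ?iE ?jE ?pE ?qE ?cancel //.
  rewrite -!compA -!compmD !compA -compDm sum comp1m.
  exact: bwdK.
- by have [a [f kf]] := ker c b g; exists a, f.
- by have [c [g kg]] := mono b a f mf; exists c, g.
Qed.

End AbelianEquivalence.

Lemma right_exact_op k (C D : category k) (F : functor C D) :
  left_exact F <-> right_exact (fop F).
Proof. by split=> h a b c f g; apply: h. Qed.

Section Coreconstruction.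
Context (k : fieldType) (C : monoidal_category k).
Hypotheses (Cab : abelian C) (Ci : enough_injectives C).

Lemma inj_conditions_radj_exact (M : module_category C) (l : M)
    (L : functor M (regular C)) (adj : adjunction L (act_on l)) :
  inj_conditions l -> right_exact (fop L).
Proof.
move=> il; apply: (radj_right_exact (adjunction_op adj)).
- exact: (proj1 (abelian_op C)).
- exact: (proj1 (abelian_op M) (ic_abelian il)).
- exact: (proj1 (enough_projectives_op C)).
- by move=> x /projective_op ix; apply/projective_op/(ic_preserve il).
Qed.

Lemma adj_comonad_left_exact (M : module_category C) (l : M)
    (L : functor M (regular C)) (adj : adjunction L (act_on l)) :
  inj_conditions l -> left_exact (adj_comonad (act_on_strong l) adj).
Proof.
move=> il a b c f g kfg.
apply: (proj2 (right_exact_op L) (inj_conditions_radj_exact adj il)).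
exact: (ic_exact il).2.
Qed.

(** The opposite adjunction retyped over the regular module category of [mop C], the source that
    [act_on] requires. *)
Definition act_on_adjunction_op (M : module_category C) (l : M)
    (L : functor M (regular C)) (adj : adjunction L (act_on l)) :
  adjunction (act_on (M := modop M) l)
    (fop L : functor (modop M) (regular (mop C))).
Proof.
refine (@Adjunction k (regular (mop C)) (modop M) (act_on (M := modop M) l) (fop L)
  (adj_counit adj) (adj_unit adj) _ _ _ _).
- exact: (unit_nat (adjunction_op adj)).
- exact: (counit_nat (adjunction_op adj)).
- exact: (unit_counit adj).
- exact: (counit_unit adj).
Defined.

Lemma comodule_category_reconstruction (M : module_category C) (l : M)
    (L : functor M (regular C)) (adj : adjunction L (act_on l))
    (E : module_structure C (comodules (adj_comonad (act_on_strong l) adj))) :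
  inj_conditions l -> extended_from_cokleisli E ->
  module_equivalent M (ModuleCategory E).
Proof.
move=> il e; apply: module_equivalent_unop.
have [E' [e' [t]]] := extended_of_coextended e.
(* [E'] lives over the opposite of the comonad, which equals the monad of the opposite adjunction
   only propositionally; a variable monad allows the equation to be substituted. *)
have rec (T : lax_module_monad (modop (regular C))) (E0 : module_structure (mop C) (modules T)) :
    T = comonad_op (adj_comonad (act_on_strong l) adj) -> extended_from_kleisli E0 ->
    module_equivalent (modop M) (ModuleCategory E0).
  rewrite comonad_op_adj => eT; move: E0; rewrite {}eT => E0.
  apply: comparison_module_equivalent.
  - exact: (proj1 (abelian_op M) (ic_abelian il)).
  - exact: inj_conditions_radj_exact adj il.
  - have h := counit_epi (adj := act_on_adjunction_op adj) (proj1 (proj_conditions_op l) il).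
    move=> m; exact: (h m).
  - exact: (proj1 (right_exact2_op _) (ic_exact il)).
apply: module_equivalent_trans (rec _ _ erefl e') _.
exists (modules_to_comodules _); split; first exact: inhabits t.
exact: modules_to_comodules_equivalence.
Qed.

Lemma coextended_unique (B : module_category C) (S : oplax_module_comonad B)
    (E E' : module_structure C (comodules S)) :
  extended_from_cokleisli E -> extended_from_cokleisli E' ->
  module_equivalent (ModuleCategory E) (ModuleCategory E').
Proof.
move=> /extended_of_coextended [E0 [e0 [t]]] /extended_of_coextended [E0' [e0' [t']]].
have eΘ := modules_to_comodules_equivalence S.
apply: module_equivalent_unop.
apply: (@module_equivalent_trans _ _ _ (ModuleCategory E0)).
  by apply: module_equivalent_sym; exists (modules_to_comodules S).
apply: module_equivalent_trans (extended_unique e0 e0') _.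
by exists (modules_to_comodules S).
Qed.

Hypothesis Cex : left_exact2 (tens (m := C)).

Lemma extended_from_cokleisli_exists (S : oplax_module_comonad (regular C)) :
  left_exact S -> exists E : module_structure C (comodules S), extended_from_cokleisli E.
Proof.
move=> /right_exact_op Sex.
have [|||E e] := @extended_from_kleisli_exists _ _ _ (comonad_op S).
- exact: (proj1 (abelian_op C)).
- exact: (proj1 (right_exact2_op _) Cex).
- exact: Sex.
- exact: coextended_of_extended e.
Qed.

Lemma proj_conditions_regular_op : proj_conditions (M := modop (regular C)) tunit.
Proof.
apply: proj_conditions_equivalence.
- exact: (proj1 (abelian_op C)).
- exact: (proj1 (abelian_op C)).
- exact: (proj1 (enough_projectives_op C)).
- exact: (proj1 (right_exact2_op _) Cex).
exists (fid (op C)); split; apply: inhabits.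
- apply: (@NatIso k (op C) (op C)
    (fcomp (fid (op C)) (act_on (M := modop (regular C)) tunit)) (fid (op C))
    (fun x => runit (x : mop C))); exact: (@runit_nat k (mop C)).
- apply: (@NatIso k (op C) (op C)
    (fcomp (act_on (M := modop (regular C)) tunit) (fid (op C))) (fid (op C))
    (fun x => runit (x : mop C))); exact: (@runit_nat k (mop C)).
Qed.

(** The projective conditions hold for the modules of the opposite monad by the first half. The
    equivalence with the opposite of the comodules, a left adjoint of its quasi-inverse, then
    carries them over by [proj_conditions_ladj]. *)
Lemma inj_conditions_comodules (S : oplax_module_comonad (regular C))
    (E : module_structure C (comodules S)) :
  left_exact S -> extended_from_cokleisli E ->
  inj_conditions (M := ModuleCategory E) (cofree_comodule S (tunit : C)).
Proof.
move=> /right_exact_op Sex e; apply/proj_conditions_op.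
have [E0 [e0 [t]]] := extended_of_coextended e.
have pc := @proj_conditions_modules _ _ _ (comonad_op S) _ _ Sex e0 proj_conditions_regular_op.
have eΘ := modules_to_comodules_equivalence S.
have Nab : abelian (op (comodules S)).
  have [Ω [n n']] := eΘ; apply: abelian_equivalence (equivalence_sym n n') _.
  exact: pc_abelian pc.
rewrite -[cofree_comodule S _]cofree_comoduleE.
pose f := equivalence_faithful eΘ; pose g := equivalence_full eΘ.
pose h := equivalence_ess_surj eΘ.
apply: (@proj_conditions_ladj (k) (mop C) (ModuleCategory E0) (modop (ModuleCategory E))
  (modules_to_comodules S) (quasi_inverse f g h) t (quasi_inverse_adj f g h)) pc.
- move=> a b u; apply: equivalence_epi => //.
  apply: equivalence_sym (inhabits (quasi_inverse_unit f g h)) _.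
  exact: inhabits (quasi_inverse_counit f g h).
- by move=> n; apply: iso_epi.
- exact: Nab.
- exact: (proj1 (right_exact2_op _) (coext_exact e)).
Qed.

Lemma injective_bijection :
  mutually_inverse_mod (@ip_equiv k C) (@lec_equiv k C)
    (@pair_to_comonad k C) (@comonad_to_pair k C).
Proof.
pose D (S : left_exact_comonad C) (z : module_category C) :=
  exists2 E : module_structure C (comodules S), extended_from_cokleisli E & z = ModuleCategory E.
have ext (S : left_exact_comonad C) := extended_from_cokleisli_exists (@lec_exact _ _ S).
apply: (@mutually_inverse_mod_of k C _ _ (@ip_cat k C) D) => //.
- move=> T U; split=> [[E [E' [e [e' m]]]]|[_ [_ [[E e ->] [[E' e' ->] m]]]]].
    by exists (ModuleCategory E), (ModuleCategory E'); split; [exists E|split; [exists E'|]].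
  by exists E, E'.
- move=> [M l il]; have [L [adj]] := ic_adjoint il.
  by exists (LeftExactComonad (adj_comonad_left_exact adj il)), L, adj.
- move=> S; have [E e] := ext S.
  have c := inj_conditions_comodules (@lec_exact _ _ S) e.
  by exists (InjPair c), E, e, c.
- by move=> S; have [E e] := ext S; exists (ModuleCategory E), E.
- by move=> S _ _ [E e ->] [E' e' ->]; apply: coextended_unique.
- by move=> S _ [E [e [c ->]]]; exists E.
- move=> [M l il] [S Sex] _ [L [adj /= eS]] [E e ->]; rewrite /= in E e *.
  by move: E e Sex; rewrite eS => E e Sex; apply: comodule_category_reconstruction.
Qed.

End Coreconstruction.

Theorem mainTheorem15 (k : fieldType) (C : monoidal_category k)
    (Cab : abelian C) :
  (enough_projectives C -> right_exact2 (tens (m := C)) ->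
    (forall (M : module_category C) (l : M), proj_conditions l ->
      forall (G : functor M (regular C)) (adj : adjunction (act_on l) G),
      let T := adj_monad (act_on_strong l) adj in
      right_exact T /\
      (exists E, extended_from_kleisli (T := T) E) /\
      (forall E, extended_from_kleisli (T := T) E ->
        module_equivalent M (ModuleCategory E))) /\
    mutually_inverse_mod (@pp_equiv k C) (@rem_equiv k C)
      (@pair_to_monad k C) (@monad_to_pair k C)) /\
  (enough_injectives C -> left_exact2 (tens (m := C)) ->
    (forall (M : module_category C) (l : M), inj_conditions l ->
      forall (L : functor M (regular C)) (adj : adjunction L (act_on l)),
      let S := adj_comonad (act_on_strong l) adj in
      left_exact S /\
      (exists E, extended_from_cokleisli (S := S) E) /\
      (forall E, extended_from_cokleisli (S := S) E ->
        module_equivalent M (ModuleCategory E))) /\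
    mutually_inverse_mod (@ip_equiv k C) (@lec_equiv k C)
      (@pair_to_comonad k C) (@comonad_to_pair k C)).
Proof.
split=> [Cp Cex|Ci Cex]; split.
- move=> M l pl G adj T.
  have Tex : right_exact T := adj_monad_right_exact Cab Cp adj pl.
  split; first exact: Tex.
  split; first exact: (@extended_from_kleisli_exists _ _ (regular C)) Cab Cex Tex.
  by move=> E; apply: module_category_reconstruction.
- exact: projective_bijection.
- move=> M l il L adj S.
  have Sex : left_exact S := adj_comonad_left_exact Cab Ci adj il.
  split; first exact: Sex.
  split; first exact: (extended_from_cokleisli_exists Cab Cex Sex).
  by move=> E; apply: comodule_category_reconstruction.
- exact: injective_bijection.
Qed.
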